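(* Let $M$ be one of the following Riemannian manifolds: $(\mathrm{SU}(2),g_{\lambda,1,1})$ with $\lambda>1$; $(\mathrm{SU}(2),g_{1,1,\nu})$ with $0<\nu<1$; $(\mathrm{SL}(2,\mathbb R),g_{\lambda,1,1})$ with $\lambda>0$; or the $3$-dimensional Heisenberg Lie group $H_1$ with a left-invariant metric. Let $\mathcal L$ be the foliation of symmetry of $M$. Then $M/\mathcal L$ has an $\mathrm{Iso}_0(M)$-invariant Riemannian metric for which the projection $M\to M/\mathcal L$ is a Riemannian submersion.
   Context: Let $M$ be a homogeneous Riemannian manifold with Levi-Civita connection $\nabla$. The distribution of symmetry $\mathfrak s$ is defined by $$\mathfrak s_p=\{v\in T_pM:\ \text{there is a Killing field } X \text{ on } M \text{ with } X(p)=v \text{ and } (\nabla X)_p=0\}.$$ It is invariant under all isometries of $M$ and integrable (with totally geodesic leaves). Its maximal integral manifolds are called leaves of symmetry, and the foliation of symmetry $\mathcal L$ is the foliation by these leaves. $M/\mathcal L$ is the leaf space (with its quotient manifold structure), and $\mathrm{Iso}_0(M)$ is the identity component of the isometry group of $M$, which acts on $M/\mathcal L$ since isometries preserve $\mathcal L$. On $\mathrm{SU}(2)$, consider the basis of $\mathfrak{su}(2)$ given by $$X_1=\tfrac12\begin{pmatrix}i&0\\0&-i\end{pmatrix},\quad X_2=\tfrac12\begin{pmatrix}0&-1\\1&0\end{pmatrix},\quad X_3=\tfrac12\begin{pmatrix}0&-i\\-i&0\end{pmatrix}.$$ On $\mathrm{SL}(2,\mathbb R)$, consider the basis of $\mathfrak{sl}(2,\mathbb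 R)$ given by $$X_1=\begin{pmatrix}0&1\\-1&0\end{pmatrix},\quad X_2=\begin{pmatrix}0&1\\1&0\end{pmatrix},\quad X_3=\begin{pmatrix}1&0\\0&-1\end{pmatrix}.$$ In each case, for $\lambda,\mu,\nu>0$, $g_{\lambda,\mu,\nu}$ denotes the left-invariant metric whose inner product on the Lie algebra is represented in the basis $X_1,X_2,X_3$ by the matrix $\mathrm{diag}(\lambda,\mu,\nu)$. $H_1$ is $\mathbb R^3$ with the product $(x,y,z)(x',y',z')=(x+x',y+y',z+z'+\tfrac12(xy'-yx'))$. *)

(* Defs.v *)
From HB Require Import structures.
From mathcomp Require Import all_boot all_order all_algebra.
From mathcomp Require Import complex spectral.
From mathcomp Require Import all_classical all_reals all_analysis.

Set Implicit Arguments.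
Unset Strict Implicit.
Unset Printing Implicit Defensive.

Import Order.TTheory GRing.Theory Num.Theory.
Import numFieldNormedType.Exports.

Local Open Scope classical_set_scope.
Local Open Scope ring_scope.
Local Open Scope quotient_scope.

Section Smooth.
Context {R : realType} {V W : normedModType R}.

(* Used only for [V] finite-dimensional and [U] open; quantifying over all
   directions [v] is then the same as quantifying over a basis of [V]. *)
Fixpoint Ck (k : nat) (U : set V) (f : V -> W) : Prop :=
  (forall x, U x -> {for x, continuous f}) /\
  if k is k'.+1 then
    forall v, (forall x, U x -> derivable f x v) /\ Ck k' U ('D_v f)
  else True.

Definition smooth_on (U : set V) (f : V -> W) : Prop := forall k, Ck k U f.

End Smooth.

(* [cto] matters only on [cdom], and [cinv] only on [cimg]. *)
Record chart (R : realType) (M : topologicalType) (n : nat) := Chart {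
  cdom : set M;
  cto : M -> 'rV[R]_n;
  cinv : 'rV[R]_n -> M }.

Section Manifold.
Context {R : realType} {M : topologicalType} {n : nat}.
Implicit Types (A : set (chart R M n)) (c d : chart R M n).

Definition cimg c : set 'rV[R]_n := cto c @` cdom c.

Definition is_chart c : Prop :=
  [/\ open (cdom c), open (cimg c),
      (forall p, cdom c p -> cinv c (cto c p) = p),
      (forall p, cdom c p -> {for p, continuous (cto c)}) &
      (forall x, cimg c x -> {for x, continuous (cinv c)})].

End Manifold.

Section Maps.
Context {R : realType} {M N : topologicalType} {m n : nat}.

(* The expression of [f] in the charts [c] and [d], and its domain. *)
Definition loc (c : chart R M m) (d : chart R N n) (f : M -> N) :
  'rV[R]_m -> 'rV[R]_n := cto d \o f \o cinv c.

Definition loc_dom (c : chart R M m) (d : chart R N n) (f : M -> N) :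
  set 'rV[R]_m := [set x | cimg c x /\ cdom d (f (cinv c x))].

Definition smooth_map (A : set (chart R M m)) (B : set (chart R N n))
    (f : M -> N) : Prop :=
  continuous f /\
  forall c d, A c -> B d -> smooth_on (loc_dom c d f) (loc c d f).

End Maps.

Definition is_manifold (R : realType) (M : topologicalType) (n : nat)
    (A : set (chart R M n)) : Prop :=
  [/\ hausdorff_space M, @second_countable M,
      (forall c, A c -> is_chart c),
      (forall p, exists2 c, A c & cdom c p) &
      (forall c d, A c -> A d -> smooth_on (loc_dom c d id) (loc c d id))].

(* Tensor fields are given by their components in every chart: the value at
   [cinv c x] of a metric [g] (resp. of a vector field [X]) has components
   [g c x] (resp. [X c x]) in the chart [c]. Only charts of the atlas and
   points [x] of [cimg c] are relevant. *)
Definition metric (R : realType) (M : topologicalType) (n : nat) :=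
  chart R M n -> 'rV[R]_n -> 'M[R]_n.

Definition form (R : realType) (n : nat) (G : 'M[R]_n) (u v : 'rV[R]_n) : R :=
  (u *m G *m v^T) 0 0.

Section Isometries.
Context {R : realType} {M N : topologicalType} {m n : nat}.
Context (A : set (chart R M m)) (g : metric R M m).
Context (B : set (chart R N n)) (h : metric R N n).

Definition pullback_eq (f : M -> N) : Prop :=
  forall c d, A c -> B d -> forall x, loc_dom c d f x -> forall u v,
    form (h d (loc c d f x)) ('D_u (loc c d f) x) ('D_v (loc c d f) x) =
    form (g c x) u v.

Definition riemannian_submersion (f : M -> N) : Prop :=
  smooth_map A B f /\
  forall c d, A c -> B d -> forall x, loc_dom c d f x ->
    let df u := 'D_u (loc c d f) x in
    let horizontal u := forall w, df w = 0 -> form (g c x) u w = 0 in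
    (forall w, exists u, df u = w) /\
    (forall u v, horizontal u -> horizontal v ->
       form (h d (loc c d f x)) (df u) (df v) = form (g c x) u v).

End Isometries.

Section Riemannian.
Context {R : realType} {M : topologicalType} {n : nat}.
Context (A : set (chart R M n)) (g : metric R M n).

(* [pullback_eq] at [f := id] is the tensor transformation rule. *)
Definition is_metric : Prop :=
  (forall c, A c ->
    smooth_on (cimg c) (g c) /\
    forall x, cimg c x -> (g c x)^T = g c x /\
      forall v, v != 0 -> 0 < form (g c x) v v) /\
  pullback_eq A g A g id.

Definition is_isometry (f : M -> M) : Prop :=
  (exists f', [/\ cancel f f', cancel f' f, smooth_map A A f &
                  smooth_map A A f']) /\
  pullback_eq A g A g f.

(* The isometry group carries the compact-open topology. *)
Definition iso0 : set {compact-open, M -> M} :=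
  connected_component
    ([set f | is_isometry f] : set {compact-open, M -> M}) idfun.

Definition is_vector_field (X : chart R M n -> 'rV[R]_n -> 'rV[R]_n) : Prop :=
  (forall c, A c -> smooth_on (cimg c) (X c)) /\
  forall c d, A c -> A d -> forall x, loc_dom c d id x ->
    X d (loc c d id x) = 'D_(X c x) (loc c d id) x.

(* Christoffel symbols of the Levi-Civita connection, contracted with [u] and
   [v]: the vector [w] such that, for all [z],
   [2 g(w, z) = (D_u g)(v, z) + (D_v g)(u, z) - (D_z g)(u, v)]. *)
Definition christoffel (c : chart R M n) (x u v : 'rV[R]_n) : 'rV[R]_n :=
  (\row_k (2^-1 * (form ('D_u (g c) x) v (delta_mx 0 k)
                   + form ('D_v (g c) x) u (delta_mx 0 k)
                   - form ('D_(delta_mx 0 k) (g c) x) u v)))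
  *m invmx (g c x).

(* Levi-Civita covariant derivative of [X] in the direction [u]. *)
Definition nabla (X : chart R M n -> 'rV[R]_n -> 'rV[R]_n)
    (c : chart R M n) (x u : 'rV[R]_n) : 'rV[R]_n :=
  'D_u (X c) x + christoffel c x u (X c x).

(* The Lie derivative of [g] along [X] vanishes. *)
Definition is_killing (X : chart R M n -> 'rV[R]_n -> 'rV[R]_n) : Prop :=
  is_vector_field X /\
  forall c, A c -> forall x, cimg c x -> forall u v,
    form ('D_(X c x) (g c) x) u v
    + form (g c x) ('D_u (X c) x) v + form (g c x) u ('D_v (X c) x) = 0.

(* The distribution of symmetry at [cinv c x], in the chart [c]. *)
Definition symmetry_distr (c : chart R M n) (x : 'rV[R]_n) : set 'rV[R]_n :=
  [set v | exists X, [/\ is_killing X, X c x = v & forall u, nabla X c x u = 0]].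

(* [L] is the image of an injective immersion [f] of a connected manifold whose
   tangent spaces are the spaces of the distribution of symmetry. *)
Definition is_integral_manifold (L : set M) : Prop :=
  exists (N : topologicalType) (k : nat) (B : set (chart R N k)) (f : N -> M),
    [/\ is_manifold B, connected [set: N], smooth_map B A f & injective f] /\
    range f = L /\
    forall b c, B b -> A c -> forall y, loc_dom b c f y ->
      let df w := 'D_w (loc b c f) y in
      injective df /\ range df = symmetry_distr c (loc b c f y).

Definition is_leaf (L : set M) : Prop :=
  is_integral_manifold L /\
  forall L', is_integral_manifold L' -> L `<=` L' -> L' = L.

Definition same_leaf (p q : M) : bool :=
  `[< forall L, is_leaf L -> (L p <-> L q) >].

Fact same_leaf_refl : reflexive same_leaf.
Proof. by move=> p; apply/asboolP. Qed.

Fact same_leaf_sym : symmetric same_leaf.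
Proof.
by move=> p q; apply: asbool_equiv_eq; split=> H L lL;
   have [? ?] := H L lL; split.
Qed.

Fact same_leaf_trans : transitive same_leaf.
Proof.
move=> q p r /asboolP H1 /asboolP H2; apply/asboolP => L lL.
by have [? ?] := H1 L lL; have [? ?] := H2 L lL; split; auto.
Qed.

Definition leaf_equiv : equiv_rel M :=
  EquivRel same_leaf same_leaf_refl same_leaf_sym same_leaf_trans.

Definition leaf_space : topologicalType := quotient_topology {eq_quot leaf_equiv}.

Definition leaf_proj : M -> leaf_space := \pi_{eq_quot leaf_equiv}.

End Riemannian.

(* The quotient manifold structure of the leaf space is the one for which
   [leaf_proj] is a smooth submersion, which is part of
   [riemannian_submersion]. The first conjunct says that the fibres of
   [leaf_proj] are the leaves of symmetry. *)
Definition leaf_space_has_invariant_metric (R : realType) (M : topologicalType)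
    (n : nat) (A : set (chart R M n)) (g : metric R M n) : Prop :=
  (forall p, is_leaf A g [set q | leaf_proj A g q = leaf_proj A g p]) /\
  exists (k : nat) (B : set (chart R (leaf_space A g) k))
         (h : metric R (leaf_space A g) k),
    [/\ is_manifold B, is_metric B h,
        riemannian_submersion A g B h (leaf_proj A g) &
        forall f, iso0 A g f -> exists fbar : leaf_space A g -> leaf_space A g,
          fbar \o leaf_proj A g = leaf_proj A g \o f /\ is_isometry B h fbar].

Record embedded_group (R : realType) := EmbeddedGroup {
  eg_space :> topologicalType;
  eg_ambient : normedModType R;
  eg_emb : eg_space -> eg_ambient;
  eg_mul : eg_space -> eg_space -> eg_space;
  eg_one : eg_space }.

Section EmbeddedAtlas.
Context {R : realType} (G : embedded_group R).
Let emb := @eg_emb R G.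

(* The maximal atlas of [G] as an [n]-dimensional embedded submanifold: a chart
   has a smooth inverse, and is locally the restriction of a smooth map
   defined on an open subset of the ambient space. *)
Definition eg_atlas (n : nat) : set (chart R G n) :=
  [set c | [/\ is_chart c,
               smooth_on (cimg c) (emb \o cinv c) &
               forall p, cdom c p ->
                 exists (U : set (eg_ambient G)) (F : eg_ambient G -> 'rV[R]_n),
                   [/\ open U, U (emb p), smooth_on U F &
                       forall q, cdom c q -> U (emb q) ->
                         F (emb q) = cto c q]]].

End EmbeddedAtlas.

Arguments eg_atlas {R} G n.

Section LeftInvariant.
Context {R : realType} (G : embedded_group R).

Definition left_invariant_metric (n : nat) (g : metric R G n) : Prop :=
  is_metric (eg_atlas G n) g /\
  forall a : G, is_isometry (eg_atlas G n) g (@eg_mul R G a).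

(* The Lie algebra is the tangent space at [eg_one G], seen in the ambient
   space: the vector with components [u] in a chart [c] is
   ['D_u (@eg_emb R G \o cinv c) (cto c (eg_one G))]. *)
Definition represented_at_one (n : nat) (g : metric R G n)
    (X : 'I_n -> eg_ambient G) (D : 'M[R]_n) : Prop :=
  forall c, eg_atlas G n c -> cdom c (eg_one G) ->
  forall u v a b : 'rV[R]_n,
    let x := cto c (eg_one G) in
    'D_u (@eg_emb R G \o cinv c) x = \sum_i a 0 i *: X i ->
    'D_v (@eg_emb R G \o cinv c) x = \sum_i b 0 i *: X i ->
    form (g c x) u v = form D a b.

End LeftInvariant.

Definition mx2 (T : Type) (a b c d : T) : 'M[T]_2 :=
  \matrix_(i, j) if i == 0 then (if j == 0 then a else b)
                 else (if j == 0 then c else d).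

Definition diag3 (R : realType) (a b c : R) : 'M[R]_3 :=
  diag_mx (\row_i [:: a; b; c]`_i).

Section SU2.
Context (R : realType).

Definition SU2_type : Type :=
  {A : 'M[R[i]]_2 | (A \is unitarymx) && (\det A == 1)}.

Definition re_im (A : 'M[R[i]]_2) : 'M[R]_2 * 'M[R]_2 :=
  (map_mx (@complex.Re R) A, map_mx (@complex.Im R) A).

Fact SU2_mul_subproof (A B : SU2_type) :
  (val A *m val B \is unitarymx) && (\det (val A *m val B) == 1).
Proof.
have /andP[uA /eqP dA] := valP A; have /andP[uB /eqP dB] := valP B.
by rewrite mul_unitarymx//= det_mulmx dA dB mulr1.
Qed.

Fact SU2_one_subproof :
  ((1%:M : 'M[R[i]]_2) \is unitarymx) && (\det (1%:M : 'M[R[i]]_2) == 1).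
Proof.
by rewrite det1 eqxx andbT; apply/unitarymxP; rewrite trmx1 map_mx1 mulmx1.
Qed.

Definition SU2 : embedded_group R :=
  @EmbeddedGroup R (@initial_topology SU2_type _ (re_im \o val)) _
    (re_im \o val)
    (fun A B => exist _ (val A *m val B) (SU2_mul_subproof A B))
    (exist _ 1%:M SU2_one_subproof).

Definition su2_basis (k : 'I_3) : eg_ambient SU2 :=
  re_im (nth 0 [:: 2^-1 *: mx2 'i%C 0 0 (- 'i%C);
                   2^-1 *: mx2 0 (- 1) 1 0;
                   2^-1 *: mx2 0 (- 'i%C) (- 'i%C) 0] k).

End SU2.

Section SL2.
Context (R : realType).

Definition SL2_type : Type := {A : 'M[R]_2 | \det A == 1}.

Fact SL2_mul_subproof (A B : SL2_type) : \det (val A *m val B) == 1.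
Proof.
by have /eqP dA := valP A; have /eqP dB := valP B;
  rewrite det_mulmx dA dB mulr1.
Qed.

Fact SL2_one_subproof : \det (1%:M : 'M[R]_2) == 1.
Proof. by rewrite det1. Qed.

Definition SL2 : embedded_group R :=
  @EmbeddedGroup R (@initial_topology SL2_type _ val) _ val
    (fun A B => exist _ (val A *m val B) (SL2_mul_subproof A B))
    (exist _ 1%:M SL2_one_subproof).

Definition sl2_basis (k : 'I_3) : eg_ambient SL2 :=
  nth 0 [:: mx2 0 1 (- 1) 0; mx2 0 1 1 0; mx2 1 0 0 (- 1)] k.

End SL2.

Definition heis_mul (R : realType) (p q : 'rV[R]_3) : 'rV[R]_3 :=
  let x := p 0 0 in let y := p 0 1 in let z := p 0 2 in
  let x' := q 0 0 in let y' := q 0 1 in let z' := q 0 2 in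
  \row_i [:: x + x'; y + y'; z + z' + 2^-1 * (x * y' - y * x')]`_i.

Definition H1 (R : realType) : embedded_group R :=
  @EmbeddedGroup R 'rV[R]_3 'rV[R]_3 id (@heis_mul R) 0.

(* Main.v *)
(* In each case M is a 3-dimensional Lie group with a left-invariant frame E0, E1, E2 in
   which the metric is diag(lam, 1, 1) and [E0, E1] = c E2, [E2, E0] = c E1, [E1, E2] = b E0,
   where b <> 0 and c <> lam b. Prolonging the Killing equation bounds the Killing fields
   enough to show that a Killing field that is parallel at a point is there a multiple of
   E0; conversely a suitable combination of E0 and of an infinitesimal rotation around the
   point is Killing and parallel there. So the distribution of symmetry is spanned by E0,
   and its leaves are the cosets of the one-parameter subgroup K of E0, a circle or a line.
   The quotient metric on M / K is the one in which E1 and E2 project to an orthonormal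
   basis. An isometry maps E0 to a multiple of E0 (pull back an infinitesimal rotation: its
   derivative along E0 vanishes at its centre, and only along E0), hence it descends to
   M / K, and since it also preserves the orthogonal complement of E0, it descends to an
   isometry.
   SU(2) and SL(2, R) are the groups of norm 1 elements of the quaternion algebras with
   i^2 = -1 and j^2 = k^2 = e, with e = -1 and e = 1; there K is the circle of the a + b i,
   and M / K has the coordinate conj(beta) / alpha for q = alpha + beta j. *)
Require Import Defs.
From HB Require Import structures.
From mathcomp Require Import all_boot all_order all_algebra.
From mathcomp Require Import complex spectral.
From mathcomp Require Import all_classical all_reals all_analysis.
From mathcomp Require Import ring lra.
Import Defs.

Set Implicit Arguments.
Unset Strict Implicit.
Unset Printing Implicit Defensive.

Import Order.TTheory GRing.Theory Num.Theory.
Import numFieldNormedType.Exports.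

Local Open Scope classical_set_scope.
Local Open Scope ring_scope.

(** * Smooth maps *)

(** Among the geometries treated, [c = lam b] would be the round metric on SU(2), where every
    direction is one of symmetry; so the factor c - lam b has to enter, and it does so in the last
    compatibility condition of the prolonged Killing system. What that condition yields is [E0, X] =
    0 for every Killing field X, local ones included; it is used both for the distribution of
    symmetry and, on pulled back rotation fields, for isometries. No flows and no Frobenius theorem
    are used. One lemma replaces them: a map into the group from a connected manifold, tangent to E0
    everywhere, stays in one coset of K, because the base coordinate has zero derivative along it.
    It shows that the cosets are the maximal integral manifolds and that isometries permute them.
    Charts of the group are arbitrary, so explicit computations take place in the ambient space R^N,
    where translations and frame are polynomial maps; a chart sees them only through the pulled back
    frame [eps]. Since smoothness is defined by iterated directional derivatives, the chain rule and
    the symmetry of second derivatives have to be derived from it first. *)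

Section Ck_general.
Context {R : realType} {V W : normedModType R}.
Implicit Types (U : set V) (f g : V -> W) (k : nat).

Lemma Ck_subset k U U' f : U' `<=` U -> Ck k U f -> Ck k U' f.
Proof.
move=> sU; elim: k f => [|k IH] f /= [cf df]; split=> //.
- by move=> x /sU /cf.
- by move=> x /sU /cf.
- by move=> v; have [d1 d2] := df v; split; [move=> x /sU /d1|exact: IH].
Qed.

Lemma Ck_pred k U f : Ck k.+1 U f -> Ck k U f.
Proof.
elim: k f => [|k IH] f [cf df]; split=> // v.
by have [d1 d2] := df v; split=> //; exact: IH.
Qed.

Lemma Ck_local k U f :
  (forall x, U x -> exists2 U', U' x & Ck k U' f) -> Ck k U f.
Proof.
elim: k f => [|k IH] f H /=; split=> //.
- by move=> x /H[U' Ux [cf _]]; exact: cf.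
- by move=> x /H[U' Ux [cf _]]; exact: cf.
- move=> v; split; first by move=> x /H[U' Ux [_ /(_ v)[df _]]]; exact: df.
  by apply: IH => x /H[U' Ux [_ /(_ v)[_ df]]]; exists U'.
Qed.

Lemma near_eq_continuous f g x : {near x, f =1 g} ->
  {for x, continuous f} -> {for x, continuous g}.
Proof.
move=> fg cf; rewrite /prop_for /continuous_at -(nbhs_singleton fg).
exact/(cvg_trans _ cf)/near_eq_cvg.
Qed.

Lemma Ck_eq k U f g : open U -> (forall x, U x -> f x = g x) ->
  Ck k U f -> Ck k U g.
Proof.
move=> oU; elim: k f g => [|k IH] f g fg [cf df].
all: have nfg x : U x -> {near x, f =1 g} by
  move=> Ux; apply: filterS (open_nbhs_nbhs (conj oU Ux)) => y; exact: fg.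
all: split=> //.
- by move=> x Ux; apply: near_eq_continuous (nfg _ Ux) (cf _ Ux).
- by move=> x Ux; apply: near_eq_continuous (nfg _ Ux) (cf _ Ux).
- move=> v; have [d1 d2] := df v; split.
    by move=> x Ux; apply: near_eq_derivable (nfg _ Ux) (d1 _ Ux).
  by apply: IH d2 => x Ux; apply: near_eq_derive; exact: nfg.
Qed.

Lemma Ck_cst k U (c : W) : Ck k U (fun=> c).
Proof.
elim: k c => [|k IH] c; split=> //; try by move=> x _; exact: cvg_cst.
move=> v; split=> [x _|]; first exact: derivable_cst.
rewrite [X in Ck _ _ X](_ : _ = fun=> 0) //.
by apply/funext => x; exact: derive_cst.
Qed.

Lemma CkD k U f g : open U -> Ck k U f -> Ck k U g -> Ck k U (f \+ g).
Proof.
move=> oU; elim: k f g => [|k IH] f g [cf df] [cg dg]; split=> //.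
- by move=> x Ux; apply: cvgD; [exact: cf|exact: cg].
- by move=> x Ux; apply: cvgD; [exact: cf|exact: cg].
- move=> v; have [d1 d2] := df v; have [d3 d4] := dg v; split.
    by move=> x Ux; apply: derivableD; [exact: d1|exact: d3].
  apply: Ck_eq (IH _ _ d2 d4) => // x Ux /=.
  by rewrite -deriveD //; [exact: d1|exact: d3].
Qed.

End Ck_general.

(** * Restriction to lines and the chain rule in one direction *)

Section Ck_line.
Context {R : realType}.

Lemma is_derive_line {V W : normedModType R} (f : V -> W) y v (t : R) :
  derivable f (y + t *: v) v ->
  is_derive t 1 (fun s => f (y + s *: v)) ('D_v f (y + t *: v)).
Proof.
move=> df; pose g := fun s : R => f (y + s *: v).
have E : (fun h : R => h^-1 *: ((g \o shift t) (h *: 1) - g t)) =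
   (fun h : R => h^-1 *: ((f \o shift (y + t *: v)) (h *: v) - f (y + t *: v))).
  apply/funext => h; rewrite /g /=; congr (_ *: (f _ - _)).
  by rewrite [h *: 1]mulr1 scalerDl addrCA.
by split; rewrite /derivable /derive E.
Qed.

(** Only derivability along [v] is available, not differentiability. Restricting [f] to the line
    gives a function of a real variable, for which the two notions agree; this covers c = 0 without
    a case split. *)
Lemma is_derive_dirZ {V W : normedModType R} (f : V -> W) x v (c : R) :
  derivable f x v -> is_derive x (c *: v) f (c *: 'D_v f x).
Proof.
move=> df; pose g := fun s : R => f (x + s *: v).
have dg : is_derive (0 : R) 1 g ('D_v f x).
  have := @is_derive_line _ _ f x v 0; rewrite scale0r addr0; exact.
have /derivable1_diffP dg' : derivable g 0 1 by [].
have E : (fun h : R => h^-1 *: ((g \o shift 0) (h *: c) - g 0)) =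
   (fun h : R => h^-1 *: ((f \o shift x) (h *: (c *: v)) - f x)).
  apply/funext => h; rewrite /g /= scale0r !addr0; congr (_ *: (f _ - _)).
  by rewrite scalerA addrC.
have dc : derivable g 0 c by exact: diff_derivable.
split; first by rewrite /derivable -E.
transitivity ('D_c g 0); first by rewrite /derive E.
rewrite deriveE // -[c in 'd _ _ c]mulr1 -[c * 1]/(c *: 1) linearZ -deriveE //.
by rewrite (@derive_val _ _ _ _ _ _ _ dg).
Qed.

(** The inner map is only derivable along [v]; as a function on the line through [x] it is
    differentiable, and the usual chain rule applies there. *)
Lemma is_derive_comp_diff {V W Z : normedModType R} (f : V -> W) (g : W -> Z) x v :
  derivable f x v -> differentiable g (f x) ->
  is_derive x v (g \o f) ('D_('D_v f x) g (f x)).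
Proof.
move=> df dg; pose F := fun s : R => f (x + s *: v).
have dF : is_derive (0 : R) 1 F ('D_v f x).
  have := @is_derive_line _ _ f x v 0; rewrite scale0r addr0; exact.
have dF' : differentiable F 0 by exact/derivable1_diffP.
have F0 : F 0 = f x by rewrite /F scale0r addr0.
have dgF : differentiable (g \o F) 0 by apply: differentiable_comp => //; rewrite F0.
have E : (fun h : R => h^-1 *: (((g \o F) \o shift 0) (h *: 1) - (g \o F) 0)) =
   (fun h : R => h^-1 *: (((g \o f) \o shift x) (h *: v) - (g \o f) x)).
  apply/funext => h; rewrite /F /= scale0r !addr0; congr (_ *: (g (f _) - _)).
  by rewrite [h *: 1]mulr1 addrC.
have dgF1 : derivable (g \o F) 0 1 by exact: diff_derivable.
split; first by rewrite /derivable -E.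
transitivity ('D_1 (g \o F) 0); first by rewrite /derive E.
have dg0 : differentiable g (F 0) by rewrite F0.
rewrite (deriveE _ dgF) (diff_comp dF' dg0) /= -(deriveE _ dF').
by rewrite (@derive_val _ _ _ _ _ _ _ dF) F0 (deriveE _ dg).
Qed.

End Ck_line.

Section Ck_scalar.
Context {R : realType} {V : normedModType R}.
Implicit Types (U : set V) (f g : V -> R) (k : nat).

Lemma CkM k U f g : open U -> Ck k U f -> Ck k U g -> Ck k U (fun x => f x * g x).
Proof.
move=> oU; elim: k f g => [|k IH] f g kf kg.
all: have [cf df] := kf; have [cg dg] := kg; split=> //.
- by move=> x Ux; apply: cvgM; [exact: cf|exact: cg].
- by move=> x Ux; apply: cvgM; [exact: cf|exact: cg].
- move=> v; have [d1 d2] := df v; have [d3 d4] := dg v; split.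
    by move=> x Ux; apply: derivableM; [exact: d1|exact: d3].
  apply: (Ck_eq oU _ (CkD oU (IH _ _ (Ck_pred kf) d4) (IH _ _ (Ck_pred kg) d2))) => x Ux /=.
  by rewrite (@deriveM _ _ f g) //; [exact: d1|exact: d3].
Qed.

Lemma CkV k U f : open U -> (forall x, U x -> f x != 0) -> Ck k U f ->
  Ck k U (fun x => (f x)^-1).
Proof.
move=> oU f0; elim: k => [|k IH] kf; have [cf df] := kf; split=> //.
- by move=> x Ux; apply: cvgV; [exact: f0|exact: cf].
- by move=> x Ux; apply: cvgV; [exact: f0|exact: cf].
- move=> v; have [d1 d2] := df v; split.
    by move=> x Ux; apply: derivableV; [exact: f0|exact: d1].
  have kV := IH (Ck_pred kf).
  apply: (Ck_eq oU _ (CkM oU (CkM oU (Ck_cst k U (-1 : R)) (CkM oU kV kV)) d2)) => x Ux /=.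
  rewrite deriveV; [|exact: f0|exact: d1].
  by rewrite -exprVn expr2 mulN1r.
Qed.

Lemma Ck_sum k U n (F : 'I_n -> V -> R) : open U ->
  (forall i, Ck k U (F i)) -> Ck k U (fun x => \sum_i F i x).
Proof.
move=> oU; elim: n F => [|n IH] F kF.
  rewrite [X in Ck _ _ X](_ : _ = fun=> 0); first exact: Ck_cst.
  by apply/funext => x; rewrite big_ord0.
rewrite [X in Ck _ _ X](_ : _ = (fun x => \sum_(i < n) F (widen_ord (leqnSn n) i) x) \+ F ord_max).
  by apply: CkD => //; apply: IH => i; exact: kF.
by apply/funext => x; rewrite big_ord_recr.
Qed.

Lemma Ck_mxP k U m n (f : V -> 'M[R]_(m, n)) : open U ->
  Ck k U f <-> forall i j, Ck k U (fun x => f x i j).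
Proof.
move=> oU; elim: k f => [|k IH] f; split.
- move=> [cf _] i j; split=> // x Ux.
  exact: (continuous_comp (cf _ Ux) (@coord_continuous _ _ _ i j _)).
- move=> H; split=> // x Ux.
  apply/cvgrPdist_le => /= e e0; near=> y.
  rewrite /Num.Def.normr/= mx_normrE (bigmax_le _ (ltW e0))//= => i _.
  rewrite !mxE/=; move: i; near: y; apply: filter_forall => /= i.
  exact: ((cvgrPdist_le _ _).1 ((H i.1 i.2).1 _ Ux)).
- move=> [cf df] i j; split=> [x Ux|v].
    exact: (continuous_comp (cf _ Ux) (@coord_continuous _ _ _ i j _)).
  have [d1 d2] := df v; split=> [x /d1/derivable_mxP //|].
  apply: Ck_eq (((IH _).1 d2) i j) => // x Ux.
  by rewrite derive_mx ?mxE //; exact: d1.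
- move=> H; split.
    move=> x Ux; apply/cvgrPdist_le => /= e e0; near=> y.
    rewrite /Num.Def.normr/= mx_normrE (bigmax_le _ (ltW e0))//= => i _.
    rewrite !mxE/=; move: i; near: y; apply: filter_forall => /= i.
    exact: ((cvgrPdist_le _ _).1 ((H i.1 i.2).1 _ Ux)).
  move=> v; have df x : U x -> derivable f x v.
    by move=> Ux; apply/derivable_mxP => i j; exact: ((H i j).2 v).1.
  split=> //; apply/IH => i j.
  apply: Ck_eq ((H i j).2 v).2 => // x Ux.
  by rewrite derive_mx ?mxE //; exact: df.
Unshelve. all: by end_near. Qed.

End Ck_scalar.

(** * Maps of class C^1 on R^n are differentiable; composition of smooth maps *)

Section Differentiable.
Context {R : realType}.

(** Bounds the error of a linear approximation by that of the derivative. With L = M = 0 it gives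
    the constancy of functions with zero derivative. *)
Lemma mean_value_error (g : R -> R) (L M : R) :
  (forall t, 0 <= t <= 1 -> derivable g t 1 /\ `|'D_1 g t - L| <= M) ->
  `|g 1 - g 0 - L| <= M.
Proof.
move=> H.
have cg : {within [set` `[0, 1]%R], continuous g}.
  apply: derivable_within_continuous => t; rewrite in_itv /= => t01.
  by have [] := H t t01.
have [|c] := @MVT R g (fun t => 'D_1 g t) 0 1 ltr01 _ cg.
  move=> t; rewrite in_itv /= => /andP[t0 t1]; apply: DeriveDef => //.
  by have [] := H t; rewrite ?(ltW t0) ?(ltW t1).
rewrite in_itv /= => /andP[c0 c1] ->; rewrite subr0 mulr1.
by have [] := H c; rewrite ?(ltW c0) ?(ltW c1).
Qed.

(** The candidate for the differential of a scalar function, with its partial derivatives in the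
    column; named so that it can carry a linear structure. *)
Definition covec n (c : 'cV[R]_n) (h : 'rV[R]_n) : R := (h *m c) 0 0.

Fact covec_linear n (c : 'cV[R]_n) : linear (covec c : 'rV[R]_n -> R^o).
Proof. by move=> a u v; rewrite /covec mulmxDl -scalemxAl !mxE. Qed.

HB.instance Definition _ n (c : 'cV[R]_n) :=
  GRing.isLinear.Build R 'rV[R]_n R^o _ (covec c) (covec_linear c).

Lemma covec_continuous n (c : 'cV[R]_n) : continuous (covec c).
Proof.
move=> x.
rewrite (_ : covec c = fun h => \sum_i h 0 i * c i 0); last first.
  by apply/funext => h; rewrite /covec mxE.
suff [H _] : Ck 0 setT (fun h : 'rV[R]_n => \sum_i h 0 i * c i 0) by exact: H.
apply: Ck_sum openT _ => i; apply: CkM openT _ (Ck_cst _ _ _).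
by split=> // y _; exact: coord_continuous.
Qed.

Lemma normr_row_le n (h : 'rV[R]_n) i : `|h 0 i| <= `|h|.
Proof.
rewrite [leRHS]/Num.Def.normr/= mx_normrE.
exact: (le_trans _ (le_bigmax _ _ (0, i))).
Qed.

(** The points x + [trunc h k], for k from 0 to n, are the vertices of a broken line from x to x + h
    each of whose edges changes one coordinate. *)
Definition trunc n (h : 'rV[R]_n) (k : nat) : 'rV[R]_n :=
  \row_i (if (i < k)%N then h 0 i else 0).

Lemma truncS n (h : 'rV[R]_n) (i : 'I_n) :
  trunc h i.+1 = trunc h i + h 0 i *: delta_mx 0 i.
Proof.
apply/rowP => j; rewrite !mxE eqxx /= ltnS leq_eqVlt -val_eqE /=.
by have [/ord_inj ->|] := eqVneq (val j) (val i); rewrite ?ltnn ?mulr1 ?add0r ?mulr0 ?addr0.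
Qed.

(** The norm is the maximum of the coordinates, so the edges of the broken line stay in every ball
    around its origin that contains its end. *)
Lemma trunc_norm n (h : 'rV[R]_n) (i : 'I_n) (t : R) : 0 <= t <= 1 ->
  `|trunc h i + t *: (h 0 i *: delta_mx 0 i)| <= `|h|.
Proof.
move=> /andP[t0 t1]; rewrite [leLHS]/Num.Def.normr/= mx_normrE.
apply: bigmax_le => // -[a j] _ /=; rewrite !mxE (ord1 a) eqxx /=.
have [->|/negbTE ji] := eqVneq j i.
  rewrite ltnn add0r mulr1 normrM ger0_norm //.
  by rewrite (le_trans _ (normr_row_le h i)) // ler_piMl.
by rewrite !mulr0 addr0; case: ifP => _; rewrite ?normr0 ?normr_row_le.
Qed.

(** The increment of [f] is split along the broken line of [trunc]; on each edge the mean value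
    theorem compares it with the partial derivative at [x], which is continuous there. *)
Lemma Ck1_differentiable_R n (U : set 'rV[R]_n) (f : 'rV[R]_n -> R) x :
  open U -> Ck 1 U f -> U x -> differentiable f x.
Proof.
move=> oU [cf df] Ux.
pose c : 'cV[R]_n := \col_i 'D_(delta_mx 0 i) f x.
suff H : f \o shift x = cst (f x) + covec c +o_ (0 : 'rV[R]_n) id.
  have D := @diff_unique R 'rV[R]_n R^o f (covec c) x (@covec_continuous n c) H.
  by apply/diff_locallyP; rewrite D; split=> //; exact: covec_continuous.
apply/eqaddoP => _/posnumP[e].
(* Each of the n edges may contribute e / (n + 1); the successor keeps the denominator positive when
   n = 0. *)
have n0 : 0 < (n.+1%:R : R) by [].
have en : 0 < e%:num / n.+1%:R by rewrite divr_gt0.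
have near_d : \forall y \near x, U y /\
    forall i, `|'D_(delta_mx 0 i) f y - 'D_(delta_mx 0 i) f x| <= e%:num / n.+1%:R.
  near=> y; split; first by near: y; exact: open_nbhs_nbhs.
  near: y; apply: filter_forall => i.
  have [_ [/(_ x Ux) cD _]] := df (delta_mx 0 i).
  near=> y; rewrite distrC; near: y.
  exact: (cvgrPdist_le _ _).1 cD _ en.
have /nbhs_ballP[r r0 Hr] := near_d.
apply/nbhs_ballP; exists r => //= h.
rewrite -ball_normE /= sub0r normrN => hr.
have Br (i : 'I_n) (t : R) : 0 <= t <= 1 ->
    ball x r (x + trunc h i + t *: (h 0 i *: delta_mx 0 i)).
  move=> t01; rewrite -ball_normE /= -addrA opprD addrA subrr sub0r normrN.
  exact: le_lt_trans (trunc_norm _ _ t01) hr.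
have T0 : trunc h 0 = 0 by apply/rowP => j; rewrite !mxE.
have Tn : trunc h n = h by apply/rowP => j; rewrite !mxE ltn_ord.
have -> : (f \o shift x - (cst (f x) + covec c)) h =
   \sum_(i < n) (f (x + trunc h i.+1) - f (x + trunc h i) - h 0 i * c i 0).
  rewrite big_split /= sumrN -(big_mkord xpredT (fun i => f (x + trunc h i.+1) - f (x + trunc h i))).
  rewrite (telescope_sumr (fun i => f (x + trunc h i))) // T0 Tn addr0.
  rewrite fctE /= fctE /= fctE /=.
  by rewrite /covec mxE opprD addrA [h + x]addrC.
apply: (le_trans (ler_norm_sum _ _ _)).
apply: (@le_trans _ _ (\sum_(i < n) e%:num / n.+1%:R * `|h|)); last first.
  rewrite sumr_const card_ord -[_ *+ n]mulr_natl mulrA ler_wpM2r //.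
  rewrite mulrC -mulrA ler_piMr // mulrC ler_pdivrMr // mul1r.
  by rewrite ler_nat.
apply: ler_sum => i _.
pose g := fun s : R => f (x + trunc h i + s *: (h 0 i *: delta_mx 0 i)).
have -> : f (x + trunc h i.+1) - f (x + trunc h i) = g 1 - g 0.
  by rewrite /g scale1r scale0r addr0 truncS addrA.
apply: mean_value_error => t t01.
have [Uy Dy] := Hr _ (Br i t t01).
have dy : derivable f (x + trunc h i + t *: (h 0 i *: delta_mx 0 i)) (delta_mx 0 i).
  by have [d _] := df (delta_mx 0 i); exact: d.
have dz := is_derive_dirZ (h 0 i) dy.
have dl := is_derive_line (@ex_derive _ _ _ _ _ _ _ dz).
split; first exact: ex_derive.
rewrite (@derive_val _ _ _ _ _ _ _ dl) (@derive_val _ _ _ _ _ _ _ dz).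
rewrite -[_ *: _]/(_ * _) -mulrBr normrM mulrC mxE.
by rewrite ler_pM // normr_row_le.
Unshelve. all: by end_near. Qed.

Lemma differentiable_mxP n p q (f : 'rV[R]_n -> 'M[R]_(p, q)) x :
  (forall i j, differentiable (fun y => f y i j) x) -> differentiable f x.
Proof.
move=> df.
have -> : f = \sum_i \sum_j (fun y => f y i j *: delta_mx i j).
  apply/funext => y; rewrite [LHS]matrix_sum_delta fct_sumE.
  by apply: eq_bigr => i _; rewrite fct_sumE.
do 2!(apply: differentiable_sum => ?).
exact: differentiableZl.
Qed.

Lemma Ck1_differentiable n p q (U : set 'rV[R]_n) (f : 'rV[R]_n -> 'M[R]_(p, q)) x :
  open U -> Ck 1 U f -> U x -> differentiable f x.
Proof.
move=> oU /(Ck_mxP _ _ oU) kf Ux; apply: differentiable_mxP => i j.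
exact: Ck1_differentiable_R (kf i j) Ux.
Qed.

Lemma derive_coord n {W : normedModType R} (f : 'rV[R]_n -> W) x v :
  differentiable f x -> 'D_v f x = \sum_i v 0 i *: 'D_(delta_mx 0 i) f x.
Proof.
move=> df; rewrite deriveE // {1}(row_sum_delta v) linear_sum.
by apply: eq_bigr => i _; rewrite linearZ deriveE.
Qed.

(** Induction on the order, with [g] general: the derivative of the composite is the sum of the
    coordinates of 'D_v f times the partial derivatives of [g] composed with [f], and the induction
    hypothesis is applied to those partial derivatives. *)
Lemma Ck_comp_R k m n (U : set 'rV[R]_m) (U' : set 'rV[R]_n)
    (f : 'rV[R]_m -> 'rV[R]_n) (g : 'rV[R]_n -> R) :
  open U -> open U' -> (forall x, U x -> U' (f x)) ->
  Ck k U f -> Ck k U' g -> Ck k U (g \o f).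
Proof.
move=> oU oU' fU; elim: k g => [|k IH] g kf kg.
all: have [cf df] := kf; have [cg dg] := kg; split=> //.
- by move=> x Ux; apply: continuous_comp; [exact: cf|exact/cg/fU].
- by move=> x Ux; apply: continuous_comp; [exact: cf|exact/cg/fU].
have dfg y : U' y -> differentiable g y.
  move=> U'y; apply: (Ck1_differentiable_R oU' _ U'y).
  by elim: k {IH df kf dg} kg => // k IH /Ck_pred /IH.
move=> v; have [d1 d2] := df v; split.
  move=> x Ux; have H := is_derive_comp_diff (d1 _ Ux) (dfg _ (fU _ Ux)).
  exact: ex_derive.
apply: (@Ck_eq _ _ _ _ _ (fun x => \sum_i 'D_v f x 0 i * ('D_(delta_mx 0 i) g \o f) x)) => //.
  move=> x Ux.
  have H := is_derive_comp_diff (d1 _ Ux) (dfg _ (fU _ Ux)).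
  rewrite (@derive_val _ _ _ _ _ _ _ H) (derive_coord _ (dfg _ (fU _ Ux))).
  by [].
apply: Ck_sum => // i; apply: CkM => //.
  by have /(Ck_mxP _ _ oU) := d2; exact.
by apply: IH; [exact: Ck_pred|have [] := dg (delta_mx 0 i)].
Qed.

End Differentiable.

(** * Symmetry of second derivatives *)

Section Schwarz.
Context {R : realType} {n : nat}.
Implicit Types (U : set 'rV[R]_n) (f : 'rV[R]_n -> R).

Lemma MVT_pos (g dg : R -> R) (h : R) : 0 < h ->
  (forall t : R, 0 <= t <= h -> is_derive t 1 g (dg t)) ->
  exists2 c, 0 <= c <= h & g h - g 0 = dg c * h.
Proof.
move=> h0 H.
have [||c] := @MVT R g dg 0 h h0.
- by move=> t; rewrite in_itv /= => /andP[t0 th]; apply: H; rewrite !ltW.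
- apply: derivable_within_continuous => t; rewrite in_itv /= => t01.
  by have [] := H t t01.
by rewrite in_itv /= subr0 => /andP[c0 c1] ->; exists c; rewrite // !ltW.
Qed.

Lemma ball_two_dirs (x u v : 'rV[R]_n) (h r a b : R) :
  h * (`|u| + `|v| + 1) < r -> 0 <= a <= h -> 0 <= b <= h ->
  ball x r (x + a *: u + b *: v).
Proof.
move=> hr /andP[a0 ah] /andP[b0 bh].
rewrite -ball_normE /= -addrA opprD addrA subrr sub0r normrN.
apply: le_lt_trans hr; rewrite (le_trans (ler_normD _ _)) // !normrZ !ger0_norm //.
rewrite !mulrDr mulr1 -[leLHS]addr0 lerD ?(le_trans a0 ah) //.
by rewrite lerD // ler_wpM2r.
Qed.

(** Two mean values in turn: along [u] for the difference of [f] on two parallel segments, then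
    along [v] for 'D_u f. *)
Lemma second_difference U f x u v : open U -> Ck 2 U f -> U x ->
  \forall h \near 0^'+, exists a b, [/\ 0 <= a <= h, 0 <= b <= h &
    f (x + h *: u + h *: v) - f (x + h *: u) - f (x + h *: v) + f x =
    'D_v ('D_u f) (x + a *: u + b *: v) * h * h].
Proof.
move=> oU [cf df] Ux.
have : \forall y \near x, U y by exact: open_nbhs_nbhs.
move=> /nbhs_ballP[r r0 Hr].
have N0 : 0 < `|u| + `|v| + 1 by rewrite ltr_wpDl.
near=> h.
have h0 : 0 < h by [].
have hr : h * (`|u| + `|v| + 1) < r.
  by rewrite -ltr_pdivlMr //; near: h; apply: nbhs_right_lt; rewrite divr_gt0.
have B a b : 0 <= a <= h -> 0 <= b <= h -> U (x + a *: u + b *: v).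
  by move=> ah bh; exact: (Hr _ (ball_two_dirs x hr ah bh)).
have [du kdu] := df u; have [cdu ddu] := kdu; have [dvu _] := ddu v.
have h00 : 0 <= (0 : R) <= h by rewrite lexx ltW.
have hhh : 0 <= h <= h by rewrite lexx ltW.
have [|a ah Ea] := @MVT_pos (fun s => f (x + h *: v + s *: u) - f (x + s *: u))
   (fun s => 'D_u f (x + h *: v + s *: u) - 'D_u f (x + s *: u)) h h0.
  move=> t th; apply: is_deriveB.
  - by apply: is_derive_line; apply: du; rewrite addrAC; exact: B.
  - apply: is_derive_line; apply: du.
    by have := B _ _ th h00; rewrite scale0r addr0.
have [|b bh Eb] := @MVT_pos (fun s => 'D_u f (x + a *: u + s *: v))
   (fun s => 'D_v ('D_u f) (x + a *: u + s *: v)) h h0.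
  by move=> t th; apply: is_derive_line; apply: dvu; exact: B.
exists a, b; split=> //.
rewrite -Eb; rewrite !scale0r !addr0 in Ea *.
rewrite (addrAC x (a *: u)) -Ea (addrAC x (h *: v)).
by ring.
Unshelve. all: by end_near. Qed.

(** The second difference is symmetric in [u] and [v], so the two mixed derivatives take a common
    value at points arbitrarily near [x]; both are continuous at [x]. *)
Lemma derive_comm U f x u v : open U -> Ck 2 U f -> U x ->
  'D_u ('D_v f) x = 'D_v ('D_u f) x.
Proof.
move=> oU kf Ux.
have [cf df] := kf.
have cont w z : {for x, continuous ('D_w ('D_z f))}.
  by have [_ [_ /(_ w)[_ [c _]]]] := df z; exact: c.
apply/eqP; rewrite -subr_eq0 -normr_le0; apply/ler_addgt0Pr => e e0.
rewrite add0r.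
have e2 : 0 < e / 2 by rewrite divr_gt0.
have N0 : 0 < `|u| + `|v| + 1 by rewrite ltr_wpDl.
have near_cont w z : exists2 r, 0 < r & forall y, ball x r y ->
    `|'D_w ('D_z f) x - 'D_w ('D_z f) y| <= e / 2.
  have H : \forall y \near x, `|'D_w ('D_z f) x - 'D_w ('D_z f) y| <= e / 2.
    exact: (cvgrPdist_le _ _).1 (cont w z) _ e2.
  by have /nbhs_ballP[r r0 Hr] := H; exists r.
have [r r0 Hr] := near_cont u v; have [s s0 Hs] := near_cont v u.
have [h [h0 hrs [a [b [ah bh E1]]] [b' [a' [bh' ah' E2]]]]] : exists h,
  [/\ 0 < h, h * (`|u| + `|v| + 1) < Num.min r s,
    exists a b, [/\ 0 <= a <= h, 0 <= b <= h &
    f (x + h *: u + h *: v) - f (x + h *: u) - f (x + h *: v) + f x =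
    'D_v ('D_u f) (x + a *: u + b *: v) * h * h] &
    exists b a, [/\ 0 <= b <= h, 0 <= a <= h &
    f (x + h *: v + h *: u) - f (x + h *: v) - f (x + h *: u) + f x =
    'D_u ('D_v f) (x + b *: v + a *: u) * h * h]].
  have S1 := @second_difference U f x u v oU kf Ux.
  have S2 := @second_difference U f x v u oU kf Ux.
  have S3 : \forall h \near (0 : R)^'+, 0 < h /\ h * (`|u| + `|v| + 1) < Num.min r s.
    near=> h; split=> //.
    by rewrite -ltr_pdivlMr //; near: h; apply: nbhs_right_lt; rewrite divr_gt0 // lt_min r0 s0.
  have [h [[A1 A2] [A3 A4]]] := filter_ex (filterI S3 (filterI S1 S2)).
  exists h; split; [exact: A1|exact: A2|exact: A3|exact: A4].
have E : 'D_v ('D_u f) (x + a *: u + b *: v) = 'D_u ('D_v f) (x + b' *: v + a' *: u).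
  apply: (mulIf (lt0r_neq0 h0)); apply: (mulIf (lt0r_neq0 h0)).
  refine (etrans (esym E1) (etrans _ E2)).
  by rewrite (addrAC x (h *: v) (h *: u)); ring.
move: hrs; rewrite lt_min => /andP[hr hs].
have F1 := Hs _ (ball_two_dirs x hs ah bh); rewrite E in F1.
have F2 := Hr _ (ball_two_dirs x hr ah' bh'); rewrite addrAC in F2.
clear - F1 F2; rewrite distrC in F1.
rewrite [e]splitr; apply: le_trans (lerD F2 F1).
by apply: le_trans (ler_normD _ _); rewrite subrKA.
Unshelve. all: by end_near. Qed.

End Schwarz.

(** * Closure properties of smooth functions *)

Section Smooth_general.
Context {R : realType} {V W : normedModType R}.
Implicit Types (U : set V) (f g : V -> W).

Lemma smooth_subset U U' f : U' `<=` U -> smooth_on U f -> smooth_on U' f.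
Proof. by move=> s H k; apply: Ck_subset (H k). Qed.

Lemma smooth_local U f :
  (forall x, U x -> exists2 U', U' x & smooth_on U' f) -> smooth_on U f.
Proof. by move=> H k; apply: Ck_local => x /H[U' Ux sf]; exists U'. Qed.

Lemma smooth_eq U f g : open U -> (forall x, U x -> f x = g x) ->
  smooth_on U f -> smooth_on U g.
Proof. by move=> oU fg H k; apply: (Ck_eq oU fg (H k)). Qed.

Lemma smooth_cst U (c : W) : smooth_on U (fun=> c).
Proof. by move=> k; exact: Ck_cst. Qed.

Lemma smoothD U f g : open U -> smooth_on U f -> smooth_on U g ->
  smooth_on U (fun x => f x + g x).
Proof. by move=> oU sf sg k; exact: CkD. Qed.

Lemma smooth_derive U f v : smooth_on U f -> smooth_on U ('D_v f).
Proof. by move=> H k; have [_ /(_ v)[]] := H k.+1. Qed.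

Lemma smooth_derivable U f v x : smooth_on U f -> U x -> derivable f x v.
Proof. by move=> H; have [_ /(_ v)[d _]] := H 1; exact: d. Qed.

Lemma smooth_continuous U f x : smooth_on U f -> U x -> {for x, continuous f}.
Proof. by move=> H; have [d _] := H 0; exact: d. Qed.

End Smooth_general.
Arguments smooth_derivable {R V W U f} v {x}.

Section Smooth_scalar.
Context {R : realType} {V : normedModType R}.
Implicit Types (U : set V) (f g : V -> R).

Lemma smoothM U f g : open U -> smooth_on U f -> smooth_on U g ->
  smooth_on U (fun x => f x * g x).
Proof. by move=> oU sf sg k; exact: CkM. Qed.

Lemma smoothN U f : open U -> smooth_on U f -> smooth_on U (fun x => - f x).
Proof.
move=> oU sf; apply: (smooth_eq oU _ (smoothM oU (smooth_cst U (-1 : R)) sf)) => x _.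
by rewrite mulN1r.
Qed.

Lemma smoothB U f g : open U -> smooth_on U f -> smooth_on U g ->
  smooth_on U (fun x => f x - g x).
Proof. by move=> oU sf sg; apply: smoothD => //; exact: smoothN. Qed.

Lemma smoothX U f n : open U -> smooth_on U f -> smooth_on U (fun x => f x ^+ n).
Proof.
move=> oU sf; elim: n => [|n IH].
  by apply: (smooth_eq oU _ (smooth_cst U (1 : R))) => x _; rewrite expr0.
by apply: (smooth_eq oU _ (smoothM oU sf IH)) => x _; rewrite exprS.
Qed.

Lemma smoothV U f : open U -> (forall x, U x -> f x != 0) -> smooth_on U f ->
  smooth_on U (fun x => (f x)^-1).
Proof. by move=> oU f0 sf k; exact: CkV. Qed.

Lemma smooth_sum U n (F : 'I_n -> V -> R) : open U ->
  (forall i, smooth_on U (F i)) -> smooth_on U (fun x => \sum_i F i x).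
Proof. by move=> oU sF k; apply: Ck_sum => // i; exact: sF. Qed.

Lemma smooth_mxP U m n (f : V -> 'M[R]_(m, n)) : open U ->
  smooth_on U f <-> forall i j, smooth_on U (fun x => f x i j).
Proof.
move=> oU; split=> [H i j k|H k]; first by have /(Ck_mxP _ _ oU) := H k; exact.
by apply/Ck_mxP => // i j; exact: H.
Qed.

Lemma smooth_rowP U n (f : V -> 'rV[R]_n) : open U ->
  (forall i, smooth_on U (fun x => f x 0 i)) -> smooth_on U f.
Proof. by move=> oU H; apply/smooth_mxP => // i j; rewrite (ord1 i). Qed.

(** The derivative of the root contains the root again, in a denominator; hence an induction on the
    order, in which the root is already known to be of the lower class. *)
Lemma smooth_sqrt U f : open U -> (forall x, U x -> 0 < f x) -> smooth_on U f ->
  smooth_on U (fun x => Num.sqrt (f x)).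
Proof.
move=> oU f0 sf.
have cs x : U x -> {for x, continuous (fun x => Num.sqrt (f x))}.
  move=> Ux; apply: continuous_comp; first exact: smooth_continuous sf Ux.
  exact: sqrt_continuous.
elim=> [|k IH]; first by split.
split=> // v.
have ds x : U x -> is_derive x v (fun x => Num.sqrt (f x))
    ((2 * Num.sqrt (f x))^-1 * 'D_v f x).
  move=> Ux.
  have d1 := smooth_derivable v sf Ux.
  have d2 := is_derive1_sqrt (f0 _ Ux).
  have d3 : differentiable (Num.sqrt : R -> R) (f x).
    by apply/derivable1_diffP; exact: ex_derive.
  have d4 := is_derive_comp_diff d1 d3.
  apply: is_derive_eq d4 _.
  rewrite -['D_v f x in LHS]mulr1 -[_ * 1]/(_ *: (1 : R)).
  have d5 := is_derive_dirZ ('D_v f x) (@ex_derive _ _ _ _ _ _ _ d2).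
  rewrite (@derive_val _ _ _ _ _ _ _ d5) (@derive_val _ _ _ _ _ _ _ d2).
  by rewrite -[_ *: _]/(_ * _) mulrC.
split; first by move=> x /ds d; exact: ex_derive.
apply: (@Ck_eq _ _ _ _ _ (fun x => (2 * Num.sqrt (f x))^-1 * 'D_v f x)) => //.
  by move=> x /ds d; rewrite (@derive_val _ _ _ _ _ _ _ d).
apply: CkM => //; last exact: smooth_derive.
apply: CkV => //; last by apply: CkM => //; exact: Ck_cst.
by move=> x Ux; rewrite mulf_neq0 // gt_eqF // sqrtr_gt0 f0.
Qed.

End Smooth_scalar.

Section Smooth_row.
Context {R : realType}.

Lemma smooth_coord n (U : set 'rV[R]_n) i : open U -> smooth_on U (fun x => x 0 i).
Proof.
move=> oU; case=> [|k]; split=> //; try by move=> x _; exact: coord_continuous.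
move=> v.
have D x : is_derive x v (fun x : 'rV[R]_n => x 0 i) (v 0 i).
  have /derivable_mxP H : derivable (@id 'rV[R]_n) x v by exact: derivable_id.
  split; first exact: H.
  by have := derive_mx (@derivable_id _ _ x v) => /rowP/(_ i); rewrite derive_id mxE => <-.
split; first by move=> x _; exact: ex_derive.
rewrite [X in Ck _ _ X](_ : _ = fun=> v 0 i); first exact: Ck_cst.
by apply/funext => x; exact: derive_val.
Qed.

Lemma smooth_id n (U : set 'rV[R]_n) : open U -> smooth_on U id.
Proof. by move=> oU; apply: smooth_rowP => // i; exact: smooth_coord. Qed.

Lemma smooth_comp_R m n (U : set 'rV[R]_m) (U' : set 'rV[R]_n)
    (f : 'rV[R]_m -> 'rV[R]_n) (g : 'rV[R]_n -> R) :
  open U -> open U' -> (forall x, U x -> U' (f x)) ->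
  smooth_on U f -> smooth_on U' g -> smooth_on U (g \o f).
Proof. by move=> oU oU' fU sf sg k; exact: (Ck_comp_R oU oU' fU). Qed.

Lemma smooth_comp m n p q (U : set 'rV[R]_m) (U' : set 'rV[R]_n)
    (f : 'rV[R]_m -> 'rV[R]_n) (g : 'rV[R]_n -> 'M[R]_(p, q)) :
  open U -> open U' -> (forall x, U x -> U' (f x)) ->
  smooth_on U f -> smooth_on U' g -> smooth_on U (g \o f).
Proof.
move=> oU oU' fU sf /(smooth_mxP _ oU') sg; apply/smooth_mxP => // i j.
exact: (smooth_comp_R oU oU' fU sf (sg i j)).
Qed.

Lemma smooth_differentiable_R n (U : set 'rV[R]_n) (f : 'rV[R]_n -> R) x :
  open U -> smooth_on U f -> U x -> differentiable f x.
Proof. by move=> oU sf; exact: Ck1_differentiable_R (sf 1). Qed.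

Lemma smooth_differentiable n p q (U : set 'rV[R]_n) (f : 'rV[R]_n -> 'M[R]_(p, q)) x :
  open U -> smooth_on U f -> U x -> differentiable f x.
Proof. by move=> oU sf; exact: Ck1_differentiable (sf 1). Qed.

Lemma derive_mxE n p q (U : set 'rV[R]_n) (f : 'rV[R]_n -> 'M[R]_(p, q)) x v i j :
  smooth_on U f -> U x -> ('D_v f x) i j = 'D_v (fun y => f y i j) x.
Proof. by move=> sf Ux; rewrite derive_mx ?mxE //; exact: (smooth_derivable _ sf Ux). Qed.

Lemma smooth_derive_dir_R n (U : set 'rV[R]_n) (f : 'rV[R]_n -> R) w :
  open U -> smooth_on U f -> smooth_on U w -> smooth_on U (fun x => 'D_(w x) f x).
Proof.
move=> oU sf /(smooth_mxP _ oU) sw.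
apply: (@smooth_eq _ _ _ _ (fun x => \sum_i w x 0 i * 'D_(delta_mx 0 i) f x)) => //.
  by move=> x Ux; rewrite -derive_coord //; exact: smooth_differentiable_R sf Ux.
by apply: smooth_sum => // i; apply: smoothM => //; exact: smooth_derive.
Qed.

Lemma smooth_derive_dir n p q (U : set 'rV[R]_n) (f : 'rV[R]_n -> 'M[R]_(p, q)) w :
  open U -> smooth_on U f -> smooth_on U w -> smooth_on U (fun x => 'D_(w x) f x).
Proof.
move=> oU sf sw; apply/smooth_mxP => // i j.
apply: (@smooth_eq _ _ _ _ (fun x => 'D_(w x) (fun y => f y i j) x)) => //.
  by move=> x Ux; rewrite (derive_mxE _ _ _ sf).
by apply: smooth_derive_dir_R => //; have /(smooth_mxP _ oU) := sf; exact.
Qed.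

End Smooth_row.

Section Directions.
Context {R : realType} {V W : normedModType R}.
Variables (f : V -> W) (x : V).
Hypothesis df : differentiable f x.

Lemma derive_dirD u v : 'D_(u + v) f x = 'D_u f x + 'D_v f x.
Proof. by rewrite !deriveE // linearD. Qed.

Lemma derive_dirB u v : 'D_(u - v) f x = 'D_u f x - 'D_v f x.
Proof. by rewrite !deriveE // linearB. Qed.

Lemma derive_dirZ a u : 'D_(a *: u) f x = a *: 'D_u f x.
Proof. by rewrite !deriveE // linearZ. Qed.

Lemma derive_dir_sum n (u : 'I_n -> V) : 'D_(\sum_i u i) f x = \sum_i 'D_(u i) f x.
Proof. by rewrite deriveE // linear_sum; apply: eq_bigr => i _; rewrite deriveE. Qed.

End Directions.

(** * Vector fields as derivations and their commutators *)

Section Lie.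
Context {R : realType} {n : nat}.
Implicit Types (U : set 'rV[R]_n) (w : 'rV[R]_n -> 'rV[R]_n).

(** Product rule for the sum of w_i times the i-th partial derivative of [f]. The second summand is
    symmetric in the two fields once derivatives commute, and it cancels in a commutator. *)
Lemma is_derive_var_dir U (f : 'rV[R]_n -> R) w x u :
  open U -> smooth_on U f -> smooth_on U w -> U x ->
  'D_u (fun y => 'D_(w y) f y) x =
  'D_('D_u w x) f x + \sum_i w x 0 i * 'D_u ('D_(delta_mx 0 i) f) x.
Proof.
move=> oU sf sw Ux.
have nU : \forall y \near x, U y by exact: open_nbhs_nbhs.
rewrite (@near_eq_derive _ _ _ _ (\sum_i (fun y => w y 0 i * 'D_(delta_mx 0 i) f y))); last first.
  near=> y; rewrite fct_sumE -derive_coord //.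
  by apply: (smooth_differentiable_R oU sf); near: y.
have sw' := (smooth_mxP _ oU).1 sw.
have dw i : derivable (fun y => w y 0 i) x u by exact: (smooth_derivable _ (sw' 0 i) Ux).
have dd i : derivable ('D_(delta_mx 0 i) f) x u.
  exact: (smooth_derivable _ (smooth_derive _ sf) Ux).
rewrite derive_sum; last by move=> i; exact: derivableM.
rewrite (derive_coord _ (smooth_differentiable_R oU sf Ux)) -big_split /=.
apply: eq_bigr => i _.
rewrite (@deriveM _ _ (fun y => w y 0 i) _ x u (dw i) (dd i)) (derive_mxE _ _ _ sw Ux).
by rewrite addrC; congr (_ + _); exact: mulrC.
Unshelve. all: by end_near. Qed.

Lemma lie_commutator_R U (f : 'rV[R]_n -> R) w1 w2 x :
  open U -> smooth_on U f -> smooth_on U w1 -> smooth_on U w2 -> U x ->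
  'D_(w1 x) (fun y => 'D_(w2 y) f y) x - 'D_(w2 x) (fun y => 'D_(w1 y) f y) x =
  'D_('D_(w1 x) w2 x - 'D_(w2 x) w1 x) f x.
Proof.
move=> oU sf s1 s2 Ux.
rewrite !(is_derive_var_dir _ oU sf) // (derive_dirB (smooth_differentiable_R oU sf Ux)).
rewrite opprD addrACA [X in _ + X](_ : _ = 0) ?addr0 //; apply/eqP; rewrite subr_eq0; apply/eqP.
have E (a b : 'rV[R]_n) : \sum_i b 0 i * 'D_a ('D_(delta_mx 0 i) f) x =
   \sum_i \sum_j b 0 i * (a 0 j * 'D_(delta_mx 0 j) ('D_(delta_mx 0 i) f) x).
  apply: eq_bigr => i _; rewrite -mulr_sumr; congr (_ * _).
  rewrite (derive_coord _ (smooth_differentiable_R oU (smooth_derive _ sf) Ux)) //.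
refine (etrans (E (w1 x) (w2 x)) (etrans _ (esym (E (w2 x) (w1 x))))).
refine (etrans (exchange_big _ _ _ _ _ _) _) => /=.
apply: eq_bigr => i _; apply: eq_bigr => j _.
by rewrite (derive_comm _ _ oU (sf 2) Ux) mulrCA.
Qed.

(** Entry by entry from the scalar case. It serves to relate brackets in a chart to brackets in the
    ambient space, and, with a constant field, to exchange two derivatives. *)
Lemma lie_commutator U p q (f : 'rV[R]_n -> 'M[R]_(p, q)) w1 w2 x :
  open U -> smooth_on U f -> smooth_on U w1 -> smooth_on U w2 -> U x ->
  'D_(w1 x) (fun y => 'D_(w2 y) f y) x - 'D_(w2 x) (fun y => 'D_(w1 y) f y) x =
  'D_('D_(w1 x) w2 x - 'D_(w2 x) w1 x) f x.
Proof.
move=> oU sf s1 s2 Ux; apply/matrixP => i j; rewrite !mxE.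
have sfij := (smooth_mxP _ oU).1 sf i j.
have nU : \forall y \near x, U y by exact: open_nbhs_nbhs.
have E w w' : smooth_on U w -> ('D_(w' x) (fun y => 'D_(w y) f y) x) i j =
    'D_(w' x) (fun y => 'D_(w y) (fun z => f z i j) y) x.
  move=> sw; rewrite (derive_mxE _ _ _ (smooth_derive_dir oU sf sw) Ux).
  apply: near_eq_derive; near=> y; rewrite (derive_mxE _ _ _ sf) //.
  by near: y.
rewrite (derive_mxE _ _ _ sf Ux) -(lie_commutator_R oU sfij s1 s2 Ux).
by congr (_ - _); [exact: E w2 w1 s2|exact: E w1 w2 s1].
Unshelve. all: by end_near. Qed.

End Lie.

(** * Charts of embedded submanifolds *)

Section SecondCountable.

Lemma second_countable_rV (R : realType) n : @second_countable 'rV[R]_n.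
Proof.
pose f (c : 'rV[rat]_n * nat) : set 'rV[R]_n :=
  ball (map_mx (@ratr R) c.1 : 'rV[R]_n) (c.2.+1%:R^-1 : R).
exists (range f); first by apply: (sub_countable (card_image_le f setT)); exact: countableP.
split=> [_ [c _ <-]|x A /nbhs_ballP[r /= r0 xA]]; first exact: ball_open.
have [k kr] : exists k, k.+1%:R^-1 < r / 2 :> R.
  have r2 : 0 < r / 2 by rewrite divr_gt0.
  have [k] := ltr_add_invr r2.
  by rewrite add0r; exists k.
have k0 : 0 < k.+1%:R^-1 :> R by [].
have /choice[q xq] i : exists a : rat, `|x 0 i - ratr a| < k.+1%:R^-1 :> R.
  have [z [xa [a _ az]]] := dense_rat (ex_intro _ (x 0 i) (ballxx _ k0))
    (ball_open (x 0 i) k.+1%:R^-1).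
  by exists a; rewrite az.
have xq' : ball (map_mx (@ratr R) (\row_i q i) : 'rV[R]_n) (k.+1%:R^-1 : R) x.
  by split=> // i j; rewrite !mxE (ord1 i) /ball /= distrC.
exists (f (\row_i q i, k)) => /=; first by split=> //; exists (\row_i q i, k).
move=> y fy; apply: xA; rewrite [r]splitr.
apply: (@ball_triangle _ _ (map_mx (@ratr R) (\row_i q i))).
  by apply: (le_ball (ltW kr)); exact: ball_sym.
exact: (le_ball (ltW kr)).
Qed.

Lemma second_countable_pull (X Y : topologicalType) (f : X -> Y) :
  continuous f ->
  (forall x A, nbhs x A -> exists2 B, nbhs (f x) B & f @^-1` B `<=` A) ->
  @second_countable Y -> @second_countable X.
Proof.
move=> cf nf [B cB [oB bB]]; exists ((fun b => f @^-1` b) @` B).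
  by apply: sub_countable cB; exact: card_image_le.
split=> [_ [b Bb <-]|x A /nf[C /bB[b /= [Bb bfx] bC] CA]].
  by apply: open_comp => [y _|]; [exact: cf|exact: oB].
by exists (f @^-1` b); [split=> //; exists b|move=> y /bC /CA].
Qed.

Lemma second_countable_push (X Y : topologicalType) (f : X -> Y) :
  continuous f -> (forall y, exists x, f x = y) ->
  (forall A, open A -> open (f @` A)) ->
  @second_countable X -> @second_countable Y.
Proof.
move=> cf sf of_ [B cB [oB bB]]; exists ((fun b => f @` b) @` B).
  by apply: sub_countable cB; exact: card_image_le.
split=> [_ [b Bb <-]|y A yA]; first exact/of_/oB.
have [x xy] := sf y; have : nbhs x (f @^-1` A) by apply: cf; rewrite xy.
move=> /bB[b /= [Bb bx] bA]; exists (f @` b).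
  by split; [exists b|exists x].
by move=> _ [z bz <-]; exact: bA.
Qed.

Lemma hausdorff_pull (X Y : topologicalType) (f : X -> Y) :
  continuous f -> injective f -> hausdorff_space Y -> hausdorff_space X.
Proof.
move=> cf fI hY x y xy; apply/fI/hY => A B /cf fA /cf fB.
by have [z [Az Bz]] := xy _ _ fA fB; exists (f z).
Qed.

Lemma hausdorff_rV (R : realType) n : hausdorff_space 'rV[R]_n.
Proof. exact: norm_hausdorff. Qed.

End SecondCountable.

Section Charts.
Context {R : realType} {N n : nat} {T : topologicalType}.
Variables (emb : T -> 'rV[R]_N) (mul : T -> T -> T) (one : T).
Let G := @EmbeddedGroup R T 'rV[R]_N emb mul one.
Implicit Types c d : chart R T n.

Lemma chart_cinv c x : is_chart c -> cimg c x ->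
  cdom c (cinv c x) /\ cto c (cinv c x) = x.
Proof. by move=> [_ _ cK _ _] [p cp <-]; rewrite cK. Qed.

Lemma chart_cto c p : is_chart c -> cdom c p -> cimg c (cto c p) /\ cinv c (cto c p) = p.
Proof. by move=> [_ _ cK _ _] cp; split; [exists p|exact: cK]. Qed.

(** The inverse of the chart seen in the ambient space. Tangent vectors in charts are compared with
    ambient vectors through its differential. *)
Definition phi c : 'rV[R]_n -> 'rV[R]_N := emb \o cinv c.

Lemma eg_is_chart c : eg_atlas G n c -> is_chart c.
Proof. by case. Qed.

Lemma phi_smooth c : eg_atlas G n c -> smooth_on (cimg c) (phi c).
Proof. by case. Qed.

Lemma cimg_open c : is_chart c -> open (cimg c).
Proof. by case. Qed.

Lemma phi_diff c x : eg_atlas G n c -> cimg c x -> differentiable (phi c) x.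
Proof.
move=> Ac cx; apply: smooth_differentiable (phi_smooth Ac) cx.
exact/cimg_open/eg_is_chart.
Qed.

Lemma near_cimg c x : is_chart c -> cimg c x -> \forall y \near x, cimg c y.
Proof. by move=> cc cx; apply: open_nbhs_nbhs; split=> //; exact: cimg_open. Qed.

(** The ambient extension of the chart is, near [x], a smooth left inverse of [phi]. So [phi] is an
    immersion, and a map into the group is smooth in the chart when it is smooth in the ambient
    space. *)
Lemma chart_retract c x : continuous emb -> eg_atlas G n c -> cimg c x ->
  exists (U : set 'rV[R]_N) (F : 'rV[R]_N -> 'rV[R]_n),
    [/\ open U, U (phi c x), smooth_on U F,
        forall q, cdom c q -> U (emb q) -> F (emb q) = cto c q &
        \forall y \near x, [/\ cimg c y, U (phi c y) & F (phi c y) = y]].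
Proof.
move=> cemb [cc sc locc] cx; have [cp cpx] := chart_cinv cc cx.
have [U [F [oU Up sF FE]]] := locc _ cp; exists U, F; split=> //.
have cphi : {for x, continuous (phi c)} by exact: (smooth_continuous sc cx).
have nU : \forall y \near x, U (phi c y) by apply: cphi; exact: open_nbhs_nbhs.
near=> y.
have cy : cimg c y by near: y; exact: near_cimg.
have Uy : U (phi c y) by near: y.
have [cq cqy] := chart_cinv cc cy.
by split=> //; rewrite /phi /= FE.
Unshelve. all: by end_near. Qed.

Lemma phi_derive_retract c x (F : 'rV[R]_N -> 'rV[R]_n) U u : eg_atlas G n c -> cimg c x ->
  open U -> U (phi c x) -> smooth_on U F ->
  (\forall y \near x, [/\ cimg c y, U (phi c y) & F (phi c y) = y]) ->
  'D_('D_u (phi c) x) F (phi c x) = u.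
Proof.
move=> Ac cx oU Ux sF nF.
have H := is_derive_comp_diff (smooth_derivable u (phi_smooth Ac) cx)
  (smooth_differentiable oU sF Ux).
rewrite -(@derive_val _ _ _ _ _ _ _ H) -[RHS](derive_id x u).
by apply: near_eq_derive; apply: filterS nF => y [].
Qed.

(** A left inverse of [phi] differentiates to a left inverse of its differential. *)
Lemma phi_derive_inj c x u v : continuous emb -> eg_atlas G n c -> cimg c x ->
  'D_u (phi c) x = 'D_v (phi c) x -> u = v.
Proof.
move=> cemb Ac cx E; have [U [F [oU Ux sF _ nF]]] := chart_retract cemb Ac cx.
by rewrite -(phi_derive_retract u Ac cx oU Ux sF nF) E (phi_derive_retract v Ac cx oU Ux sF nF).
Qed.

End Charts.

Section Loc.
Context {R : realType} {M M' : topologicalType} {m n : nat}.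
Implicit Types (c : chart R M m) (d : chart R M' n) (f : M -> M').

Lemma loc_dom_open c d f : is_chart c -> is_chart d -> continuous f ->
  open (loc_dom c d f).
Proof.
move=> cc [od _ _ _ _] cf; rewrite openE => x [cx dx] /=.
have [_ _ _ _ ccinv] := cc.
have nd : \forall y \near x, cdom d (f (cinv c y)).
  apply: (continuous_comp (ccinv _ cx) (cf _)).
  exact: open_nbhs_nbhs.
near=> y; split; first by near: y; exact: near_cimg.
by near: y.
Unshelve. all: by end_near. Qed.

Lemma loc_cimg c d f x : is_chart d -> loc_dom c d f x -> cimg d (loc c d f x).
Proof. by move=> cd [cx dx]; exists (f (cinv c x)). Qed.

Lemma loc_cinv c d f x : is_chart d -> loc_dom c d f x ->
  cinv d (loc c d f x) = f (cinv c x).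
Proof. by move=> cd [cx dx]; rewrite /loc /=; have [_ ->] := chart_cto cd dx. Qed.

End Loc.

Section LocEmbedded.
Context {R : realType} {N n : nat} {T : topologicalType}.
Variables (emb : T -> 'rV[R]_N) (mul : T -> T -> T) (one : T).
Hypothesis cemb : continuous emb.
Context {N' n' : nat} {T' : topologicalType}.
Variables (emb' : T' -> 'rV[R]_N') (mul' : T' -> T' -> T') (one' : T').
Hypothesis cemb' : continuous emb'.
Let G := @EmbeddedGroup R T 'rV[R]_N emb mul one.
Let G' := @EmbeddedGroup R T' 'rV[R]_N' emb' mul' one'.
Variables (f : T -> T') (F : 'rV[R]_N -> 'rV[R]_N').
Hypotheses (cf : continuous f) (sF : smooth_on setT F).
Hypothesis fF : forall q, emb' (f q) = F (emb q).

(** Locally [loc c d f] is the composite of [phi], of the ambient extension [F] of [f], and of the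
    retraction belonging to the chart [d]. *)
Lemma loc_smooth c d : eg_atlas G n c -> eg_atlas G' n' d ->
  smooth_on (loc_dom c d f) (loc c d f).
Proof.
move=> Ac Ad; have cc := eg_is_chart Ac; have cd := eg_is_chart Ad.
have oL := loc_dom_open cc cd cf.
apply: smooth_local => x Lx.
have [U [H [oU Ux sH HE _]]] := chart_retract cemb' Ad (loc_cimg cd Lx).
pose U' := loc_dom c d f `&` (F \o phi emb c) @^-1` U.
have sFp : smooth_on (loc_dom c d f) (F \o phi emb c).
  apply: (smooth_comp oL openT _ _ sF) => //.
  by apply: smooth_subset (phi_smooth Ac) => y [].
have oU' : open U'.
  rewrite openE => y [Ly Uy]; apply: filterI; first exact: open_nbhs_nbhs.
  by apply: (smooth_continuous sFp Ly); exact: open_nbhs_nbhs.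
exists U'.
  by split=> //=; rewrite -fF -(loc_cinv cd Lx).
apply: (@smooth_eq _ _ _ _ (H \o (F \o phi emb c))) => //.
  by move=> y [[cy dy] /= Uy]; rewrite -fF HE // fF.
apply: (smooth_comp oU' oU _ _ sH); first by move=> y [].
by apply: smooth_subset sFp => y [].
Qed.

(** Both sides differentiate the same map: [phi] after [loc c d f] is [F] after [phi]. *)
Lemma loc_derive c d x u : eg_atlas G n c -> eg_atlas G' n' d -> loc_dom c d f x ->
  'D_('D_u (loc c d f) x) (phi emb' d) (loc c d f x) =
  'D_('D_u (phi emb c) x) F (phi emb c x).
Proof.
move=> Ac Ad Lx; have cc := eg_is_chart Ac; have cd := eg_is_chart Ad.
have oL := loc_dom_open cc cd cf.
have [cx dx] := Lx.
have H1 := is_derive_comp_diff (smooth_derivable u (loc_smooth Ac Ad) Lx)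
  (phi_diff Ad (loc_cimg cd Lx)).
have H2 := is_derive_comp_diff (smooth_derivable u (phi_smooth Ac) cx)
  (smooth_differentiable openT sF (I : setT (phi emb c x))).
rewrite -(@derive_val _ _ _ _ _ _ _ H1) -(@derive_val _ _ _ _ _ _ _ H2).
apply: near_eq_derive.
have nL : \forall y \near x, loc_dom c d f y by exact: open_nbhs_nbhs.
by apply: filterS nL => y Ly; rewrite /phi /= -/(loc c d f y) -fF (loc_cinv cd Ly).
Qed.

End LocEmbedded.

(** * Groups with a left-invariant frame *)

(* [Lt a] extends the left translation by [a] to the ambient space, and the restriction
   of [E i] to the group is a left-invariant vector field. *)
Record framed_group (R : realType) (N n : nat) (T : topologicalType)
    (emb : T -> 'rV[R]_N) (mul : T -> T -> T) (one : T) (inv : T -> T)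
    (Lt : T -> 'rV[R]_N -> 'rV[R]_N) (E : 'I_n -> 'rV[R]_N -> 'rV[R]_N) : Prop :=
  FramedGroup {
    fg_mulg1 : forall a, mul a one = a;
    fg_mulKg : forall a b, mul (inv a) (mul a b) = b;
    fg_mulVKg : forall a b, mul a (mul (inv a) b) = b;
    fg_emb_inj : injective emb;
    fg_emb_cont : continuous emb;
    fg_emb_nbhs : forall p A, nbhs p A ->
      exists2 B, nbhs (emb p) B & emb @^-1` B `<=` A;
    fg_Lt_smooth : forall a, smooth_on setT (Lt a);
    fg_Lt_emb : forall a b, emb (mul a b) = Lt a (emb b);
    fg_E_smooth : forall i, smooth_on setT (E i);
    fg_E_left : forall a b i,
      'D_(E i (emb b)) (Lt a) (emb b) = E i (emb (mul a b));
    fg_E_free : forall u : 'rV[R]_n,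
      \sum_i u 0 i *: E i (emb one) = 0 -> u = 0;
    fg_curve : forall i, exists2 c : R -> T,
      c 0 = one & is_derive (0 : R) 1 (emb \o c) (E i (emb one));
    fg_chart : exists2 c,
      eg_atlas (@EmbeddedGroup R T 'rV[R]_N emb mul one) n c & cdom c one }.

Section Framed.
Context {R : realType} {N n : nat} {T : topologicalType}.
Context {emb : T -> 'rV[R]_N} {mul : T -> T -> T} {one : T} {inv : T -> T}.
Context {Lt : T -> 'rV[R]_N -> 'rV[R]_N} {E : 'I_n -> 'rV[R]_N -> 'rV[R]_N}.
Hypothesis fg : framed_group emb mul one inv Lt E.
Let G := @EmbeddedGroup R T 'rV[R]_N emb mul one.
Let cemb := fg_emb_cont fg.
Implicit Types c d : chart R T n.

Lemma fg_mulVg a : mul (inv a) a = one.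
Proof. by rewrite -{2}(fg_mulg1 fg a) (fg_mulKg fg). Qed.

Lemma initial_cont (X : topologicalType) (f : X -> T) x :
  {for x, continuous (emb \o f)} -> {for x, continuous f}.
Proof.
move=> cf A /(fg_emb_nbhs fg)[B Bx BA].
by move: (cf _ Bx); apply: (@filterS _ (nbhs x)) => y; exact: BA.
Qed.

Lemma mul_continuous a : continuous (mul a).
Proof.
move=> b; apply: initial_cont.
rewrite (_ : emb \o mul a = Lt a \o emb); last by apply/funext => x; exact: (fg_Lt_emb fg).
apply: continuous_comp; first exact: cemb.
exact: (smooth_continuous (fg_Lt_smooth fg a) I).
Qed.

(** The left translate of a chart. The single chart around the identity granted by [fg_chart] thus
    gives charts everywhere. *)
Definition tchart a c : chart R T n :=
  @Chart R T n (mul (inv a) @^-1` cdom c) (cto c \o mul (inv a)) (mul a \o cinv c).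

Lemma cimg_tchart a c : cimg (tchart a c) = cimg c.
Proof.
apply/seteqP; split=> x [p cp <-] /=; first by exists (mul (inv a) p).
by exists (mul a p) => /=; rewrite ?(fg_mulKg fg).
Qed.

Lemma tchart_atlas a c : eg_atlas G n c -> eg_atlas G n (tchart a c).
Proof.
move=> Ac; have [cc sc lc] := Ac; have [od oi cK ct ci] := cc; split.
- split; [| by rewrite cimg_tchart | | | rewrite cimg_tchart].
  + by apply: open_comp od => x _; exact: mul_continuous.
  + by move=> p cp /=; rewrite cK // (fg_mulVKg fg).
  + move=> p cp; apply: continuous_comp; [exact: mul_continuous|exact: ct].
  + move=> x cx; apply: continuous_comp; [exact: ci|exact: mul_continuous].
- rewrite cimg_tchart; apply: (@smooth_eq _ _ _ _ (Lt a \o phi emb c)) => //.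
    by move=> x _ /=; rewrite (fg_Lt_emb fg).
  exact: (smooth_comp oi openT _ sc (fg_Lt_smooth fg a)).
- move=> p cp; have [U [F [oU Up sF FE]]] := lc _ cp.
  exists (Lt (inv a) @^-1` U), (F \o Lt (inv a)); split.
  + apply: open_comp oU => x _; exact: (smooth_continuous (fg_Lt_smooth fg (inv a)) I).
  + by rewrite /= -(fg_Lt_emb fg).
  + have oV : open (Lt (inv a) @^-1` U).
      by apply: open_comp oU => x _; exact: (smooth_continuous (fg_Lt_smooth fg (inv a)) I).
    apply: (smooth_comp oV oU _ _ sF) => //.
    exact: smooth_subset (fg_Lt_smooth fg (inv a)).
  + by move=> q cq /=; rewrite -(fg_Lt_emb fg) => Uq; rewrite FE.
Qed.

Lemma chart_at p : exists2 c, eg_atlas G n c & cdom c p.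
Proof.
have [c Ac c1] := fg_chart fg; exists (tchart p c); first exact: tchart_atlas.
by rewrite /= fg_mulVg.
Qed.

Lemma group_smooth_map (n' N' : nat) (T' : topologicalType) (emb' : T' -> 'rV[R]_N') mul' one'
    (f : T' -> T) F (cemb' : continuous emb') : smooth_on setT F ->
  (forall q, emb (f q) = F (emb' q)) ->
  smooth_map (eg_atlas (@EmbeddedGroup R T' 'rV[R]_N' emb' mul' one') n') (eg_atlas G n) f.
Proof.
move=> sF fF.
have cf : continuous f.
  move=> q; apply: initial_cont.
  rewrite (_ : emb \o f = F \o emb'); last by apply/funext => x; exact: fF.
  by apply: continuous_comp; [exact: cemb'|exact: (smooth_continuous sF I)].
by split=> // c d Ac Ad; exact: (loc_smooth cemb cf sF fF Ac Ad).
Qed.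

Lemma group_manifold : is_manifold (eg_atlas G n).
Proof.
split.
- exact: hausdorff_pull cemb (fg_emb_inj fg) (@hausdorff_rV _ _).
- exact: (second_countable_pull cemb (fg_emb_nbhs fg) (second_countable_rV _ _)).
- by move=> c [].
- exact: chart_at.
- move=> c d Ac Ad.
  have cid : continuous (@id T) by move=> x A.
  exact: (loc_smooth cemb cid (smooth_id openT) (fun q => erefl) Ac Ad).
Qed.

Lemma E_freeP a (u : 'rV[R]_n) : \sum_i u 0 i *: E i (emb a) = 0 -> u = 0.
Proof.
move=> H; apply: (fg_E_free fg).
have dL : differentiable (Lt (inv a)) (emb a).
  exact: (smooth_differentiable openT (fg_Lt_smooth fg (inv a)) I).
have := derive_dir_sum dL (fun i => u 0 i *: E i (emb a)); rewrite H derive0 => /esym H'.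
rewrite -[RHS]H'; apply: eq_bigr => i _.
by rewrite (derive_dirZ dL) (fg_E_left fg) fg_mulVg.
Qed.

Lemma curve_at i p : exists2 c : R -> T, c 0 = p &
  is_derive (0 : R) 1 (emb \o c) (E i (emb p)).
Proof.
have [c c0 dc] := fg_curve fg i; exists (mul p \o c).
  by rewrite /= c0 (fg_mulg1 fg).
have dL : differentiable (Lt p) ((emb \o c) 0).
  exact: (smooth_differentiable openT (fg_Lt_smooth fg p) I).
have H := is_derive_comp_diff (@ex_derive _ _ _ _ _ _ _ dc) dL.
rewrite (_ : emb \o (mul p \o c) = Lt p \o (emb \o c)); last first.
  by apply/funext => x; exact: (fg_Lt_emb fg).
apply: (is_derive_eq H).
by rewrite (@derive_val _ _ _ _ _ _ _ dc) /= c0 (fg_E_left fg) (fg_mulg1 fg).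
Qed.

(** The field [E i] in the chart [c]. It is defined by choice because the tangency of [E i] to the
    group is only known through the curves of [fg_curve]; the default 0 is not reached at points of
    the image of the chart, by [eps_spec]. *)
Definition eps c i (x : 'rV[R]_n) : 'rV[R]_n :=
  xget 0 [set u | 'D_u (phi emb c) x = E i (phi emb c x)].

(** [E i] is the velocity of a curve of the group. Along this curve [phi] after [F] is the identity,
    and differentiating this shows that the image of [E i] under the differential of [F] is a
    preimage of [E i] under that of [phi]. *)
Lemma eps_retract c x (U : set 'rV[R]_N) (F : 'rV[R]_N -> 'rV[R]_n) i :
  eg_atlas G n c -> cimg c x -> open U -> U (phi emb c x) -> smooth_on U F ->
  (forall q, cdom c q -> U (emb q) -> F (emb q) = cto c q) ->
  'D_('D_(E i (phi emb c x)) F (phi emb c x)) (phi emb c) x = E i (phi emb c x).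
Proof.
move=> Ac cx oU Ux sF FE; have cc := eg_is_chart Ac.
have [cp cpx] := chart_cinv cc cx.
have [g g0 dg] := curve_at i (cinv c x).
have dge := @ex_derive _ _ _ _ _ _ _ dg.
have cg : {for (0 : R), continuous (emb \o g)}.
  by apply/differentiable_continuous/derivable1_diffP.
have dF : differentiable F ((emb \o g) 0).
  by rewrite /= g0; exact: (smooth_differentiable oU sF Ux).
have H1 := is_derive_comp_diff dge dF.
have F0 : (F \o (emb \o g)) 0 = x by rewrite /= g0 FE.
have dphi : differentiable (phi emb c) ((F \o (emb \o g)) 0).
  by rewrite F0; exact: phi_diff.
have H2 := is_derive_comp_diff (@ex_derive _ _ _ _ _ _ _ H1) dphi.
have V2 := @derive_val _ _ _ _ _ _ _ H2.
have V1 := @derive_val _ _ _ _ _ _ _ H1.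
have V0 := @derive_val _ _ _ _ _ _ _ dg.
rewrite V1 V0 F0 /= g0 in V2.
rewrite -V2 -V0; apply: near_eq_derive.
have n1 : \forall t \near (0 : R), cdom c (g t).
  by apply: (initial_cont cg); rewrite g0; apply: open_nbhs_nbhs; split=> //; case: cc.
have n2 : \forall t \near (0 : R), U (emb (g t)).
  by apply: cg; rewrite /= g0; exact: open_nbhs_nbhs.
near=> t.
have ct : cdom c (g t) by near: t.
have Ut : U (emb (g t)) by near: t.
rewrite -[LHS]/(emb (cinv c (F (emb (g t))))) (FE _ ct Ut).
by have [_ _ cK _ _] := cc; rewrite (cK _ ct).
Unshelve. all: by end_near. Qed.

Lemma eps_spec c i x : eg_atlas G n c -> cimg c x ->
  'D_(eps c i x) (phi emb c) x = E i (phi emb c x).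
Proof.
move=> Ac cx; have [U [F [oU Ux sF FE _]]] := chart_retract cemb Ac cx.
rewrite /eps; case: xgetP => [u _ //|/(_ ('D_(E i (phi emb c x)) F (phi emb c x)))].
by case; exact: (eps_retract i Ac cx oU Ux sF FE).
Qed.

Lemma eps_uniq c i x u : eg_atlas G n c -> cimg c x ->
  'D_u (phi emb c) x = E i (phi emb c x) -> u = eps c i x.
Proof.
move=> Ac cx H; apply: (phi_derive_inj cemb Ac cx).
by rewrite H eps_spec.
Qed.

(** A chosen vector has no evident regularity; by uniqueness it agrees locally with the derivative
    of the retraction along [E i], which is smooth. *)
Lemma eps_smooth c i : eg_atlas G n c -> smooth_on (cimg c) (eps c i).
Proof.
move=> Ac; have cc := eg_is_chart Ac; have oc := cimg_open cc.
apply: smooth_local => x cx.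
have [U [F [oU Ux sF FE _]]] := chart_retract cemb Ac cx.
pose W := cimg c `&` phi emb c @^-1` U.
have oW : open W.
  rewrite openE => y [cy Uy]; apply: filterI; first exact: near_cimg.
  by apply: (smooth_continuous (phi_smooth Ac) cy); exact: open_nbhs_nbhs.
exists W => //.
have sphi : smooth_on W (phi emb c) by apply: smooth_subset (phi_smooth Ac) => y [].
apply: (@smooth_eq _ _ _ _ (fun y => 'D_(E i (phi emb c y)) F (phi emb c y))) => //.
  move=> y [cy Uy]; apply: eps_uniq => //.
  exact: (eps_retract i Ac cy oU Uy sF FE).
have s1 : smooth_on U (fun v => 'D_(E i v) F v).
  by apply: smooth_derive_dir => //; apply: smooth_subset (fg_E_smooth fg i).
by apply: (smooth_comp oW oU _ sphi s1) => y [].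
Qed.

Lemma eps_free c x (u : 'rV[R]_n) : eg_atlas G n c -> cimg c x ->
  \sum_i u 0 i *: eps c i x = 0 -> u = 0.
Proof.
move=> Ac cx H; apply: (@E_freeP (cinv c x)).
have dp := phi_diff Ac cx.
have := derive_dir_sum dp (fun i => u 0 i *: eps c i x); rewrite H derive0 => /esym H'.
rewrite -[RHS]H'; apply: eq_bigr => i _.
by rewrite (derive_dirZ dp) eps_spec.
Qed.

Definition eps_coord c x (v : 'rV[R]_n) : 'rV[R]_n :=
  v *m invmx (\matrix_(i, j) eps c i x 0 j).

Lemma eps_decomp c x v : eg_atlas G n c -> cimg c x ->
  v = \sum_i eps_coord c x v 0 i *: eps c i x.
Proof.
move=> Ac cx; set M : 'M[R]_n := \matrix_(i, j) eps c i x 0 j.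
have ME u : u *m M = \sum_i u 0 i *: eps c i x.
  rewrite mulmx_sum_row; apply: eq_bigr => i _; congr (_ *: _).
  by apply/rowP => j; rewrite !mxE.
have MU : M \in unitmx.
  rewrite -row_free_unit; apply/row_freeP; exists (invmx M); apply: mulmxV.
  rewrite -row_free_unit -kermx_eq0; apply/rowV0P => u /sub_kermxP.
  by rewrite ME; exact: eps_free.
by rewrite -ME /eps_coord -/M mulmxKV.
Qed.

Lemma eps_ambient c i x (f : 'rV[R]_N -> R) U : eg_atlas G n c -> cimg c x ->
  open U -> U (phi emb c x) -> smooth_on U f ->
  'D_(eps c i x) (f \o phi emb c) x = 'D_(E i (phi emb c x)) f (phi emb c x).
Proof.
move=> Ac cx oU Ux sf.
have H := is_derive_comp_diff (smooth_derivable (eps c i x) (phi_smooth Ac) cx)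
  (smooth_differentiable_R oU sf Ux).
by rewrite (@derive_val _ _ _ _ _ _ _ H) eps_spec.
Qed.

Lemma eps_loc_left a c d i x : eg_atlas G n c -> eg_atlas G n d ->
  loc_dom c d (mul a) x ->
  'D_(eps c i x) (loc c d (mul a)) x = eps d i (loc c d (mul a) x).
Proof.
move=> Ac Ad Lx; have cd := eg_is_chart Ad; have [cx _] := Lx.
apply: eps_uniq => //; first exact: loc_cimg.
have H := loc_derive cemb (@mul_continuous a) (fg_Lt_smooth fg a) (fg_Lt_emb fg a) (eps c i x) Ac Ad Lx.
have P : phi emb d (loc c d (mul a) x) = emb (mul a (cinv c x)).
  by rewrite -(loc_cinv cd Lx).
rewrite [LHS]H (eps_spec i Ac cx) P.
exact: (fg_E_left fg).
Qed.

Lemma eps_loc_id c d i x : eg_atlas G n c -> eg_atlas G n d -> loc_dom c d id x ->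
  'D_(eps c i x) (loc c d id) x = eps d i (loc c d id x).
Proof.
move=> Ac Ad Lx; have cd := eg_is_chart Ad; have [cx _] := Lx.
apply: eps_uniq => //; first exact: loc_cimg.
have cid : continuous (@id T) by move=> y A.
have H := loc_derive cemb cid (smooth_id openT) (fun q => erefl) (eps c i x) Ac Ad Lx.
have P : phi emb d (loc c d id x) = phi emb c x by rewrite /phi /= (loc_cinv cd Lx).
by rewrite [LHS]H derive_id (eps_spec i Ac cx) P.
Qed.

(** The fields [eps] and [E] are related by [phi], and brackets of related fields are related:
    [lie_commutator] is applied to [phi] itself, whose differential is injective. *)
Lemma eps_bracket c x i j (B : 'I_n -> R) : eg_atlas G n c -> cimg c x ->
  'D_(E i (phi emb c x)) (E j) (phi emb c x) - 'D_(E j (phi emb c x)) (E i) (phi emb c x) =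
    \sum_k B k *: E k (phi emb c x) ->
  'D_(eps c i x) (eps c j) x - 'D_(eps c j x) (eps c i) x = \sum_k B k *: eps c k x.
Proof.
move=> Ac cx HB; have oc := cimg_open (eg_is_chart Ac); have dp := phi_diff Ac cx.
apply: (phi_derive_inj cemb Ac cx).
rewrite (derive_dir_sum dp).
rewrite -(lie_commutator oc (phi_smooth Ac) (eps_smooth i Ac) (eps_smooth j Ac) cx).
have D a b : 'D_(eps c a x) (fun y => 'D_(eps c b y) (phi emb c) y) x =
    'D_(E a (phi emb c x)) (E b) (phi emb c x).
  rewrite (@near_eq_derive _ _ _ _ (E b \o phi emb c)); last first.
    by apply: filterS (near_cimg (eg_is_chart Ac) cx) => y cy; rewrite eps_spec.
  have H := is_derive_comp_diff (smooth_derivable (eps c a x) (phi_smooth Ac) cx)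
    (smooth_differentiable openT (fg_E_smooth fg b) I).
  by rewrite (@derive_val _ _ _ _ _ _ _ H) eps_spec.
rewrite !D HB; apply: eq_bigr => k _.
by rewrite (derive_dirZ dp) eps_spec.
Qed.

End Framed.
Arguments eps {R N n T} emb E c i x.

(** * Killing fields in a frame *)

Section Form.
Context {R : realType} {n : nat}.
Implicit Types (G : 'M[R]_n) (u v w : 'rV[R]_n).

Lemma formE G u v : form G u v = \sum_i \sum_j u 0 i * G i j * v 0 j.
Proof.
rewrite /form mxE exchange_big /=; apply: eq_bigr => j _.
by rewrite !mxE mulr_suml; apply: eq_bigr => i _.
Qed.

Lemma formDl G u v w : form G (u + v) w = form G u w + form G v w.
Proof. by rewrite /form !mulmxDl mxE. Qed.

Lemma formDr G u v w : form G u (v + w) = form G u v + form G u w.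
Proof. by rewrite /form linearD mulmxDr mxE. Qed.

Lemma formZl G a u v : form G (a *: u) v = a * form G u v.
Proof. by rewrite /form -!scalemxAl mxE. Qed.

Lemma formZr G a u v : form G u (a *: v) = a * form G u v.
Proof. by rewrite /form linearZ -scalemxAr mxE. Qed.

Lemma formNl G u v : form G (- u) v = - form G u v.
Proof. by rewrite -scaleN1r formZl mulN1r. Qed.

Lemma formNr G u v : form G u (- v) = - form G u v.
Proof. by rewrite -scaleN1r formZr mulN1r. Qed.

Lemma formBl G u v w : form G (u - v) w = form G u w - form G v w.
Proof. by rewrite formDl formNl. Qed.

Lemma formBr G u v w : form G u (v - w) = form G u v - form G u w.
Proof. by rewrite formDr formNr. Qed.

Lemma form0l G u : form G 0 u = 0.
Proof. by rewrite -(scale0r 0) formZl mul0r. Qed.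

Lemma form0r G u : form G u 0 = 0.
Proof. by rewrite -(scale0r 0) formZr mul0r. Qed.

Lemma form_sym G u v : G^T = G -> form G u v = form G v u.
Proof.
move=> sG; rewrite /form (_ : u *m G *m v^T = (v *m G *m u^T)^T) ?mxE //.
by rewrite !trmx_mul trmxK sG mulmxA.
Qed.

Lemma form_sumr G (I : finType) (F : I -> 'rV[R]_n) u :
  form G u (\sum_i F i) = \sum_i form G u (F i).
Proof. by rewrite /form linear_sum mulmx_sumr summxE. Qed.

Lemma formGD (G G' : 'M[R]_n) u v : form (G + G') u v = form G u v + form G' u v.
Proof. by rewrite /form mulmxDr mulmxDl mxE. Qed.

Lemma formGZ a (G : 'M[R]_n) u v : form (a *: G) u v = a * form G u v.
Proof. by rewrite /form -scalemxAr -scalemxAl mxE. Qed.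

Lemma formGsum (I : finType) (G : I -> 'M[R]_n) u v :
  form (\sum_i G i) u v = \sum_i form (G i) u v.
Proof. by rewrite /form mulmx_sumr mulmx_suml summxE. Qed.

Lemma form_mul_invmx G (r : 'rV[R]_n) v : G \in unitmx ->
  form G (r *m invmx G) v = \sum_k r 0 k * v 0 k.
Proof.
by move=> uG; rewrite /form mulmxKV // mxE; apply: eq_bigr => k _; rewrite !mxE.
Qed.

Lemma is_derive_form {V : normedModType R} (g : V -> 'M[R]_n) (a b : V -> 'rV[R]_n) x (w : V) :
  derivable g x w -> derivable a x w -> derivable b x w ->
  is_derive x w (fun y => form (g y) (a y) (b y))
    (form ('D_w g x) (a x) (b x) + form (g x) ('D_w a x) (b x) +
     form (g x) (a x) ('D_w b x)).
Proof.
move=> dg da db.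
have gd i j := (derivable_mxP g x w).1 dg i j.
have ad i j := (derivable_mxP a x w).1 da i j.
have bd i j := (derivable_mxP b x w).1 db i j.
have H i j : is_derive x w (fun y => a y 0 i * g y i j * b y 0 j)
   (a x 0 i * ('D_w g x) i j * b x 0 j + ('D_w a x) 0 i * g x i j * b x 0 j +
    a x 0 i * g x i j * ('D_w b x) 0 j).
  have h1 := is_deriveM (derivableP (ad 0 i)) (derivableP (gd i j)).
  have h2 := is_deriveM h1 (derivableP (bd 0 j)).
  apply: (is_derive_eq h2).
  rewrite (derive_mx da) (derive_mx db) (derive_mx dg) !mxE /=.
  rewrite !fctE -!/(_ *: _ : R^o) /GRing.scale /=.
  by ring.
have H2 : is_derive x w (\sum_i \sum_j (fun y => a y 0 i * g y i j * b y 0 j))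
  (\sum_i \sum_j (a x 0 i * ('D_w g x) i j * b x 0 j +
     ('D_w a x) 0 i * g x i j * b x 0 j + a x 0 i * g x i j * ('D_w b x) 0 j)).
  by apply: is_derive_sum => i; apply: is_derive_sum => j; exact: H.
rewrite (_ : (fun y => form (g y) (a y) (b y)) =
  \sum_i \sum_j (fun y => a y 0 i * g y i j * b y 0 j)); last first.
  apply/funext => y; rewrite formE fct_sumE; apply: eq_bigr => i _.
  by rewrite fct_sumE.
apply: (is_derive_eq H2); rewrite !formE -!big_split /=.
apply: eq_bigr => i _; rewrite -!big_split /=.
by apply: eq_bigr => j _.
Qed.

Lemma smooth_form m (U : set 'rV[R]_m) (g : 'rV[R]_m -> 'M[R]_n) a b : open U ->
  smooth_on U g -> smooth_on U a -> smooth_on U b ->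
  smooth_on U (fun y => form (g y) (a y) (b y)).
Proof.
move=> oU /(smooth_mxP _ oU) sg /(smooth_mxP _ oU) sa /(smooth_mxP _ oU) sb.
rewrite [X in smooth_on _ X](_ : _ = fun y => \sum_i \sum_j a y 0 i * g y i j * b y 0 j).
  apply: smooth_sum => // i; apply: smooth_sum => // j.
  by apply: smoothM => //; apply: smoothM.
by apply/funext => y; exact: formE.
Qed.

Lemma form_nondeg G u : (forall v, v != 0 -> 0 < form G v v) ->
  (forall v, form G u v = 0) -> u = 0.
Proof.
move=> pG H; apply/eqP/negPn/negP => u0.
by have := pG _ u0; rewrite H ltxx.
Qed.

Lemma form_unit G : (forall v, v != 0 -> 0 < form G v v) -> G \in unitmx.
Proof.
move=> pG; rewrite -row_free_unit -kermx_eq0; apply/rowV0P => u /sub_kermxP uG.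
by apply: (form_nondeg pG) => v; rewrite /form uG mul0mx mxE.
Qed.

Lemma is_derive_scale {V : normedModType R} p q (f : V -> R) (w : V -> 'M[R]_(p, q)) x (v : V) :
  derivable f x v -> derivable w x v ->
  is_derive x v (fun y => f y *: w y) ('D_v f x *: w x + f x *: 'D_v w x).
Proof.
move=> df dw; have dwij := (derivable_mxP w x v).1 dw.
have H i j : is_derive x v (fun y => (f y *: w y) i j)
    ('D_v f x * w x i j + f x * ('D_v w x) i j).
  rewrite (_ : (fun y => (f y *: w y) i j) = (fun y => f y * w y i j)); last first.
    by apply/funext => y; rewrite mxE.
  have h := is_deriveM (derivableP df) (derivableP (dwij i j)).
  apply: (is_derive_eq h); rewrite (derive_mx dw) mxE addrC.
  by congr (_ + _); exact: mulrC.
have d : derivable (fun y => f y *: w y) x v.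
  by apply/derivable_mxP => i j; have := H i j; move=> [].
split=> //; rewrite (derive_mx d); apply/matrixP => i j; rewrite [LHS]mxE.
by rewrite (@derive_val _ _ _ _ _ _ _ (H i j)) !mxE.
Qed.

End Form.

(* The prolongation of the Killing equation, for abstract derivations [d0], [d1],
   [d2] with the brackets of the frame: kept abstract because the argument is
   pure algebra. *)
Section KillingPDE.
Context {R : realType} {V : Type}.
Variables (U : set V) (S : (V -> R) -> Prop) (d0 d1 d2 : (V -> R) -> V -> R).
Variables (lam b c : R) (x0 x1 x2 : V -> R).
(** The law required is linearity over constants. It is enough for the prolongation since the
    brackets of the frame have constant coefficients. *)
Definition derivation_on (d : (V -> R) -> V -> R) : Prop :=
  [/\ forall f, S f -> S (d f),
      forall f f', (forall y, U y -> f y = f' y) -> forall x, U x -> d f x = d f' x &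
      forall f f' k k' x, S f -> S f' -> U x ->
        d (fun y => k * f y + k' * f' y) x = k * d f x + k' * d f' x].
Hypotheses (D0 : derivation_on d0) (D1 : derivation_on d1) (D2 : derivation_on d2).
Hypothesis c01 : forall f x, S f -> U x -> d0 (d1 f) x - d1 (d0 f) x = c * d2 f x.
Hypothesis c20 : forall f x, S f -> U x -> d2 (d0 f) x - d0 (d2 f) x = c * d1 f x.
Hypothesis c12 : forall f x, S f -> U x -> d1 (d2 f) x - d2 (d1 f) x = b * d0 f x.
Hypotheses (sx0 : S x0) (sx1 : S x1) (sx2 : S x2).
Hypotheses (lam0 : lam != 0) (b0 : b != 0) (clb : c != lam * b).
(** Here and below, [kij] is the Killing equation evaluated on the i-th and j-th frame vectors. *)
Hypothesis k00 : forall x, U x -> d0 x0 x = 0.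
Hypothesis k11 : forall x, U x -> d1 x1 x = 0.
Hypothesis k22 : forall x, U x -> d2 x2 x = 0.
Hypothesis k01 : forall x, U x -> lam * d1 x0 x = (c - lam * b) * x2 x - d0 x1 x.
Hypothesis k02 : forall x, U x -> lam * d2 x0 x = (lam * b - c) * x1 x - d0 x2 x.
Hypothesis k12 : forall x, U x -> d2 x1 x = - d1 x2 x.

Let p := d0 x1.
Let q := d0 x2.
Let a := d1 x2.
Let sp : S p. Proof. by case: D0 => + _ _; exact. Qed.
Let sq : S q. Proof. by case: D0 => + _ _; exact. Qed.
Let sa : S a. Proof. by case: D1 => + _ _; exact. Qed.
Let sd1 : S (d1 x0). Proof. by case: D1 => + _ _; exact. Qed.
Let sd2 : S (d2 x0). Proof. by case: D2 => + _ _; exact. Qed.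

Let D_scaled d f f1 f2 k l x : derivation_on d -> S f -> S f1 -> S f2 ->
  (forall y, U y -> l * f y = k * f1 y - f2 y) -> U x ->
  l * d f x = k * d f1 x - d f2 x.
Proof.
move=> [_ dE dl] sf sf1 sf2 ff Ux.
have E y : U y -> l * f y + 0 * f y = k * f1 y + -1 * f2 y.
  by move=> Uy; rewrite mul0r addr0 mulN1r ff.
by have := dE _ _ E _ Ux; rewrite !dl // mul0r addr0 mulN1r.
Qed.

Let D_scale d f f1 k x : derivation_on d -> S f1 ->
  (forall y, U y -> f y = k * f1 y) -> U x -> d f x = k * d f1 x.
Proof.
move=> [_ dE dl] sf1 ff Ux.
have E y : U y -> f y = k * f1 y + 0 * f1 y by move=> Uy; rewrite mul0r addr0 ff.
by rewrite (dE _ _ E _ Ux) dl // mul0r addr0.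
Qed.

Let D_0 d f x : derivation_on d -> (forall y, U y -> f y = 0) -> U x -> d f x = 0.
Proof.
move=> Dd f0 Ux; rewrite (@D_scale d f x0 0 x Dd sx0) ?mul0r //.
by move=> y Uy; rewrite f0 // mul0r.
Qed.

Let D_opp d f f1 x : derivation_on d -> S f1 ->
  (forall y, U y -> f y = - f1 y) -> U x -> d f x = - d f1 x.
Proof.
move=> Dd sf1 ff Ux; rewrite (@D_scale d f f1 (-1) x Dd sf1) ?mulN1r //.
by move=> y Uy; rewrite ff // mulN1r.
Qed.

(** The relations [r1] to [r10] other than [r4] are the three bracket relations applied to the three
    coefficients: to [x0] in [r1], [r9], [r10], to [x1] in [r2], [r5], [r7], and to [x2] in [r3],
    [r6], [r8]. They give all first derivatives of [p], [q] and [a], so the system closes. *)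
Let r1 x : U x -> d1 q x = d2 p x.
Proof.
move=> Ux.
have h := c12 sx0 Ux; rewrite (k00 Ux) in h.
have h1 := D_scaled D1 sd2 sx1 sq k02 Ux; rewrite (k11 Ux) in h1.
have h2 := D_scaled D2 sd1 sx2 sp k01 Ux; rewrite (k22 Ux) in h2.
have {}h : lam * d1 (d2 x0) x - lam * d2 (d1 x0) x = 0 by rewrite -mulrBr h !mulr0.
by move: h; rewrite h1 h2; lra.
Qed.

Let r2 x : U x -> d2 p x + d0 a x = 0.
Proof.
move=> Ux; have h := c20 sx1 Ux; rewrite (k11 Ux) in h.
by move: h; rewrite (D_opp D0 sa k12 Ux) mulr0 opprK.
Qed.

Let r3 x : U x -> d0 a x = d1 q x.
Proof.
move=> Ux; have h := c01 sx2 Ux; rewrite (k22 Ux) mulr0 in h.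
by apply/eqP; rewrite -subr_eq0; apply/eqP.
Qed.

Let r4 x : U x -> [/\ d0 a x = 0, d1 q x = 0 & d2 p x = 0].
Proof.
move=> Ux; have h1 := r1 Ux; have h2 := r2 Ux; have h3 := r3 Ux.
by split; lra.
Qed.

Let r5 x : U x -> d1 p x = c * a x.
Proof.
move=> Ux; have h := c01 sx1 Ux; rewrite (k12 Ux) (D_0 D0 k11 Ux) in h.
by move: h; rewrite -/p sub0r mulrN => /oppr_inj.
Qed.

Let r6 x : U x -> d2 q x = c * a x.
Proof. by move=> Ux; have := c20 sx2 Ux; rewrite (D_0 D0 k22 Ux) subr0. Qed.

Let r7 x : U x -> d1 a x = - b * p x.
Proof.
move=> Ux; have h := c12 sx1 Ux.
rewrite (D_0 D2 k11 Ux) subr0 (D_opp D1 sa k12 Ux) in h.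
by rewrite mulNr -h opprK.
Qed.

Let r8 x : U x -> d2 a x = - b * q x.
Proof.
move=> Ux; have h := c12 sx2 Ux; rewrite (D_0 D1 k22 Ux) sub0r in h.
by rewrite mulNr -h opprK.
Qed.

Let r9 x : U x -> d0 p x = (2 * c - lam * b) * q x - c * (lam * b - c) * x1 x.
Proof.
move=> Ux; have h := c01 sx0 Ux; rewrite (D_0 D1 k00 Ux) subr0 in h.
have h1 := D_scaled D0 sd1 sx2 sp k01 Ux.
have h2 := k02 Ux.
have {}h : lam * d0 (d1 x0) x = c * (lam * d2 x0 x) by rewrite h mulrCA.
by move: h; rewrite h1 h2 -/q; lra.
Qed.

Let r10 x : U x -> d0 q x = (lam * b - 2 * c) * p x + c * (c - lam * b) * x2 x.
Proof.
move=> Ux; have h := c20 sx0 Ux; rewrite (D_0 D2 k00 Ux) sub0r in h.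
have h1 := D_scaled D0 sd2 sx1 sq k02 Ux.
have h2 := k01 Ux.
have {}h : - (lam * d0 (d2 x0) x) = c * (lam * d1 x0 x) by rewrite -mulrN h mulrCA.
by move: h; rewrite h1 h2 -/p; lra.
Qed.

Let bcl : b * (c - lam * b) != 0.
Proof. by rewrite mulf_neq0 // subr_eq0. Qed.

(** The compatibility condition that remains is [E1, E2] p = b E0 p. With the derivatives of [p] and
    [a] inserted it becomes b (c - lam b) (q + c x1) = 0. The next lemma does the same with [q] in
    place of [p]. *)
Lemma killing_pde_q x : U x -> d0 x2 x = - c * x1 x.
Proof.
move=> Ux; have h := c12 sp Ux.
rewrite (D_0 D1 (fun y Uy => let: And3 _ _ h := r4 Uy in h) Ux) sub0r in h.
rewrite (D_scale D2 sa r5 Ux) (r8 Ux) (r9 Ux) in h.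
apply/eqP; rewrite -subr_eq0 -(mulrI_eq0 _ (mulfI bcl)); apply/eqP.
by move: h; rewrite -/q; lra.
Qed.

Lemma killing_pde_p x : U x -> d0 x1 x = c * x2 x.
Proof.
move=> Ux; have h := c12 sq Ux.
rewrite (D_0 D2 (fun y Uy => let: And3 _ h _ := r4 Uy in h) Ux) subr0 in h.
rewrite (D_scale D1 sa r6 Ux) (r7 Ux) (r10 Ux) in h.
apply/eqP; rewrite -subr_eq0 -(mulrI_eq0 _ (mulfI bcl)); apply/eqP.
by move: h; rewrite -/p; lra.
Qed.

Lemma killing_pde_1 x : U x -> d1 x0 x = - b * x2 x.
Proof.
by move=> Ux; apply: (mulfI lam0); rewrite (k01 Ux) (killing_pde_p Ux); lra.
Qed.

Lemma killing_pde_2 x : U x -> d2 x0 x = b * x1 x.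
Proof.
by move=> Ux; apply: (mulfI lam0); rewrite (k02 Ux) (killing_pde_q Ux); lra.
Qed.

End KillingPDE.

(** * Brackets and Lie derivatives of the metric in a frame with constant structure coefficients *)

Section FieldInFrame.
Context {R : realType}.
Variables (U : set 'rV[R]_3) (e0 e1 e2 X : 'rV[R]_3 -> 'rV[R]_3) (b c : R).
Variables (x0 x1 x2 : 'rV[R]_3 -> R).
Hypotheses (oU : open U) (s0 : smooth_on U e0) (s1 : smooth_on U e1) (s2 : smooth_on U e2).
Hypotheses (sx0 : smooth_on U x0) (sx1 : smooth_on U x1) (sx2 : smooth_on U x2).
Hypothesis b01 : forall x, U x -> 'D_(e0 x) e1 x - 'D_(e1 x) e0 x = c *: e2 x.
Hypothesis b20 : forall x, U x -> 'D_(e2 x) e0 x - 'D_(e0 x) e2 x = c *: e1 x.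
Hypothesis b12 : forall x, U x -> 'D_(e1 x) e2 x - 'D_(e2 x) e1 x = b *: e0 x.
Hypothesis XE : forall x, U x -> X x = x0 x *: e0 x + x1 x *: e1 x + x2 x *: e2 x.

Let nearU x : U x -> \forall y \near x, U y.
Proof. by move=> Ux; exact: open_nbhs_nbhs. Qed.

Let dX x v : U x -> 'D_v X x =
  ('D_v x0 x *: e0 x + x0 x *: 'D_v e0 x) + ('D_v x1 x *: e1 x + x1 x *: 'D_v e1 x)
  + ('D_v x2 x *: e2 x + x2 x *: 'D_v e2 x).
Proof.
move=> Ux.
have h0 := is_derive_scale (smooth_derivable v sx0 Ux) (smooth_derivable v s0 Ux).
have h1 := is_derive_scale (smooth_derivable v sx1 Ux) (smooth_derivable v s1 Ux).
have h2 := is_derive_scale (smooth_derivable v sx2 Ux) (smooth_derivable v s2 Ux).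
have h := is_deriveD (is_deriveD h0 h1) h2.
rewrite -(@derive_val _ _ _ _ _ _ _ h); apply: near_eq_derive.
by apply: filterS (nearU Ux) => y Uy; rewrite (XE Uy).
Qed.

Let dXe x (e : 'rV[R]_3 -> 'rV[R]_3) : U x -> smooth_on U e ->
  'D_(X x) e x = x0 x *: 'D_(e0 x) e x + x1 x *: 'D_(e1 x) e x + x2 x *: 'D_(e2 x) e x.
Proof.
move=> Ux se; have de := smooth_differentiable oU se Ux.
by rewrite (XE Ux) !(derive_dirD de) !(derive_dirZ de).
Qed.

Let b10 x : U x -> 'D_(e1 x) e0 x - 'D_(e0 x) e1 x = - c *: e2 x.
Proof. by move=> Ux; rewrite -opprB b01 // scaleNr. Qed.
Let b02 x : U x -> 'D_(e0 x) e2 x - 'D_(e2 x) e0 x = - c *: e1 x.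
Proof. by move=> Ux; rewrite -opprB b20 // scaleNr. Qed.
Let b21 x : U x -> 'D_(e2 x) e1 x - 'D_(e1 x) e2 x = - b *: e0 x.
Proof. by move=> Ux; rewrite -opprB b12 // scaleNr. Qed.

Local Notation d0 f := (fun y => 'D_(e0 y) f y).
Local Notation d1 f := (fun y => 'D_(e1 y) f y).
Local Notation d2 f := (fun y => 'D_(e2 y) f y).

Let L_alg (p q r A B C A' B' C' : 'rV[R]_3) (k0 k1 k2 : R) :
  (p + k0 *: A + (q + k1 *: B) + (r + k2 *: C)) - (k0 *: A' + k1 *: B' + k2 *: C') =
  p + q + r + (k0 *: (A - A') + k1 *: (B - B') + k2 *: (C - C')).
Proof. by apply/rowP => i; rewrite !mxE; ring. Qed.

(** Leibniz rule for [e0, X]. The derivatives of the frame vectors occur only in differences, by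
    [L_alg], and these are the known brackets. *)
Lemma frame_bracket0 x : U x -> 'D_(e0 x) X x - 'D_(X x) e0 x =
  d0 x0 x *: e0 x + (d0 x1 x - c * x2 x) *: e1 x + (d0 x2 x + c * x1 x) *: e2 x.
Proof.
move=> Ux; rewrite (dX _ Ux) (dXe Ux s0) L_alg subrr scaler0.
by rewrite (b01 Ux) (b02 Ux); apply/rowP => i; rewrite !mxE; ring.
Qed.

Lemma frame_bracket1 x : U x -> 'D_(e1 x) X x - 'D_(X x) e1 x =
  (d1 x0 x + b * x2 x) *: e0 x + d1 x1 x *: e1 x + (d1 x2 x - c * x0 x) *: e2 x.
Proof.
move=> Ux; rewrite (dX _ Ux) (dXe Ux s1) L_alg subrr scaler0.
by rewrite (b10 Ux) (b12 Ux); apply/rowP => i; rewrite !mxE; ring.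
Qed.

Lemma frame_bracket2 x : U x -> 'D_(e2 x) X x - 'D_(X x) e2 x =
  (d2 x0 x - b * x1 x) *: e0 x + (d2 x1 x + c * x0 x) *: e1 x + d2 x2 x *: e2 x.
Proof.
move=> Ux; rewrite (dX _ Ux) (dXe Ux s2) L_alg subrr scaler0.
by rewrite (b20 Ux) (b21 Ux); apply/rowP => i; rewrite !mxE; ring.
Qed.

Variables (g : 'rV[R]_3 -> 'M[R]_3) (lam : R).
Hypothesis sg : smooth_on U g.

(** The Lie derivative of [g] on (e, e') is X(g(e, e')) - g([X, e], e') - g(e, [X, e']), and its
    first term vanishes when g(e, e') is constant. *)
Lemma lie_metric_frame (e e' : 'rV[R]_3 -> 'rV[R]_3) k x : smooth_on U e -> smooth_on U e' ->
  (forall y, U y -> form (g y) (e y) (e' y) = k) -> U x ->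
  form ('D_(X x) g x) (e x) (e' x) + form (g x) ('D_(e x) X x) (e' x)
    + form (g x) (e x) ('D_(e' x) X x) =
  form (g x) ('D_(e x) X x - 'D_(X x) e x) (e' x) +
  form (g x) (e x) ('D_(e' x) X x - 'D_(X x) e' x).
Proof.
move=> se se' gk Ux.
have h := is_derive_form (smooth_derivable (X x) sg Ux) (smooth_derivable (X x) se Ux)
  (smooth_derivable (X x) se' Ux).
have : 'D_(X x) (fun y => form (g y) (e y) (e' y)) x = 0.
  rewrite (@near_eq_derive _ _ _ _ (cst k)) ?derive_cst //.
  by apply: filterS (nearU Ux) => y Uy; exact: gk.
rewrite (@derive_val _ _ _ _ _ _ _ h) formBl formBr.
by do 5 move: (form _ _ _) => ?; lra.
Qed.

End FieldInFrame.

Section LieMetricBasis.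
Context {R : realType} {n : nat}.
Variables (A G : 'M[R]_n) (Y : 'rV[R]_n -> 'rV[R]_n).
Hypotheses (YD : forall u v, Y (u + v) = Y u + Y v) (YZ : forall a u, Y (a *: u) = a *: Y u).
Let K u v := form A u v + form G (Y u) v + form G u (Y v).

Lemma lie_metric_basis (e0 e1 e2 : 'rV[R]_n) :
  (forall v, exists a0 a1 a2, v = a0 *: e0 + a1 *: e1 + a2 *: e2) ->
  [/\ K e0 e0 = 0, K e0 e1 = 0 & K e0 e2 = 0] ->
  [/\ K e1 e0 = 0, K e1 e1 = 0 & K e1 e2 = 0] ->
  [/\ K e2 e0 = 0, K e2 e1 = 0 & K e2 e2 = 0] -> forall u v, K u v = 0.
Proof.
move=> B [h00 h01 h02] [h10 h11 h12] [h20 h21 h22] u v.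
have KDl a a' z : K (a + a') z = K a z + K a' z.
  by rewrite /K YD !formDl; ring.
have KDr a z z' : K a (z + z') = K a z + K a z'.
  by rewrite /K YD !formDr; ring.
have KZl k a z : K (k *: a) z = k * K a z by rewrite /K YZ !formZl; ring.
have KZr k a z : K a (k *: z) = k * K a z by rewrite /K YZ !formZr; ring.
have [a0 [a1 [a2 ->]]] := B u; have [b0 [b1 [b2 ->]]] := B v.
rewrite !(KDl, KDr, KZl, KZr) h00 h01 h02 h10 h11 h12 h20 h21 h22.
by ring.
Qed.

End LieMetricBasis.

Section LocalKilling.
Context {R : realType}.
Variables (U : set 'rV[R]_3) (g : 'rV[R]_3 -> 'M[R]_3).
Variables (e0 e1 e2 X : 'rV[R]_3 -> 'rV[R]_3) (lam b c : R).
Hypotheses (oU : open U) (sg : smooth_on U g) (symg : forall x, U x -> (g x)^T = g x).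
Hypotheses (s0 : smooth_on U e0) (s1 : smooth_on U e1) (s2 : smooth_on U e2).
Hypothesis sX : smooth_on U X.
Hypothesis b01 : forall x, U x -> 'D_(e0 x) e1 x - 'D_(e1 x) e0 x = c *: e2 x.
Hypothesis b20 : forall x, U x -> 'D_(e2 x) e0 x - 'D_(e0 x) e2 x = c *: e1 x.
Hypothesis b12 : forall x, U x -> 'D_(e1 x) e2 x - 'D_(e2 x) e1 x = b *: e0 x.
Hypothesis basis_e : forall x v, U x ->
  exists a0 a1 a2, v = a0 *: e0 x + a1 *: e1 x + a2 *: e2 x.
Hypothesis g_e : forall x, U x ->
  [/\ form (g x) (e0 x) (e0 x) = lam, form (g x) (e1 x) (e1 x) = 1 &
      form (g x) (e2 x) (e2 x) = 1].
Hypothesis g_o : forall x, U x ->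
  [/\ form (g x) (e0 x) (e1 x) = 0, form (g x) (e0 x) (e2 x) = 0 &
      form (g x) (e1 x) (e2 x) = 0].
Hypotheses (lam0 : lam != 0) (b0 : b != 0) (clb : c != lam * b).
Hypothesis killX : forall x, U x -> forall u v,
  form ('D_(X x) g x) u v + form (g x) ('D_u X x) v + form (g x) u ('D_v X x) = 0.

(** Coefficients of the field in the orthogonal frame; e0 has squared length [lam], hence the
    division. *)
Let x0 y := lam^-1 * form (g y) (X y) (e0 y).
Let x1 y := form (g y) (X y) (e1 y).
Let x2 y := form (g y) (X y) (e2 y).

Let g_o' x : U x ->
  [/\ form (g x) (e1 x) (e0 x) = 0, form (g x) (e2 x) (e0 x) = 0 &
      form (g x) (e2 x) (e1 x) = 0].
Proof.
move=> Ux; have [h1 h2 h3] := g_o Ux.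
by split; rewrite form_sym // symg.
Qed.

Lemma frame_coordsE x v : U x ->
  v = (lam^-1 * form (g x) v (e0 x)) *: e0 x + form (g x) v (e1 x) *: e1 x
      + form (g x) v (e2 x) *: e2 x.
Proof.
move=> Ux; have [a0 [a1 [a2 Ev]]] := basis_e v Ux.
have [h1 h2 h3] := g_o Ux; have [h4 h5 h6] := g_o' Ux; have [k1 k2 k3] := g_e Ux.
rewrite {1}Ev; congr (_ *: _ + _ *: _ + _ *: _); rewrite Ev !formDl !formZl;
  rewrite ?(h1, h2, h3, h4, h5, h6, k1, k2, k3); by field.
Qed.

Let sx0 : smooth_on U x0.
Proof. by apply: smoothM => //; [exact: smooth_cst|exact: smooth_form]. Qed.
Let sx1 : smooth_on U x1. Proof. exact: smooth_form. Qed.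
Let sx2 : smooth_on U x2. Proof. exact: smooth_form. Qed.

Let XE x : U x -> X x = x0 x *: e0 x + x1 x *: e1 x + x2 x *: e2 x.
Proof. by move=> Ux; exact: frame_coordsE. Qed.

Let nearU x : U x -> \forall y \near x, U y.
Proof. by move=> Ux; exact: open_nbhs_nbhs. Qed.

Local Notation d0 f := (fun y => 'D_(e0 y) f y).
Local Notation d1 f := (fun y => 'D_(e1 y) f y).
Local Notation d2 f := (fun y => 'D_(e2 y) f y).

Let L0 x : U x -> 'D_(e0 x) X x - 'D_(X x) e0 x =
  d0 x0 x *: e0 x + (d0 x1 x - c * x2 x) *: e1 x + (d0 x2 x + c * x1 x) *: e2 x.
Proof. exact: (frame_bracket0 oU s0 s1 s2 sx0 sx1 sx2 b01 b20 XE). Qed.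

Let L1 x : U x -> 'D_(e1 x) X x - 'D_(X x) e1 x =
  (d1 x0 x + b * x2 x) *: e0 x + d1 x1 x *: e1 x + (d1 x2 x - c * x0 x) *: e2 x.
Proof. exact: (frame_bracket1 oU s0 s1 s2 sx0 sx1 sx2 b01 b12 XE). Qed.

Let L2 x : U x -> 'D_(e2 x) X x - 'D_(X x) e2 x =
  (d2 x0 x - b * x1 x) *: e0 x + (d2 x1 x + c * x0 x) *: e1 x + d2 x2 x *: e2 x.
Proof. exact: (frame_bracket2 oU s0 s1 s2 sx0 sx1 sx2 b20 b12 XE). Qed.

Let kill_frame (e e' : 'rV[R]_3 -> 'rV[R]_3) k x : smooth_on U e -> smooth_on U e' ->
  (forall y, U y -> form (g y) (e y) (e' y) = k) -> U x ->
  form (g x) ('D_(e x) X x - 'D_(X x) e x) (e' x) +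
  form (g x) (e x) ('D_(e' x) X x - 'D_(X x) e' x) = 0.
Proof.
by move=> se se' gk Ux; rewrite -(lie_metric_frame X oU sg se se' gk Ux); exact: killX.
Qed.

Let form_frame x a0 a1 a2 : U x -> let v := a0 *: e0 x + a1 *: e1 x + a2 *: e2 x in
  [/\ form (g x) v (e0 x) = lam * a0, form (g x) v (e1 x) = a1 & form (g x) v (e2 x) = a2] /\
  [/\ form (g x) (e0 x) v = lam * a0, form (g x) (e1 x) v = a1 & form (g x) (e2 x) v = a2].
Proof.
move=> Ux; have [h1 h2 h3] := g_o Ux; have [h4 h5 h6] := g_o' Ux; have [k1 k2 k3] := g_e Ux.
by split; split; rewrite ?formDl ?formDr ?formZl ?formZr ?(h1, h2, h3, h4, h5, h6, k1, k2, k3); ring.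
Qed.

Let k00 x : U x -> d0 x0 x = 0.
Proof.
move=> Ux; have := kill_frame s0 s0 (fun y Uy => let: And3 h _ _ := g_e Uy in h) Ux.
rewrite (L0 Ux); set u := 'D_(e0 x) x0 x.
have [[-> _ _] [-> _ _]] := form_frame u (d0 x1 x - c * x2 x) (d0 x2 x + c * x1 x) Ux.
by move: u => u H; apply: (mulfI lam0); lra.
Qed.

Let k11 x : U x -> d1 x1 x = 0.
Proof.
move=> Ux; have := kill_frame s1 s1 (fun y Uy => let: And3 _ h _ := g_e Uy in h) Ux.
rewrite (L1 Ux); set u := 'D_(e1 x) x1 x.
have [[_ -> _] [_ -> _]] := form_frame (d1 x0 x + b * x2 x) u (d1 x2 x - c * x0 x) Ux.
by move: u => u; lra.
Qed.

Let k22 x : U x -> d2 x2 x = 0.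
Proof.
move=> Ux; have := kill_frame s2 s2 (fun y Uy => let: And3 _ _ h := g_e Uy in h) Ux.
rewrite (L2 Ux); set u := 'D_(e2 x) x2 x.
have [[_ _ ->] [_ _ ->]] := form_frame (d2 x0 x - b * x1 x) (d2 x1 x + c * x0 x) u Ux.
by move: u => u; lra.
Qed.

Let k01 x : U x -> lam * d1 x0 x = (c - lam * b) * x2 x - d0 x1 x.
Proof.
move=> Ux; have := kill_frame s0 s1 (fun y Uy => let: And3 h _ _ := g_o Uy in h) Ux.
rewrite (L0 Ux) (L1 Ux); set u := 'D_(e0 x) x1 x; set v := 'D_(e1 x) x0 x.
have [[_ -> _] _] := form_frame (d0 x0 x) (u - c * x2 x) (d0 x2 x + c * x1 x) Ux.
have [_ [-> _ _]] := form_frame (v + b * x2 x) (d1 x1 x) (d1 x2 x - c * x0 x) Ux.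
by move: u v (x2 x) => *; lra.
Qed.

Let k02 x : U x -> lam * d2 x0 x = (lam * b - c) * x1 x - d0 x2 x.
Proof.
move=> Ux; have := kill_frame s0 s2 (fun y Uy => let: And3 _ h _ := g_o Uy in h) Ux.
rewrite (L0 Ux) (L2 Ux); set u := 'D_(e0 x) x2 x; set v := 'D_(e2 x) x0 x.
have [[_ _ ->] _] := form_frame (d0 x0 x) (d0 x1 x - c * x2 x) (u + c * x1 x) Ux.
have [_ [-> _ _]] := form_frame (v - b * x1 x) (d2 x1 x + c * x0 x) (d2 x2 x) Ux.
by move: u v (x1 x) => *; lra.
Qed.

Let k12 x : U x -> d2 x1 x = - d1 x2 x.
Proof.
move=> Ux; have := kill_frame s1 s2 (fun y Uy => let: And3 _ _ h := g_o Uy in h) Ux.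
rewrite (L1 Ux) (L2 Ux); set u := 'D_(e1 x) x2 x; set v := 'D_(e2 x) x1 x.
have [[_ _ ->] _] := form_frame (d1 x0 x + b * x2 x) (d1 x1 x) (u - c * x0 x) Ux.
have [_ [_ -> _]] := form_frame (d2 x0 x - b * x1 x) (v + c * x0 x) (d2 x2 x) Ux.
by move: u v (x0 x) => *; lra.
Qed.

Let c01 (f : 'rV[R]_3 -> R) x : smooth_on U f -> U x ->
  d0 (d1 f) x - d1 (d0 f) x = c * d2 f x.
Proof.
move=> sf Ux; rewrite (lie_commutator_R oU sf s0 s1 Ux) b01 //.
exact: derive_dirZ (smooth_differentiable_R oU sf Ux) _ _.
Qed.

Let c20 (f : 'rV[R]_3 -> R) x : smooth_on U f -> U x ->
  d2 (d0 f) x - d0 (d2 f) x = c * d1 f x.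
Proof.
move=> sf Ux; rewrite (lie_commutator_R oU sf s2 s0 Ux) b20 //.
exact: derive_dirZ (smooth_differentiable_R oU sf Ux) _ _.
Qed.

Let c12 (f : 'rV[R]_3 -> R) x : smooth_on U f -> U x ->
  d1 (d2 f) x - d2 (d1 f) x = b * d0 f x.
Proof.
move=> sf Ux; rewrite (lie_commutator_R oU sf s1 s2 Ux) b12 //.
exact: derive_dirZ (smooth_differentiable_R oU sf Ux) _ _.
Qed.

Let D_eq (f f' : 'rV[R]_3 -> R) x v : (forall y, U y -> f y = f' y) -> U x ->
  'D_v f x = 'D_v f' x.
Proof. by move=> ff Ux; apply: near_eq_derive; apply: filterS (nearU Ux). Qed.

Let D_lin (f f' : 'rV[R]_3 -> R) k k' x v : smooth_on U f -> smooth_on U f' -> U x ->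
  'D_v (fun y => k * f y + k' * f' y) x = k * 'D_v f x + k' * 'D_v f' x.
Proof.
move=> sf sf' Ux.
have h := is_deriveZ k (derivableP (smooth_derivable v sf Ux)).
have h' := is_deriveZ k' (derivableP (smooth_derivable v sf' Ux)).
exact: (@derive_val _ _ _ _ _ _ _ (is_deriveD h h')).
Qed.

Let der_on (e : 'rV[R]_3 -> 'rV[R]_3) : smooth_on U e ->
  derivation_on U (smooth_on U) (fun f y => 'D_(e y) f y).
Proof.
move=> se; split.
- by move=> f sf; exact: smooth_derive_dir_R.
- by move=> f f' ff x Ux; exact: D_eq.
- by move=> f f' k k' x sf sf' Ux; exact: D_lin.
Qed.

Theorem killing_frame_derivatives x : U x ->
  [/\ 'D_(e0 x) x1 x = c * x2 x, 'D_(e0 x) x2 x = - c * x1 x,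
      'D_(e1 x) x0 x = - b * x2 x & 'D_(e2 x) x0 x = b * x1 x].
Proof.
move=> Ux; split.
- exact: (killing_pde_p (der_on s0) (der_on s1) (der_on s2) c01 c20 c12 sx0 sx1 sx2 b0 clb k00 k11 k22 k01 k02 k12 Ux).
- exact: (killing_pde_q (der_on s0) (der_on s1) (der_on s2) c01 c20 c12 sx0 sx1 sx2 b0 clb k00 k11 k22 k01 k02 k12 Ux).
- exact: (killing_pde_1 (der_on s0) (der_on s1) (der_on s2) c01 c20 c12 sx0 sx1 sx2 lam0 b0 clb k00 k11 k22 k01 k02 k12 Ux).
- exact: (killing_pde_2 (der_on s0) (der_on s1) (der_on s2) c01 c20 c12 sx0 sx1 sx2 lam0 b0 clb k00 k11 k22 k01 k02 k12 Ux).
Qed.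

(** By [frame_bracket0] the coefficients of [e0, X] are E0 x0, E0 x1 - c x2 and E0 x2 + c x1; the
    prolongation makes all of them zero. *)
Theorem killing_commutes x : U x -> 'D_(e0 x) X x = 'D_(X x) e0 x.
Proof.
move=> Ux; have [h1 h2 _ _] := killing_frame_derivatives Ux.
apply/eqP; rewrite -subr_eq0 (L0 Ux) (k00 Ux) h1 h2.
by rewrite subrr mulNr addNr !scale0r !addr0.
Qed.

End LocalKilling.

(* [A v] and [Y v] stand for the derivatives at a point, in the direction [v], of a
   metric [G] and of a vector field with value [x]. *)
Section FlatAlgebra.
Context {R : realType} {n : nat}.
Variables (A : 'rV[R]_n -> 'M[R]_n) (Y : 'rV[R]_n -> 'rV[R]_n) (G : 'M[R]_n) (x : 'rV[R]_n).

Lemma christoffel_formula u v z :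
  (forall z, A z = \sum_k z 0 k *: A (delta_mx 0 k)) -> G \in unitmx ->
  form G ((\row_k (2^-1 * (form (A u) v (delta_mx 0 k) + form (A v) u (delta_mx 0 k)
     - form (A (delta_mx 0 k)) u v))) *m invmx G) z =
  2^-1 * (form (A u) v z + form (A v) u z - form (A z) u v).
Proof.
move=> linA uG; rewrite form_mul_invmx // (linA z).
rewrite [X in form (A u) v X](row_sum_delta z) [X in form (A v) u X](row_sum_delta z).
rewrite !form_sumr formGsum -sumrN -!big_split /= mulr_sumr; apply: eq_bigr => k _.
by rewrite !mxE !formZr formGZ; ring.
Qed.

Definition flat (u z : 'rV[R]_n) : R :=
  (form (A u) x z + form G (Y u) z) - (form (A z) x u + form G (Y z) u).

(** The covariant derivative of a Killing field is skew, so it equals half of its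
    antisymmetrization, from which the Christoffel symbols disappear. *)
Lemma nabla_flat u z : G^T = G -> (A z)^T = A z ->
  form (A x) u z + form G (Y u) z + form G u (Y z) = 0 ->
  form G (Y u) z + 2^-1 * (form (A u) x z + form (A x) u z - form (A z) u x) =
  2^-1 * flat u z.
Proof.
by move=> sG sA K; rewrite /flat (form_sym u x sA) (form_sym (Y z) u sG); lra.
Qed.

Lemma flat_anti u z : flat u z = - flat z u.
Proof. by rewrite /flat opprB. Qed.

Hypotheses (AD : forall u v, A (u + v) = A u + A v) (AZ : forall a u, A (a *: u) = a *: A u).
Hypotheses (YD : forall u v, Y (u + v) = Y u + Y v) (YZ : forall a u, Y (a *: u) = a *: Y u).

Lemma flatDl u u' z : flat (u + u') z = flat u z + flat u' z.
Proof. by rewrite /flat AD YD formGD formDl !formDr; ring. Qed.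

Lemma flatZl a u z : flat (a *: u) z = a * flat u z.
Proof. by rewrite /flat AZ YZ formGZ formZl !formZr; ring. Qed.

Lemma flatDr u z z' : flat u (z + z') = flat u z + flat u z'.
Proof. by rewrite ![flat u _]flat_anti flatDl opprD. Qed.

Lemma flatZr a u z : flat u (a *: z) = a * flat u z.
Proof. by rewrite ![flat u _]flat_anti flatZl mulrN. Qed.

Lemma flat_basis (e0 e1 e2 : 'rV[R]_n) :
  (forall v, exists a0 a1 a2, v = a0 *: e0 + a1 *: e1 + a2 *: e2) ->
  flat e0 e1 = 0 -> flat e0 e2 = 0 -> flat e1 e2 = 0 ->
  forall u z, flat u z = 0.
Proof.
move=> B h01 h02 h12 u z.
have h10 : flat e1 e0 = 0 by rewrite flat_anti h01 oppr0.
have h20 : flat e2 e0 = 0 by rewrite flat_anti h02 oppr0.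
have h21 : flat e2 e1 = 0 by rewrite flat_anti h12 oppr0.
have h e : flat e e = 0 by rewrite /flat subrr.
have [a0 [a1 [a2 ->]]] := B u; have [b0 [b1 [b2 ->]]] := B z.
rewrite !(flatDl, flatDr, flatZl, flatZr).
by rewrite ?h !(h01, h02, h12, h10, h20, h21); ring.
Qed.

End FlatAlgebra.

(** * Killing fields parallel at a point, through the exterior derivative of the dual form *)

Section Nabla.
Context {R : realType} {M : topologicalType} {n : nat}.
Variables (g : metric R M n) (c : chart R M n) (x : 'rV[R]_n).
Variable (U : set 'rV[R]_n).
Hypotheses (oU : open U) (Ux : U x) (sg : smooth_on U (g c)).
Hypothesis symg : forall y, U y -> (g c y)^T = g c y.
Hypothesis posg : forall v, v != 0 -> 0 < form (g c x) v v.

Lemma derive_metric_sym v : ('D_v (g c) x)^T = 'D_v (g c) x.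
Proof.
apply/matrixP => i j; rewrite mxE (derive_mxE _ _ _ sg Ux) (derive_mxE _ _ _ sg Ux).
apply: near_eq_derive; have nU : \forall y \near x, U y by exact: open_nbhs_nbhs.
by apply: filterS nU => y Uy; rewrite -{1}(symg Uy) mxE.
Qed.

(* The exterior derivative at [x] of the 1-form dual to [X], for constant [u], [z]. *)
Definition dflat (X : 'rV[R]_n -> 'rV[R]_n) : 'rV[R]_n -> 'rV[R]_n -> R :=
  flat (fun v => 'D_v (g c) x) (fun v => 'D_v X x) (g c x) (X x).

(** Replaces the covariant derivative by an exterior derivative, which can be evaluated on a frame
    from brackets alone. *)
Lemma nabla0_dflat (X : chart R M n -> 'rV[R]_n -> 'rV[R]_n) :
  (forall u v, form ('D_(X c x) (g c) x) u v + form (g c x) ('D_u (X c) x) v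
     + form (g c x) u ('D_v (X c) x) = 0) ->
  (forall u, nabla g X c x u = 0) <-> (forall u z, dflat (X c) u z = 0).
Proof.
move=> K.
have dg := smooth_differentiable oU sg Ux.
have N u z : form (g c x) (nabla g X c x u) z = 2^-1 * dflat (X c) u z.
  refine (etrans (formDl _ _ _ _) _).
  rewrite /dflat -(nabla_flat (symg Ux) (derive_metric_sym z) (K u z)); congr (_ + _).
  apply: (@christoffel_formula _ _ (fun v => 'D_v (g c) x)); last exact: form_unit.
  by move=> v; exact: derive_coord.
split=> H.
  move=> u z; have := N u z; rewrite H form0l => /esym/eqP.
  by rewrite mulf_eq0 invr_eq0 pnatr_eq0 /= => /eqP.
by move=> u; apply: (form_nondeg posg) => z; rewrite N H mulr0.
Qed.

(** Cartan's formula: the exterior derivative of a 1-form w on (e, e') is e(w(e')) - e'(w(e)) -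
    w([e, e']). *)
Lemma dflat_frame (X e e' : 'rV[R]_n -> 'rV[R]_n) :
  smooth_on U X -> smooth_on U e -> smooth_on U e' ->
  dflat X (e x) (e' x) =
  'D_(e x) (fun y => form (g c y) (X y) (e' y)) x
  - 'D_(e' x) (fun y => form (g c y) (X y) (e y)) x
  - form (g c x) (X x) ('D_(e x) e' x - 'D_(e' x) e x).
Proof.
move=> sX se se'.
have h := is_derive_form (smooth_derivable (e x) sg Ux) (smooth_derivable (e x) sX Ux)
  (smooth_derivable (e x) se' Ux).
have h' := is_derive_form (smooth_derivable (e' x) sg Ux) (smooth_derivable (e' x) sX Ux)
  (smooth_derivable (e' x) se Ux).
rewrite (@derive_val _ _ _ _ _ _ _ h) (@derive_val _ _ _ _ _ _ _ h') /dflat /flat.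
move: ('D_(e x) (g c) x) ('D_(e x) X x) ('D_(e x) e' x) => A B C.
move: ('D_(e' x) (g c) x) ('D_(e' x) X x) ('D_(e' x) e x) => A' B' C'.
by rewrite formBr; ring.
Qed.

Lemma dflat_basis X (e0 e1 e2 : 'rV[R]_n) : smooth_on U X ->
  (forall v, exists a0 a1 a2, v = a0 *: e0 + a1 *: e1 + a2 *: e2) ->
  dflat X e0 e1 = 0 -> dflat X e0 e2 = 0 -> dflat X e1 e2 = 0 ->
  forall u z, dflat X u z = 0.
Proof.
move=> sX; have dg := smooth_differentiable oU sg Ux.
have dX := smooth_differentiable oU sX Ux.
apply: flat_basis.
- exact: (derive_dirD dg).
- exact: (derive_dirZ dg).
- exact: (derive_dirD dX).
- exact: (derive_dirZ dX).
Qed.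

End Nabla.

(** * Pulling back Killing fields *)

Section Pullback.
Context {R : realType} {n : nat}.
Variables (W V : set 'rV[R]_n) (T S : 'rV[R]_n -> 'rV[R]_n).
Variables (g g' : 'rV[R]_n -> 'M[R]_n) (X : 'rV[R]_n -> 'rV[R]_n).
Hypotheses (oW : open W) (oV : open V) (sT : smooth_on W T) (sS : smooth_on V S).
Hypothesis TW : forall x, W x -> V (T x) /\ S (T x) = x.
Hypothesis SV : forall y, V y -> W (S y) /\ T (S y) = y.
Hypotheses (sg : smooth_on W g) (sg' : smooth_on V g') (sX : smooth_on V X).
Hypothesis isoT : forall x, W x -> forall u v,
  form (g' (T x)) ('D_u T x) ('D_v T x) = form (g x) u v.
Hypothesis killX : forall y, V y -> forall u v,
  form ('D_(X y) g' y) u v + form (g' y) ('D_u X y) v + form (g' y) u ('D_v X y) = 0.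

Definition pullback_field (x : 'rV[R]_n) : 'rV[R]_n := 'D_(X (T x)) S (T x).
Let Y := pullback_field.

Lemma pullback_smooth : smooth_on W Y.
Proof.
have s1 : smooth_on V (fun y => 'D_(X y) S y) by exact: smooth_derive_dir.
by apply: (smooth_comp oW oV _ sT s1) => x /TW[].
Qed.
Let sY := pullback_smooth.

Let nearW x : W x -> \forall y \near x, W y.
Proof. by move=> Wx; exact: open_nbhs_nbhs. Qed.

Lemma pullback_derive x : W x -> 'D_(Y x) T x = X (T x).
Proof.
move=> Wx; have [VTx STx] := TW Wx.
have dT : differentiable T (S (T x)) by rewrite STx; exact: (smooth_differentiable oW sT Wx).
have h := is_derive_comp_diff (smooth_derivable (X (T x)) sS VTx) dT.
have := @derive_val _ _ _ _ _ _ _ h; rewrite STx -/(pullback_field x) => <-.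
rewrite -[RHS](derive_id (T x) (X (T x))); apply: near_eq_derive.
have nV : \forall y \near T x, V y by exact: open_nbhs_nbhs.
by apply: filterS nV => y /SV[].
Qed.

(** The derivative along [u] of the identity DT(Y) = X after T, with the two derivatives of T
    exchanged. *)
Lemma pullback_second x u : W x ->
  'D_('D_u T x) X (T x) = 'D_('D_u Y x) T x + 'D_(Y x) ('D_u T) x.
Proof.
move=> Wx; have [VTx _] := TW Wx.
(* The first field is the constant [u], so that its bracket with Y is 'D_u Y. *)
have L := lie_commutator oW sT (smooth_cst W u) sY Wx.
have D0 : 'D_u Y x - 'D_(Y x) (fun=> u) x = 'D_u Y x.
  exact: (etrans (congr1 (fun w => 'D_u Y x - w) (derive_cst u x (Y x))) (subr0 _)).
have {}L := canRL (subrK _) (etrans L (congr1 (fun w => 'D_w T x) D0)).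
refine (etrans _ L).
have h := is_derive_comp_diff (smooth_derivable u sT Wx) (smooth_differentiable oV sX VTx).
refine (etrans (esym (@derive_val _ _ _ _ _ _ _ h)) _); apply: near_eq_derive.
by apply: filterS (nearW Wx) => y Wy; exact: (esym (pullback_derive Wy)).
Qed.

Let kill_alg (G g0 dG dG' dg0 : 'M[R]_n) (u v du dv Yu Yv u' v' A B P Q A' B' : 'rV[R]_n) :
  A = A' + P -> B = B' + Q -> du = 0 -> dv = 0 -> dG' = dG ->
  form dg0 u v + form g0 du v + form g0 u dv =
    form dG' u' v' + form G P v' + form G u' Q ->
  form dG u' v' + form G A v' + form G u' B = 0 ->
  form G A' v' = form g0 Yu v -> form G u' B' = form g0 u Yv ->
  form dg0 u v + form g0 Yu v + form g0 u Yv = 0.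
Proof.
move=> -> -> -> -> -> + + <- <-; rewrite formDl formDr form0l form0r !addr0 => -> K.
by rewrite -[RHS]K; ring.
Qed.

(** The isometry equation, with [u] and [v] fixed, is differentiated along Y. By [pullback_second]
    the second derivatives of T are the same as those produced by the Killing equation of X, so they
    cancel. *)
Lemma pullback_killing x : W x -> forall u v,
  form ('D_(Y x) g x) u v + form (g x) ('D_u Y x) v + form (g x) u ('D_v Y x) = 0.
Proof.
move=> Wx u v; have [VTx STx] := TW Wx.
have dg' := smooth_differentiable oV sg' VTx.
have hT w := is_derive_comp_diff (smooth_derivable w sT Wx) dg'.
have sDT w : smooth_on W ('D_w T) by exact: smooth_derive.
have h := is_derive_form (@ex_derive _ _ _ _ _ _ _ (hT (Y x)))
  (smooth_derivable (Y x) (sDT u) Wx) (smooth_derivable (Y x) (sDT v) Wx).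
have h' := is_derive_form (smooth_derivable (Y x) sg Wx)
  (derivable_cst u x (Y x)) (derivable_cst v x (Y x)).
have E : 'D_(Y x) (fun y => form (g y) (cst u y) (cst v y)) x =
   'D_(Y x) (fun y => form ((g' \o T) y) ('D_u T y) ('D_v T y)) x.
  apply: near_eq_derive; apply: filterS (nearW Wx) => y Wy.
  by rewrite /= (isoT Wy).
have {}E := etrans (esym (@derive_val _ _ _ _ _ _ _ h')) (etrans E (@derive_val _ _ _ _ _ _ _ h)).
have Du : 'D_(Y x) (cst u) x = 0 by exact: derive_cst.
have Dv : 'D_(Y x) (cst v) x = 0 by exact: derive_cst.
have Dg := etrans (@derive_val _ _ _ _ _ _ _ (hT (Y x)))
  (congr1 (fun w => 'D_w g' (T x)) (pullback_derive Wx)).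
have K := killX VTx ('D_u T x) ('D_v T x).
have Pu := pullback_second u Wx; have Pv := pullback_second v Wx.
have Iu := isoT Wx ('D_u Y x) v; have Iv := isoT Wx u ('D_v Y x).
exact: (kill_alg Pu Pv Du Dv Dg E K Iu Iv).
Qed.

End Pullback.

(** * Which Killing fields are parallel at a point, in terms of the frame *)

Section FrameSymmetry.
Context {R : realType} {M : topologicalType}.
Variables (g : metric R M 3) (ch : chart R M 3) (U : set 'rV[R]_3).
Variables (e0 e1 e2 : 'rV[R]_3 -> 'rV[R]_3) (lam b c : R).
Hypotheses (oU : open U) (sg : smooth_on U (g ch)).
Hypothesis symg : forall x, U x -> (g ch x)^T = g ch x.
Hypothesis posg : forall x, U x -> forall v, v != 0 -> 0 < form (g ch x) v v.
Hypotheses (s0 : smooth_on U e0) (s1 : smooth_on U e1) (s2 : smooth_on U e2).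
Hypothesis b01 : forall x, U x -> 'D_(e0 x) e1 x - 'D_(e1 x) e0 x = c *: e2 x.
Hypothesis b20 : forall x, U x -> 'D_(e2 x) e0 x - 'D_(e0 x) e2 x = c *: e1 x.
Hypothesis b12 : forall x, U x -> 'D_(e1 x) e2 x - 'D_(e2 x) e1 x = b *: e0 x.
Hypothesis basis_e : forall x v, U x ->
  exists a0 a1 a2, v = a0 *: e0 x + a1 *: e1 x + a2 *: e2 x.
Hypothesis g_e : forall x, U x ->
  [/\ form (g ch x) (e0 x) (e0 x) = lam, form (g ch x) (e1 x) (e1 x) = 1 &
      form (g ch x) (e2 x) (e2 x) = 1].
Hypothesis g_o : forall x, U x ->
  [/\ form (g ch x) (e0 x) (e1 x) = 0, form (g ch x) (e0 x) (e2 x) = 0 &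
      form (g ch x) (e1 x) (e2 x) = 0].
Hypotheses (lam0 : lam != 0) (b0 : b != 0) (clb : c != lam * b).

Let nearU x : U x -> \forall y \near x, U y.
Proof. by move=> Ux; exact: open_nbhs_nbhs. Qed.

Let b02 x : U x -> 'D_(e0 x) e2 x - 'D_(e2 x) e0 x = - (c *: e1 x).
Proof. by move=> Ux; rewrite -(b20 Ux) opprB. Qed.

(** The exterior derivative of the dual form on (e0, e1) and (e0, e2) is, after
    [killing_frame_derivatives], lam b x2 and - lam b x1. Both vanish, so only the component along
    e0 is left. *)
Lemma frame_symmetry_sub (X : chart R M 3 -> 'rV[R]_3 -> 'rV[R]_3) x :
  smooth_on U (X ch) ->
  (forall x, U x -> forall u v, form ('D_(X ch x) (g ch) x) u v
     + form (g ch x) ('D_u (X ch) x) v + form (g ch x) u ('D_v (X ch) x) = 0) ->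
  U x -> (forall u, nabla g X ch x u = 0) -> exists t, X ch x = t *: e0 x.
Proof.
move=> sX kX Ux N0.
have H := (nabla0_dflat oU Ux sg symg (posg Ux) (kX x Ux)).1 N0.
have [k1 k2 k3 k4] := killing_frame_derivatives oU sg symg s0 s1 s2 sX b01 b20 b12
  basis_e g_e g_o lam0 b0 clb kX Ux.
pose x0 y := lam^-1 * form (g ch y) (X ch y) (e0 y).
have E0 v : 'D_v (fun y => form (g ch y) (X ch y) (e0 y)) x = lam * 'D_v x0 x.
  have sx0 : smooth_on U x0.
    by apply: smoothM => //; [exact: smooth_cst|exact: smooth_form].
  have h := is_deriveZ lam (derivableP (smooth_derivable v sx0 Ux)).
  refine (etrans _ (@derive_val _ _ _ _ _ _ _ h)); apply: near_eq_derive.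
  by apply: filterS (nearU Ux) => y _; rewrite /x0 [RHS]mulrA mulfV // mul1r.
have F1 := dflat_frame Ux sg sX s0 s1; rewrite H E0 k1 k3 (b01 Ux) formZr in F1.
have F2 := dflat_frame Ux sg sX s0 s2; rewrite H E0 k2 k4 in F2.
rewrite (b02 Ux) formNr formZr in F2.
have lb : lam * b != 0 by rewrite mulf_neq0.
have x2 : form (g ch x) (X ch x) (e2 x) = 0.
  by apply: (mulfI lb); move: F1; move: (form _ _ _) => *; lra.
have x1 : form (g ch x) (X ch x) (e1 x) = 0.
  by apply: (mulfI lb); move: F2; move: (form _ _ _) => *; lra.
exists (x0 x).
rewrite {1}(frame_coordsE symg basis_e g_e g_o lam0 (X ch x) Ux) x1 x2.
by rewrite !scale0r !addr0.
Qed.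

Variables (z0 z1 z2 a : 'rV[R]_3 -> R).
Hypotheses (sz0 : smooth_on U z0) (sz1 : smooth_on U z1) (sz2 : smooth_on U z2).
(** The laws satisfied by the coefficients of a Killing field, with the rotation in the plane of e1
    and e2 left free as the function [a]. They turn out to be sufficient. *)
Hypothesis D0 : forall x, U x -> [/\ 'D_(e0 x) z0 x = 0, 'D_(e0 x) z1 x = c * z2 x &
  'D_(e0 x) z2 x = - c * z1 x].
Hypothesis D1 : forall x, U x -> [/\ 'D_(e1 x) z0 x = - b * z2 x, 'D_(e1 x) z1 x = 0 &
  'D_(e1 x) z2 x = a x].
Hypothesis D2 : forall x, U x -> [/\ 'D_(e2 x) z0 x = b * z1 x, 'D_(e2 x) z1 x = - a x &
  'D_(e2 x) z2 x = 0].
Variable X : chart R M 3 -> 'rV[R]_3 -> 'rV[R]_3.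
Hypothesis XE : forall x, U x -> X ch x = z0 x *: e0 x + z1 x *: e1 x + z2 x *: e2 x.

Lemma frame_field_smooth : smooth_on U (X ch).
Proof.
have sm (z : 'rV[R]_3 -> R) (e : 'rV[R]_3 -> 'rV[R]_3) : smooth_on U z -> smooth_on U e ->
    smooth_on U (fun x => z x *: e x).
  move=> sz /(smooth_mxP _ oU) se; apply/smooth_mxP => // i j.
  apply: (smooth_eq oU _ (smoothM oU sz (se i j))) => x _.
  by rewrite mxE.
apply: (smooth_eq oU _ (smoothD oU (smoothD oU (sm _ _ sz0 s0) (sm _ _ sz1 s1)) (sm _ _ sz2 s2))).
by move=> x Ux; rewrite XE.
Qed.

Let gsym x : U x ->
  [/\ form (g ch x) (e1 x) (e0 x) = 0, form (g ch x) (e2 x) (e0 x) = 0 &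
      form (g ch x) (e2 x) (e1 x) = 0].
Proof.
move=> Ux; have [h1 h2 h3] := g_o Ux.
by split; rewrite form_sym // symg.
Qed.

(** The bracket [e0, X] is 0, while [e1, X] = (a - c z0) e2 and [e2, X] = - (a - c z0) e1:
    bracketing with X acts on the orthogonal frame by a skew map. *)
Lemma frame_field_killing x u v : U x -> form ('D_(X ch x) (g ch) x) u v
  + form (g ch x) ('D_u (X ch) x) v + form (g ch x) u ('D_v (X ch) x) = 0.
Proof.
move=> Ux; have sX := frame_field_smooth; have dX := smooth_differentiable oU sX Ux.
have [h00 h11 h22] := g_e Ux; have [h01 h02 h12] := g_o Ux; have [h10 h20 h21] := gsym Ux.
have B0 := frame_bracket0 oU s0 s1 s2 sz0 sz1 sz2 b01 b20 XE Ux.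
have B1 := frame_bracket1 oU s0 s1 s2 sz0 sz1 sz2 b01 b12 XE Ux.
have B2 := frame_bracket2 oU s0 s1 s2 sz0 sz1 sz2 b20 b12 XE Ux.
have [d00 d01 d02] := D0 Ux; have [d10 d11 d12] := D1 Ux; have [d20 d21 d22] := D2 Ux.
rewrite d00 d01 d02 subrr mulNr addNr !scale0r !addr0 in B0.
rewrite d10 d11 d12 mulNr addNr !scale0r !add0r in B1.
rewrite d20 d21 d22 subrr !scale0r add0r addr0 in B2.
apply: (@lie_metric_basis R 3 _ _ (fun v => 'D_v (X ch) x) (derive_dirD dX) (derive_dirZ dX)
  (e0 x) (e1 x) (e2 x)).
- by move=> w; exact: basis_e.
- split.
  + rewrite (lie_metric_frame (X ch) oU sg s0 s0 (fun y Uy => let: And3 h _ _ := g_e Uy in h) Ux).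
    by rewrite B0 form0l form0r addr0.
  + rewrite (lie_metric_frame (X ch) oU sg s0 s1 (fun y Uy => let: And3 h _ _ := g_o Uy in h) Ux).
    by rewrite B0 B1 form0l formZr h02 mulr0 addr0.
  + rewrite (lie_metric_frame (X ch) oU sg s0 s2 (fun y Uy => let: And3 _ h _ := g_o Uy in h) Ux).
    by rewrite B0 B2 form0l formZr h01 mulr0 addr0.
- split.
  + rewrite (lie_metric_frame (X ch) oU sg s1 s0 (fun y Uy => let: And3 h _ _ := gsym Uy in h) Ux).
    by rewrite B0 B1 form0r formZl h20 mulr0 addr0.
  + rewrite (lie_metric_frame (X ch) oU sg s1 s1 (fun y Uy => let: And3 _ h _ := g_e Uy in h) Ux).
    by rewrite B1 formZl formZr h12 h21 mulr0 addr0.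
  + rewrite (lie_metric_frame (X ch) oU sg s1 s2 (fun y Uy => let: And3 _ _ h := g_o Uy in h) Ux).
    by rewrite B1 B2 formZl formZr h11 h22; ring.
- split.
  + rewrite (lie_metric_frame (X ch) oU sg s2 s0 (fun y Uy => let: And3 _ h _ := gsym Uy in h) Ux).
    by rewrite B0 B2 form0r formZl h10 mulr0 addr0.
  + rewrite (lie_metric_frame (X ch) oU sg s2 s1 (fun y Uy => let: And3 _ _ h := gsym Uy in h) Ux).
    by rewrite B1 B2 formZl formZr h11 h22; ring.
  + rewrite (lie_metric_frame (X ch) oU sg s2 s2 (fun y Uy => let: And3 _ _ h := g_e Uy in h) Ux).
    by rewrite B2 formZl formZr h12 h21 mulr0 addr0.
Qed.

(** Where z1 and z2 vanish, the only component of the exterior derivative not already zero is the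
    one on (e1, e2), namely 2 a - b lam z0. *)
Lemma frame_field_nabla x : U x -> z1 x = 0 -> z2 x = 0 -> 2 * a x = b * lam * z0 x ->
  forall u, nabla g X ch x u = 0.
Proof.
move=> Ux z10 z20 az; have sX := frame_field_smooth.
apply/(nabla0_dflat oU Ux sg symg (posg Ux) (fun u v => frame_field_killing u v Ux)).
have [d00 d01 d02] := D0 Ux; have [d10 d11 d12] := D1 Ux; have [d20 d21 d22] := D2 Ux.
have XEx := XE Ux; rewrite z10 z20 !scale0r !addr0 in XEx.
have [h00 h11 h22] := g_e Ux; have [h01 h02 h12] := g_o Ux.
have A0 v : 'D_v (fun y => form (g ch y) (X ch y) (e0 y)) x = lam * 'D_v z0 x.
  have h := is_deriveZ lam (derivableP (smooth_derivable v sz0 Ux)).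
  refine (etrans _ (@derive_val _ _ _ _ _ _ _ h)); apply: near_eq_derive.
  apply: filterS (nearU Ux) => y Uy; rewrite XE // !formDl !formZl.
  have [k1 k2 k3] := g_e Uy; have [k4 k5 k6] := gsym Uy.
  by rewrite k1 k4 k5 !mulr0 !addr0 mulrC.
have A1 v : 'D_v (fun y => form (g ch y) (X ch y) (e1 y)) x = 'D_v z1 x.
  apply: near_eq_derive; apply: filterS (nearU Ux) => y Uy; rewrite XE // !formDl !formZl.
  have [k1 k2 k3] := g_e Uy; have [k4 k5 k6] := gsym Uy; have [k7 _ _] := g_o Uy.
  by rewrite k2 k6 k7 !mulr0 add0r addr0 mulr1.
have A2 v : 'D_v (fun y => form (g ch y) (X ch y) (e2 y)) x = 'D_v z2 x.
  apply: near_eq_derive; apply: filterS (nearU Ux) => y Uy; rewrite XE // !formDl !formZl.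
  have [k1 k2 k3] := g_e Uy; have [_ k7 k8] := g_o Uy.
  by rewrite k3 k7 k8 !mulr0 !add0r mulr1.
apply: (dflat_basis oU Ux sg sX (fun v => basis_e v Ux)).
- rewrite (dflat_frame Ux sg sX s0 s1) A0 A1 d01 d10 (b01 Ux) XEx formZl formZr h02 z20.
  by ring.
- rewrite (dflat_frame Ux sg sX s0 s2) A0 A2 d02 d20 (b02 Ux) XEx formZl formNr formZr h01 z10.
  by ring.
- rewrite (dflat_frame Ux sg sX s1 s2) A1 A2 d12 d21 (b12 Ux) XEx formZl formZr h00.
  by rewrite opprK -mulr2n -mulr_natl az; ring.
Qed.

End FrameSymmetry.

(** * The distribution of symmetry *)

Definition i0 : 'I_3 := @Ordinal 3 0 isT.
Definition i1 : 'I_3 := @Ordinal 3 1 isT.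
Definition i2 : 'I_3 := @Ordinal 3 2 isT.

Lemma sum3 (V : nmodType) (F : 'I_3 -> V) : \sum_i F i = F i0 + F i1 + F i2.
Proof.
rewrite !big_ord_recr big_ord0 /= add0r.
by congr (F _ + F _ + F _); apply: val_inj.
Qed.

Lemma forall3 (P : 'I_3 -> Prop) : P i0 -> P i1 -> P i2 -> forall i, P i.
Proof.
move=> h0 h1 h2 [[|[|[|//]]] Hi].
- by rewrite (_ : Ordinal Hi = i0) //; exact: val_inj.
- by rewrite (_ : Ordinal Hi = i1) //; exact: val_inj.
- by rewrite (_ : Ordinal Hi = i2) //; exact: val_inj.
Qed.

Record frame_brackets (R : realType) (N : nat) (T : Type) (emb : T -> 'rV[R]_N)
    (E : 'I_3 -> 'rV[R]_N -> 'rV[R]_N) (b c : R) : Prop := FrameBrackets {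
  fb01 : forall q, 'D_(E i0 (emb q)) (E i1) (emb q) - 'D_(E i1 (emb q)) (E i0) (emb q)
    = c *: E i2 (emb q);
  fb20 : forall q, 'D_(E i2 (emb q)) (E i0) (emb q) - 'D_(E i0 (emb q)) (E i2) (emb q)
    = c *: E i1 (emb q);
  fb12 : forall q, 'D_(E i1 (emb q)) (E i2) (emb q) - 'D_(E i2 (emb q)) (E i1) (emb q)
    = b *: E i0 (emb q) }.

(* The coordinates, in the frame, of the Killing field of the rotations around [one]. *)
Record rotation_field (R : realType) (N : nat) (T : Type) (emb : T -> 'rV[R]_N) (one : T)
    (E : 'I_3 -> 'rV[R]_N -> 'rV[R]_N) (b c : R) (y0 y1 y2 a : 'rV[R]_N -> R) : Prop :=
  RotationField {
    rf_smooth : [/\ smooth_on setT y0, smooth_on setT y1 & smooth_on setT y2];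
    rf_one : [/\ y0 (emb one) = 0, y1 (emb one) = 0, y2 (emb one) = 0 & a (emb one) = 1];
    rf_D0 : forall q, let v := emb q in
      [/\ 'D_(E i0 v) y0 v = 0, 'D_(E i0 v) y1 v = c * y2 v & 'D_(E i0 v) y2 v = - c * y1 v];
    rf_D1 : forall q, let v := emb q in
      [/\ 'D_(E i1 v) y0 v = - b * y2 v, 'D_(E i1 v) y1 v = 0 & 'D_(E i1 v) y2 v = a v];
    rf_D2 : forall q, let v := emb q in
      [/\ 'D_(E i2 v) y0 v = b * y1 v, 'D_(E i2 v) y1 v = - a v & 'D_(E i2 v) y2 v = 0] }.

Section Symmetry.
Context {R : realType} {N : nat} {T : topologicalType}.
Context {emb : T -> 'rV[R]_N} {mul : T -> T -> T} {one : T} {inv : T -> T}.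
Context {Lt : T -> 'rV[R]_N -> 'rV[R]_N} {E : 'I_3 -> 'rV[R]_N -> 'rV[R]_N}.
Hypothesis fg : framed_group emb mul one inv Lt E.
Let G := @EmbeddedGroup R T 'rV[R]_N emb mul one.
Let A := eg_atlas G 3.
Context {b c lam : R} {y0 y1 y2 a : 'rV[R]_N -> R}.
Hypothesis fb : frame_brackets emb E b c.
Hypothesis rf : rotation_field emb one E b c y0 y1 y2 a.
Hypotheses (lam_gt0 : 0 < lam) (b0 : b != 0) (clb : c != lam * b).
Variable g : metric R T 3.
Hypothesis metric_g : is_metric A g.
Hypothesis left_g : forall a, pullback_eq A g A g (mul a).
Hypothesis g_one : forall ch, A ch -> cdom ch one -> forall i j,
  form (g ch (cto ch one)) (eps emb E ch i (cto ch one)) (eps emb E ch j (cto ch one)) =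
  diag3 lam 1 1 i j.
Implicit Types ch d : chart R T 3.

(** The left translation taking the identity to the given point is an isometry and preserves the
    frame, so the Gram matrix is the one at the identity. *)
Lemma metric_frame ch x i j : A ch -> cimg ch x ->
  form (g ch x) (eps emb E ch i x) (eps emb E ch j x) = diag3 lam 1 1 i j.
Proof.
move=> Ac cx; have [c0 A0 c01] := fg_chart fg.
have cc0 := eg_is_chart A0; have cc := eg_is_chart Ac.
have [i01 k01] := chart_cto cc0 c01.
have [cp cpx] := chart_cinv cc cx.
have Lx : loc_dom c0 ch (mul (cinv ch x)) (cto c0 one).
  by split=> //=; rewrite k01 (fg_mulg1 fg).
have Lv : loc c0 ch (mul (cinv ch x)) (cto c0 one) = x.
  by rewrite /loc /= k01 (fg_mulg1 fg).
have H := left_g A0 Ac Lx (eps emb E c0 i (cto c0 one)) (eps emb E c0 j (cto c0 one)).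
rewrite (eps_loc_left fg i A0 Ac Lx) (eps_loc_left fg j A0 Ac Lx) Lv in H.
by rewrite H g_one.
Qed.

Let oc ch : A ch -> open (cimg ch).
Proof. by move=> /eg_is_chart/cimg_open. Qed.

Let gE ch x : A ch -> cimg ch x ->
  let e i := eps emb E ch i x in
  [/\ form (g ch x) (e i0) (e i0) = lam, form (g ch x) (e i1) (e i1) = 1 &
      form (g ch x) (e i2) (e i2) = 1].
Proof. by move=> Ac cx /=; rewrite !(metric_frame _ _ Ac cx) !mxE /=. Qed.

Let gO ch x : A ch -> cimg ch x ->
  let e i := eps emb E ch i x in
  [/\ form (g ch x) (e i0) (e i1) = 0, form (g ch x) (e i0) (e i2) = 0 &
      form (g ch x) (e i1) (e i2) = 0].
Proof. by move=> Ac cx /=; rewrite !(metric_frame _ _ Ac cx) !mxE /=. Qed.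

Lemma eps_basis3 ch x v : A ch -> cimg ch x -> exists a0 a1 a2,
  v = a0 *: eps emb E ch i0 x + a1 *: eps emb E ch i1 x + a2 *: eps emb E ch i2 x.
Proof.
move=> Ac cx; have := eps_decomp fg v Ac cx; rewrite sum3 => H.
by do 3 eexists; exact: H.
Qed.

Let br01 ch x : A ch -> cimg ch x ->
  'D_(eps emb E ch i0 x) (eps emb E ch i1) x - 'D_(eps emb E ch i1 x) (eps emb E ch i0) x =
  c *: eps emb E ch i2 x.
Proof.
move=> Ac cx.
rewrite (eps_bracket (B := fun k => if k == i2 then c else 0) fg Ac cx).
  by rewrite sum3 /= !scale0r !add0r.
by rewrite (fb01 fb) sum3 /= !scale0r !add0r.
Qed.

Let br20 ch x : A ch -> cimg ch x ->
  'D_(eps emb E ch i2 x) (eps emb E ch i0) x - 'D_(eps emb E ch i0 x) (eps emb E ch i2) x =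
  c *: eps emb E ch i1 x.
Proof.
move=> Ac cx.
rewrite (eps_bracket (B := fun k => if k == i1 then c else 0) fg Ac cx).
  by rewrite sum3 /= !scale0r add0r addr0.
by rewrite (fb20 fb) sum3 /= !scale0r add0r addr0.
Qed.

Let br12 ch x : A ch -> cimg ch x ->
  'D_(eps emb E ch i1 x) (eps emb E ch i2) x - 'D_(eps emb E ch i2 x) (eps emb E ch i1) x =
  b *: eps emb E ch i0 x.
Proof.
move=> Ac cx.
rewrite (eps_bracket (B := fun k => if k == i0 then b else 0) fg Ac cx).
  by rewrite sum3 /= !scale0r !addr0.
by rewrite (fb12 fb) sum3 /= !scale0r !addr0.
Qed.

Let lam0 : lam != 0. Proof. exact: lt0r_neq0. Qed.

Let sg ch : A ch -> smooth_on (cimg ch) (g ch).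
Proof. by move=> /metric_g.1[]. Qed.
Let symg ch : A ch -> forall x, cimg ch x -> (g ch x)^T = g ch x.
Proof. by move=> /metric_g.1[_ H] x /H[]. Qed.
Let posg ch : A ch -> forall x, cimg ch x -> forall v, v != 0 -> 0 < form (g ch x) v v.
Proof. by move=> /metric_g.1[_ H] x /H[]. Qed.

Lemma derive_translate ch x i p (f : 'rV[R]_N -> R) : A ch -> cimg ch x -> smooth_on setT f ->
  'D_(eps emb E ch i x) (f \o Lt p \o phi emb ch) x =
  'D_(E i (emb (mul p (cinv ch x)))) f (emb (mul p (cinv ch x))).
Proof.
move=> Ac cx sf.
have sfL : smooth_on setT (f \o Lt p).
  exact: (smooth_comp_R openT openT _ (fg_Lt_smooth fg p) sf).
rewrite (eps_ambient fg i Ac cx openT I sfL).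
have h := is_derive_comp_diff (smooth_derivable (E i (phi emb ch x)) (fg_Lt_smooth fg p) (I : setT (phi emb ch x)))
  (smooth_differentiable_R openT sf I).
rewrite (@derive_val _ _ _ _ _ _ _ h) -(fg_E_left fg).
by rewrite (fg_Lt_emb fg).
Qed.

(* Translates of the rotation field plus a multiple of the (Killing) field [E i0]. *)
Definition rot_coord (s t : R) p (y : 'rV[R]_N -> R) (s0 : R) ch (x : 'rV[R]_3) : R :=
  s0 * s + t * (y \o Lt p \o phi emb ch) x.

Let rot_smooth s t p y s0 ch : A ch -> smooth_on setT y ->
  smooth_on (cimg ch) (rot_coord s t p y s0 ch).
Proof.
move=> Ac sy; have o := oc Ac.
apply: smoothD => //; first exact: smooth_cst.
apply: smoothM => //; first exact: smooth_cst.
apply: (smooth_comp_R o openT _ (phi_smooth Ac)) => //.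
exact: (smooth_comp_R openT openT _ (fg_Lt_smooth fg p) sy).
Qed.

Let rot_derive s t p y s0 ch x i : A ch -> cimg ch x -> smooth_on setT y ->
  'D_(eps emb E ch i x) (rot_coord s t p y s0 ch) x =
  t * 'D_(E i (emb (mul p (cinv ch x)))) y (emb (mul p (cinv ch x))).
Proof.
move=> Ac cx sy; rewrite -(derive_translate i p Ac cx sy).
have sL : smooth_on (cimg ch) (y \o Lt p \o phi emb ch).
  apply: (smooth_comp_R (oc Ac) openT _ (phi_smooth Ac)) => //.
  exact: (smooth_comp_R openT openT _ (fg_Lt_smooth fg p) sy).
have h := is_deriveZ t (derivableP (smooth_derivable (eps emb E ch i x) sL cx)).
have h' := is_deriveD (is_derive_cst (s0 * s) x (eps emb E ch i x)) h.
by refine (etrans (@derive_val _ _ _ _ _ _ _ h') _); rewrite add0r.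
Qed.

(** The field s E0 plus t times the rotation field, translated so that its centre is the point [q]
    with [mul p q = one]. *)
Definition rot_field (s t : R) p ch (x : 'rV[R]_3) : 'rV[R]_3 :=
  rot_coord s t p y0 1 ch x *: eps emb E ch i0 x +
  rot_coord s t p y1 0 ch x *: eps emb E ch i1 x +
  rot_coord s t p y2 0 ch x *: eps emb E ch i2 x.

Section RotField.
Variables (s t : R) (p : T).
Let a' ch (x : 'rV[R]_3) := t * (a \o Lt p \o phi emb ch) x.

Let Lte ch (x : 'rV[R]_3) y : (y \o Lt p \o phi emb ch) x = y (emb (mul p (cinv ch x))) :> R.
Proof. by rewrite /= /phi /= (fg_Lt_emb fg). Qed.

Let D0 ch x : A ch -> cimg ch x ->
  [/\ 'D_(eps emb E ch i0 x) (rot_coord s t p y0 1 ch) x = 0,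
      'D_(eps emb E ch i0 x) (rot_coord s t p y1 0 ch) x = c * rot_coord s t p y2 0 ch x &
      'D_(eps emb E ch i0 x) (rot_coord s t p y2 0 ch) x = - c * rot_coord s t p y1 0 ch x].
Proof.
move=> Ac cx; have [u0 u1 u2] := rf_smooth rf.
have [h0 h1 h2] := rf_D0 rf (mul p (cinv ch x)).
rewrite (rot_derive _ _ _ _ _ Ac cx u0) (rot_derive _ _ _ _ _ Ac cx u1) (rot_derive _ _ _ _ _ Ac cx u2).
by rewrite h0 h1 h2 /rot_coord !Lte; split; ring.
Qed.

Let D1 ch x : A ch -> cimg ch x ->
  [/\ 'D_(eps emb E ch i1 x) (rot_coord s t p y0 1 ch) x = - b * rot_coord s t p y2 0 ch x,
      'D_(eps emb E ch i1 x) (rot_coord s t p y1 0 ch) x = 0 &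
      'D_(eps emb E ch i1 x) (rot_coord s t p y2 0 ch) x = a' ch x].
Proof.
move=> Ac cx; have [u0 u1 u2] := rf_smooth rf.
have [h0 h1 h2] := rf_D1 rf (mul p (cinv ch x)).
rewrite (rot_derive _ _ _ _ _ Ac cx u0) (rot_derive _ _ _ _ _ Ac cx u1) (rot_derive _ _ _ _ _ Ac cx u2).
by rewrite h0 h1 h2 /a' /rot_coord !Lte; split; ring.
Qed.

Let D2 ch x : A ch -> cimg ch x ->
  [/\ 'D_(eps emb E ch i2 x) (rot_coord s t p y0 1 ch) x = b * rot_coord s t p y1 0 ch x,
      'D_(eps emb E ch i2 x) (rot_coord s t p y1 0 ch) x = - a' ch x &
      'D_(eps emb E ch i2 x) (rot_coord s t p y2 0 ch) x = 0].
Proof.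
move=> Ac cx; have [u0 u1 u2] := rf_smooth rf.
have [h0 h1 h2] := rf_D2 rf (mul p (cinv ch x)).
rewrite (rot_derive _ _ _ _ _ Ac cx u0) (rot_derive _ _ _ _ _ Ac cx u1) (rot_derive _ _ _ _ _ Ac cx u2).
by rewrite h0 h1 h2 /a' /rot_coord !Lte; split; ring.
Qed.

Lemma rot_field_smooth ch : A ch -> smooth_on (cimg ch) (rot_field s t p ch).
Proof.
move=> Ac; have [u0 u1 u2] := rf_smooth rf.
exact: (frame_field_smooth (X := rot_field s t p) (oc Ac) (eps_smooth fg i0 Ac) (eps_smooth fg i1 Ac)
  (eps_smooth fg i2 Ac) (rot_smooth s t p 1 Ac u0) (rot_smooth s t p 0 Ac u1)
  (rot_smooth s t p 0 Ac u2) (fun x _ => erefl)).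
Qed.

Lemma rot_field_killing_eq ch x u v : A ch -> cimg ch x ->
  form ('D_(rot_field s t p ch x) (g ch) x) u v +
  form (g ch x) ('D_u (rot_field s t p ch) x) v +
  form (g ch x) u ('D_v (rot_field s t p ch) x) = 0.
Proof.
move=> Ac; have [u0 u1 u2] := rf_smooth rf.
exact: (frame_field_killing (X := rot_field s t p) (oc Ac) (sg Ac) (symg Ac) (eps_smooth fg i0 Ac) (eps_smooth fg i1 Ac)
  (eps_smooth fg i2 Ac) (fun x => br01 Ac) (fun x => br20 Ac) (fun x => br12 Ac)
  (fun x v cx => eps_basis3 v Ac cx) (fun x => gE Ac) (fun x => gO Ac)
  (rot_smooth s t p 1 Ac u0) (rot_smooth s t p 0 Ac u1) (rot_smooth s t p 0 Ac u2)
  (fun x => D0 Ac) (fun x => D1 Ac) (fun x => D2 Ac) (fun x _ => erefl) u v).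
Qed.

Lemma rot_field_killing : is_killing A g (rot_field s t p).
Proof.
split; last by move=> ch Ac x cx u v; exact: rot_field_killing_eq.
split; first exact: rot_field_smooth.
move=> ch d Ac Ad x Lx; have [cx _] := Lx; have cd := eg_is_chart Ad.
have cid : continuous (@id T) by move=> y B.
have sL := loc_smooth (fg_emb_cont fg) cid (smooth_id openT) (fun q => erefl) Ac Ad.
have oL := loc_dom_open (eg_is_chart Ac) cd cid.
have dL := smooth_differentiable oL sL Lx.
rewrite /rot_field !(derive_dirD dL) !(derive_dirZ dL) !(eps_loc_id fg _ Ac Ad Lx).
have P : phi emb d (loc ch d id x) = phi emb ch x by rewrite /phi /= (loc_cinv cd Lx).
by rewrite /rot_coord /= P.
Qed.

Lemma rot_field_nabla ch x : A ch -> cimg ch x -> mul p (cinv ch x) = one ->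
  2 * t = b * lam * s -> forall u, nabla g (rot_field s t p) ch x u = 0.
Proof.
move=> Ac cx px st; have [u0 u1 u2] := rf_smooth rf.
have [v0 v1 v2 va] := rf_one rf.
apply: (frame_field_nabla (oc Ac) (sg Ac) (symg Ac) (posg Ac) (eps_smooth fg i0 Ac) (eps_smooth fg i1 Ac)
  (eps_smooth fg i2 Ac) (fun x => br01 Ac) (fun x => br20 Ac) (fun x => br12 Ac)
  (fun x v cx => eps_basis3 v Ac cx) (fun x => gE Ac) (fun x => gO Ac)
  (rot_smooth s t p 1 Ac u0) (rot_smooth s t p 0 Ac u1) (rot_smooth s t p 0 Ac u2)
  (fun x => D0 Ac) (fun x => D1 Ac) (fun x => D2 Ac) (fun x _ => erefl) cx).
- by rewrite /rot_coord Lte px v1; ring.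
- by rewrite /rot_coord Lte px v2; ring.
- by rewrite /rot_coord /a' !Lte px va v0 mulr1 st; ring.
Qed.

Lemma rot_field_at ch x : A ch -> cimg ch x -> mul p (cinv ch x) = one ->
  rot_field s t p ch x = s *: eps emb E ch i0 x.
Proof.
move=> Ac cx px; have [v0 v1 v2 va] := rf_one rf.
by rewrite /rot_field /rot_coord !Lte px v0 v1 v2 mul1r !mulr0 !addr0 !mul0r !scale0r !addr0.
Qed.

(** At a zero of a field its derivative along e is the bracket of e with it, so [frame_bracket1] and
    [frame_bracket2] give the infinitesimal rotation. *)
Lemma rot_field_derive_at ch x : A ch -> cimg ch x -> mul p (cinv ch x) = one -> s = 0 ->
  'D_(eps emb E ch i1 x) (rot_field s t p ch) x = t *: eps emb E ch i2 x /\
  'D_(eps emb E ch i2 x) (rot_field s t p ch) x = - (t *: eps emb E ch i1 x).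
Proof.
move=> Ac cx px s0'; have [u0 u1 u2] := rf_smooth rf; have [v0 v1 v2 va] := rf_one rf.
have X0 : rot_field s t p ch x = 0 by rewrite rot_field_at // s0' scale0r.
have r0 : rot_coord s t p y0 1 ch x = 0 by rewrite /rot_coord Lte px v0 s0'; ring.
have r1 : rot_coord s t p y1 0 ch x = 0 by rewrite /rot_coord Lte px v1; ring.
have r2 : rot_coord s t p y2 0 ch x = 0 by rewrite /rot_coord Lte px v2; ring.
have ra : a' ch x = t by rewrite /a' Lte px va mulr1.
have B1 := frame_bracket1 (X := rot_field s t p ch) (oc Ac) (eps_smooth fg i0 Ac) (eps_smooth fg i1 Ac)
  (eps_smooth fg i2 Ac) (rot_smooth s t p 1 Ac u0) (rot_smooth s t p 0 Ac u1) (rot_smooth s t p 0 Ac u2)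
  (fun x => br01 Ac) (fun x => br12 Ac) (fun x _ => erefl) cx.
have B2 := frame_bracket2 (X := rot_field s t p ch) (oc Ac) (eps_smooth fg i0 Ac) (eps_smooth fg i1 Ac)
  (eps_smooth fg i2 Ac) (rot_smooth s t p 1 Ac u0) (rot_smooth s t p 0 Ac u1) (rot_smooth s t p 0 Ac u2)
  (fun x => br20 Ac) (fun x => br12 Ac) (fun x _ => erefl) cx.
have [d10 d11 d12] := D1 Ac cx; have [d20 d21 d22] := D2 Ac cx.
have Z e : 'D_(rot_field s t p ch x) e x = 0 :> 'rV[R]_3 by rewrite X0 derive0.
have {}B1 := etrans (esym (subr0 _)) (etrans (congr1 (fun w => _ - w) (esym (Z _))) B1).
have {}B2 := etrans (esym (subr0 _)) (etrans (congr1 (fun w => _ - w) (esym (Z _))) B2).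
rewrite B1 B2 d10 d11 d12 d20 d21 d22 r0 r1 r2 ra; split.
  by rewrite !mulr0 addr0 subr0 !scale0r !add0r.
by rewrite !mulr0 subr0 addr0 !scale0r add0r addr0 scaleNr.
Qed.

End RotField.

Theorem symmetry_distrE ch x : A ch -> cimg ch x ->
  symmetry_distr A g ch x = [set v | exists t, v = t *: eps emb E ch i0 x].
Proof.
move=> Ac cx; apply/seteqP; split=> v.
  move=> [X [[[sX _] kX] <- N0]].
  exact: (frame_symmetry_sub (oc Ac) (sg Ac) (symg Ac) (posg Ac) (eps_smooth fg i0 Ac)
    (eps_smooth fg i1 Ac) (eps_smooth fg i2 Ac) (fun x => br01 Ac) (fun x => br20 Ac)
    (fun x => br12 Ac) (fun x v cx => eps_basis3 v Ac cx) (fun x => gE Ac) (fun x => gO Ac)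
    lam0 b0 clb (sX _ Ac) (kX _ Ac) cx N0).
(* The amount of rotation solves 2 t = b lam s, the condition of [frame_field_nabla] at the centre,
   where the function [a] of the rotation field is 1. *)
move=> [s ->]; exists (rot_field s (2^-1 * (b * lam * s)) (inv (cinv ch x))).
have px : mul (inv (cinv ch x)) (cinv ch x) = one by exact: (fg_mulVg fg).
split; [exact: rot_field_killing|by rewrite (rot_field_at _ _ Ac cx px)|].
by apply: rot_field_nabla => //; rewrite mulrA mulfV ?mul1r // pnatr_eq0.
Qed.

(** Stated on an open part of a chart, because a Killing field pulled back by an isometry is only
    considered where both charts are defined. *)
Lemma killing_commutes_frame ch U (X : 'rV[R]_3 -> 'rV[R]_3) x : A ch -> open U -> U `<=` cimg ch ->
  smooth_on U X ->
  (forall x, U x -> forall u v, form ('D_(X x) (g ch) x) u v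
     + form (g ch x) ('D_u X x) v + form (g ch x) u ('D_v X x) = 0) ->
  U x -> 'D_(eps emb E ch i0 x) X x = 'D_(X x) (eps emb E ch i0) x.
Proof.
move=> Ac oU Uc sX kX Ux.
have se i : smooth_on U (eps emb E ch i) by apply: smooth_subset (eps_smooth fg i Ac).
apply: (killing_commutes oU _ _ (se i0) (se i1) (se i2) sX _ _ _ _ _ _ lam0 b0 clb kX Ux).
- exact: smooth_subset (sg Ac).
- by move=> y /Uc; exact: symg.
- by move=> y /Uc; exact: br01.
- by move=> y /Uc; exact: br20.
- by move=> y /Uc; exact: br12.
- by move=> y v /Uc; exact: eps_basis3.
- by move=> y /Uc; exact: gE.
- by move=> y /Uc; exact: gO.
Qed.

End Symmetry.

(** * Isometries and their inverses in charts *)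

Section LocInverse.
Context {R : realType} {M M' : topologicalType} {m n : nat}.
Variables (f : M -> M') (f' : M' -> M).
Hypotheses (fK : cancel f f') (cf : continuous f) (cf' : continuous f').
Implicit Types (c : chart R M m) (d : chart R M' n).

Lemma loc_inverse c d x : is_chart c -> is_chart d -> loc_dom c d f x ->
  loc_dom d c f' (loc c d f x) /\ loc d c f' (loc c d f x) = x.
Proof.
move=> cc cd Lx; have [cx dx] := Lx; have [cp cpx] := chart_cinv cc cx.
have E := loc_cinv cd Lx.
split; first by split; [exact: loc_cimg|rewrite E fK].
by rewrite /loc /=; move: E; rewrite /loc /= => ->; rewrite fK.
Qed.

Lemma loc_inverse_derive c d x u : is_chart c -> is_chart d ->
  smooth_on (loc_dom c d f) (loc c d f) -> smooth_on (loc_dom d c f') (loc d c f') ->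
  loc_dom c d f x ->
  'D_('D_u (loc c d f) x) (loc d c f') (loc c d f x) = u.
Proof.
move=> cc cd s s' Lx; have [Ly _] := loc_inverse cc cd Lx.
have h := is_derive_comp_diff (smooth_derivable u s Lx)
  (smooth_differentiable (loc_dom_open cd cc cf') s' Ly).
refine (etrans (esym (@derive_val _ _ _ _ _ _ _ h)) (etrans _ (derive_id x u))).
apply: near_eq_derive.
have nL : \forall y \near x, loc_dom c d f y.
  by apply: open_nbhs_nbhs; split=> //; exact: loc_dom_open.
by apply: filterS nL => y Ly'; exact: (loc_inverse cc cd Ly').2.
Qed.

End LocInverse.

Lemma isometry_inverse (R : realType) (M : topologicalType) (n : nat)
    (A : set (chart R M n)) (g : metric R M n) (f : M -> M) :
  (forall c, A c -> is_chart c) -> is_isometry A g f ->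
  exists f', [/\ cancel f f', cancel f' f & is_isometry A g f'].
Proof.
move=> Ach [[f' [fK f'K sf sf']] pf]; exists f'; split=> //; split.
  by exists f; split.
move=> c d Ac Ad x Lx u v; have cc := Ach _ Ac; have cd := Ach _ Ad.
have [Ly Ex] := loc_inverse f'K cc cd Lx.
have H := pf _ _ Ad Ac _ Ly ('D_u (loc c d f') x) ('D_v (loc c d f') x).
rewrite Ex in H.
have L w := loc_inverse_derive f'K sf'.1 sf.1 w cc cd (sf'.2 _ _ Ac Ad) (sf.2 _ _ Ad Ac) Lx.
refine (etrans (esym H) _).
by congr (form _ _ _); exact: L.
Qed.

Lemma identity_isometry (R : realType) (M : topologicalType) (n : nat)
    (A : set (chart R M n)) (g : metric R M n) :
  smooth_map A A id -> is_metric A g -> is_isometry A g id.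
Proof. by move=> s [_ pg]; split=> //; exists id; split. Qed.

Section IsometryDirection.
Context {R : realType} {N : nat} {T : topologicalType}.
Context {emb : T -> 'rV[R]_N} {mul : T -> T -> T} {one : T} {inv : T -> T}.
Context {Lt : T -> 'rV[R]_N -> 'rV[R]_N} {E : 'I_3 -> 'rV[R]_N -> 'rV[R]_N}.
Hypothesis fg : framed_group emb mul one inv Lt E.
Let G := @EmbeddedGroup R T 'rV[R]_N emb mul one.
Let A := eg_atlas G 3.
Context {b c lam : R} {y0 y1 y2 a : 'rV[R]_N -> R}.
Hypothesis fb : frame_brackets emb E b c.
Hypothesis rf : rotation_field emb one E b c y0 y1 y2 a.
Hypotheses (lam_gt0 : 0 < lam) (b0 : b != 0) (clb : c != lam * b).
Variable g : metric R T 3.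
Hypothesis metric_g : is_metric A g.
Hypothesis left_g : forall a, pullback_eq A g A g (mul a).
Hypothesis g_one : forall ch, A ch -> cdom ch one -> forall i j,
  form (g ch (cto ch one)) (eps emb E ch i (cto ch one)) (eps emb E ch j (cto ch one)) =
  diag3 lam 1 1 i j.
Implicit Types ch d : chart R T 3.

(* The rotation field around [f p] pulls back to a Killing field vanishing at [p],
   whose derivative along [E i0] therefore vanishes; so does the derivative of the
   rotation field along the image of [E i0]. *)
Theorem isometry_direction f ch d x : is_isometry A g f -> A ch -> A d ->
  loc_dom ch d f x -> exists t,
  'D_(eps emb E ch i0 x) (loc ch d f) x = t *: eps emb E d i0 (loc ch d f x).
Proof.
move=> [[f' [fK f'K sf sf']] pf] Ac Ad Lx.
have cc := eg_is_chart Ac; have cd := eg_is_chart Ad.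
have oW := loc_dom_open cc cd sf.1; have oV := loc_dom_open cd cc sf'.1.
pose y := loc ch d f x; have dy : cimg d y by exact: loc_cimg.
pose p := inv (cinv d y); have py : mul p (cinv d y) = one by exact: (fg_mulVg fg).
pose X := rot_field (emb := emb) (Lt := Lt) (E := E) (y0 := y0) (y1 := y1) (y2 := y2) 0 1 p d.
have Vd : loc_dom d ch f' `<=` cimg d by move=> z [].
have Wc : loc_dom ch d f `<=` cimg ch by move=> z [].
have sXd : smooth_on (cimg d) X by exact: (rot_field_smooth fg rf 0 1 p Ad).
have sX : smooth_on (loc_dom d ch f') X by exact: smooth_subset sXd.
have kXd z : cimg d z -> forall u v, form ('D_(X z) (g d) z) u v
   + form (g d z) ('D_u X z) v + form (g d z) u ('D_v X z) = 0.
  by move=> dz u v; exact: (rot_field_killing_eq fg fb rf metric_g left_g g_one 0 1 p u v Ad dz).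
have TW z : loc_dom ch d f z -> loc_dom d ch f' (loc ch d f z) /\ loc d ch f' (loc ch d f z) = z.
  exact: loc_inverse.
have SV z : loc_dom d ch f' z -> loc_dom ch d f (loc d ch f' z) /\ loc ch d f (loc d ch f' z) = z.
  exact: loc_inverse.
have sW := sf.2 _ _ Ac Ad; have sV := sf'.2 _ _ Ad Ac.
have sgW : smooth_on (loc_dom ch d f) (g ch) by apply: smooth_subset Wc _; case: (metric_g.1 _ Ac).
have sgV : smooth_on (loc_dom d ch f') (g d) by apply: smooth_subset Vd _; case: (metric_g.1 _ Ad).
pose Y := pullback_field (loc ch d f) (loc d ch f') X.
have sY : smooth_on (loc_dom ch d f) Y by exact: (pullback_smooth oW oV sW sV TW sX).
have kY z : loc_dom ch d f z -> forall u v, form ('D_(Y z) (g ch) z) u v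
   + form (g ch z) ('D_u Y z) v + form (g ch z) u ('D_v Y z) = 0.
  move=> Lz u v.
  apply: (pullback_killing oW oV sW sV TW SV sgW sgV sX _ _ Lz u v).
  - by move=> z' Lz' u' v'; exact: pf.
  - by move=> z' /Vd dz'; exact: kXd.
have Xy : X y = 0 by rewrite /X (rot_field_at fg rf _ _ Ad dy py) scale0r.
have Yx : Y x = 0 by rewrite /Y /pullback_field -/y Xy derive0.
have Y0 := killing_commutes_frame fg fb lam_gt0 b0 clb metric_g left_g g_one Ac oW Wc sY kY Lx.
rewrite Yx derive0 in Y0.
have P := pullback_second oW oV sW sV TW SV sX (eps emb E ch i0 x) Lx.
have {P} : 'D_('D_(eps emb E ch i0 x) (loc ch d f) x) X y = 0.
  refine (etrans P _).
  refine (etrans (congr2 +%R (congr1 (fun w => 'D_w (loc ch d f) x) Y0) (congr1 (fun w => 'D_w _ x) Yx)) _).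
  by rewrite !derive0 addr0.
have [a0 [a1 [a2 ->]]] := eps_basis3 fg ('D_(eps emb E ch i0 x) (loc ch d f) x) Ad dy.
have dX := smooth_differentiable (cimg_open cd) sXd dy.
have [X1 X2] := rot_field_derive_at fg fb rf 1 Ad dy py erefl.
have X0 := killing_commutes_frame fg fb lam_gt0 b0 clb metric_g left_g g_one Ad (cimg_open cd)
  (@subset_refl _ _) sXd kXd dy.
rewrite Xy derive0 in X0.
rewrite !(derive_dirD dX) !(derive_dirZ dX) X0 X1 X2 scaler0 add0r !scale1r scalerN => H.
(* If the image of e0 is a0 e0 + a1 e1 + a2 e2, the derivative of the rotation field along it is a1
   e2 - a2 e1; its vanishing is the relation fed to the freeness of the frame. *)
have F := @eps_free _ _ _ _ _ _ _ _ _ _ fg d y (\row_i (if i == i1 then - a2 else if i == i2 then a1 else 0)) Ad dy.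
have /rowP Z : \row_i (if i == i1 then - a2 else if i == i2 then a1 else 0) = 0 :> 'rV[R]_3.
  apply: F; rewrite sum3 !mxE /= scale0r add0r scaleNr addrC.
  exact: H.
have := Z i1; have := Z i2; rewrite !mxE /= => -> /eqP; rewrite oppr_eq0 => /eqP ->.
by exists a0; rewrite !scale0r !addr0.
Qed.

End IsometryDirection.

(** * The leaves of symmetry *)

(* The fibres of [Phi] are the cosets of the subgroup [K] of [fibre_group]; [psi] is a
   coordinate of the base on the image of [O], with section [sig], and [h] is the metric
   of the base in that coordinate. *)
Record fibration (R : realType) (N m : nat) (T : topologicalType)
    (emb : T -> 'rV[R]_N) (mul : T -> T -> T) (one : T)
    (E : 'I_3 -> 'rV[R]_N -> 'rV[R]_N) (Phi : T -> 'rV[R]_m)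
    (O : set 'rV[R]_N) (psi : 'rV[R]_N -> 'rV[R]_2) (U : set 'rV[R]_2)
    (sig : 'rV[R]_2 -> T) (h : 'rV[R]_2 -> 'M[R]_2) : Prop := Fibration {
  fi_right : forall q, continuous (mul^~ q);
  fi_Phi_cont : continuous Phi;
  fi_Phi_left : forall p q q', Phi q = Phi q' -> Phi (mul p q) = Phi (mul p q');
  fi_open : open O;
  fi_one : O (emb one);
  fi_sat : forall q q', Phi q = Phi q' -> O (emb q) -> O (emb q');
  fi_psi_smooth : smooth_on O psi;
  fi_psi_Phi : forall q q', O (emb q) -> O (emb q') ->
    psi (emb q) = psi (emb q') <-> Phi q = Phi q';
  fi_U_open : open U;
  fi_psi_U : forall q, O (emb q) -> U (psi (emb q));
  fi_sig_smooth : smooth_on U (emb \o sig);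
  fi_sig : forall x, U x -> O (emb (sig x)) /\ psi (emb (sig x)) = x;
  fi_E0 : forall q, O (emb q) -> 'D_(E i0 (emb q)) psi (emb q) = 0;
  fi_h_smooth : smooth_on U h;
  fi_h_sym : forall x, U x -> (h x)^T = h x;
  fi_h : forall q, O (emb q) ->
    let v := emb q in let u i := 'D_(E i v) psi v in
    [/\ form (h (psi v)) (u i1) (u i1) = 1, form (h (psi v)) (u i1) (u i2) = 0 &
        form (h (psi v)) (u i2) (u i2) = 1] }.

(** The subgroup as a one-dimensional framed group of its own, so that it has an atlas and can serve
    as the immersed manifold in the definition of a leaf. The map [kt] extends the inclusion [kap]
    to the ambient spaces, and [r] is the ratio between the generator of K and E0. *)
Record fibre_group (R : realType) (N m : nat) (T : topologicalType)
    (emb : T -> 'rV[R]_N) (one : T) (E : 'I_3 -> 'rV[R]_N -> 'rV[R]_N) (Phi : T -> 'rV[R]_m)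
    (N' : nat) (K : topologicalType) (embK : K -> 'rV[R]_N') (mulK : K -> K -> K) (oneK : K)
    (invK : K -> K) (LtK : K -> 'rV[R]_N' -> 'rV[R]_N') (EK : 'I_1 -> 'rV[R]_N' -> 'rV[R]_N')
    (kap : K -> T) (kt : 'rV[R]_N' -> 'rV[R]_N) (r : R) : Prop := FibreGroup {
  fk_group : framed_group embK mulK oneK invK LtK EK;
  fk_connected : connected [set: K];
  fk_smooth : smooth_on setT kt;
  fk_emb : forall k, emb (kap k) = kt (embK k);
  fk_inj : injective kap;
  fk_range : forall q, Phi q = Phi one <-> exists k, kap k = q;
  fk_r : r != 0;
  fk_E : forall k, 'D_(EK ord0 (embK k)) kt (embK k) = r *: E i0 (emb (kap k)) }.

Lemma zero_derivative_ball (R : realType) (k m : nat) (W : set 'rV[R]_k)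
    (u : 'rV[R]_k -> 'rV[R]_m) (y0 y : 'rV[R]_k) (e : R) :
  open W -> smooth_on W u -> (forall y, W y -> forall w, 'D_w u y = 0) ->
  ball y0 e `<=` W -> ball y0 e y -> u y = u y0.
Proof.
move=> oW su u0 BW By; apply/rowP => i; apply/eqP; rewrite -subr_eq0 -normr_le0.
have sui := (smooth_mxP _ oW).1 su 0 i.
have Wt t : 0 <= t <= 1 -> W (y0 + t *: (y - y0)).
  move=> /andP[t0 t1]; apply: BW; move: By; rewrite -!ball_normE /=.
  rewrite opprD addrA subrr sub0r normrN normrZ (ger0_norm t0) distrC.
  by apply: le_lt_trans; rewrite ler_piMl.
have := @mean_value_error R (fun t => u (y0 + t *: (y - y0)) 0 i) 0 0.
rewrite scale1r scale0r addr0 subrKC subr0; apply => t t01.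
have W1 := Wt t t01.
have d := is_derive_line (smooth_derivable (y - y0) sui W1).
split; first exact: (@ex_derive _ _ _ _ _ _ _ d).
rewrite (@derive_val _ _ _ _ _ _ _ d) -(derive_mxE _ _ _ su W1) u0 // mxE.
by rewrite subrr normr0.
Qed.

Section Leaves.
Context {R : realType} {N m : nat} {T : topologicalType}.
Context {emb : T -> 'rV[R]_N} {mul : T -> T -> T} {one : T} {inv : T -> T}.
Context {Lt : T -> 'rV[R]_N -> 'rV[R]_N} {E : 'I_3 -> 'rV[R]_N -> 'rV[R]_N}.
Context {Phi : T -> 'rV[R]_m} {O : set 'rV[R]_N} {psi : 'rV[R]_N -> 'rV[R]_2}.
Context {U : set 'rV[R]_2} {sig : 'rV[R]_2 -> T} {h : 'rV[R]_2 -> 'M[R]_2}.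
Hypothesis fg : framed_group emb mul one inv Lt E.
Hypothesis fi : fibration emb mul one E Phi O psi U sig h.
Let G := @EmbeddedGroup R T 'rV[R]_N emb mul one.
Let A := eg_atlas G 3.

Let cemb := fg_emb_cont fg.

(** The base coordinate around the coset of [p]: that of the coset of the identity, moved by left
    translation. *)
Definition base_coord p : 'rV[R]_N -> 'rV[R]_2 := psi \o Lt (inv p).
Definition base_dom p : set 'rV[R]_N := Lt (inv p) @^-1` O.

Lemma base_dom_open p : open (base_dom p).
Proof.
apply: open_comp (fi_open fi) => x _.
exact: (smooth_continuous (fg_Lt_smooth fg (inv p)) I).
Qed.

Lemma base_dom_emb p q : base_dom p (emb q) <-> O (emb (mul (inv p) q)).
Proof. by rewrite (fg_Lt_emb fg). Qed.

Lemma base_coord_emb p q : base_coord p (emb q) = psi (emb (mul (inv p) q)).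
Proof. by rewrite (fg_Lt_emb fg). Qed.

Lemma base_coord_smooth p : smooth_on (base_dom p) (base_coord p).
Proof.
have s : smooth_on (base_dom p) (Lt (inv p)).
  by apply: smooth_subset (fg_Lt_smooth fg (inv p)).
exact (smooth_comp (@base_dom_open p) (fi_open fi) (fun x => id) s (fi_psi_smooth fi)).
Qed.

Lemma base_coord_derive p q i : base_dom p (emb q) ->
  'D_(E i (emb q)) (base_coord p) (emb q) =
  'D_(E i (emb (mul (inv p) q))) psi (emb (mul (inv p) q)).
Proof.
move=> Oq; have Oq' := (base_dom_emb p q).1 Oq.
have d := is_derive_comp_diff (smooth_derivable (E i (emb q)) (fg_Lt_smooth fg (inv p)) (I : setT (emb q)))
  (smooth_differentiable (fi_open fi) (fi_psi_smooth fi) Oq).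
by refine (etrans (@derive_val _ _ _ _ _ _ _ d) _); rewrite (fg_E_left fg) -(fg_Lt_emb fg).
Qed.

Lemma base_coord_Phi p q q' : base_dom p (emb q) -> base_dom p (emb q') ->
  base_coord p (emb q) = base_coord p (emb q') <-> Phi q = Phi q'.
Proof.
rewrite !base_dom_emb !base_coord_emb => Oq Oq'.
split=> [/(fi_psi_Phi fi Oq Oq') H|H].
  by have := fi_Phi_left fi p H; rewrite !(fg_mulVKg fg).
by apply/(fi_psi_Phi fi Oq Oq'); exact: (fi_Phi_left fi).
Qed.

Lemma base_dom_sat p q q' : Phi q = Phi q' -> base_dom p (emb q) -> base_dom p (emb q').
Proof.
rewrite !base_dom_emb => H; apply: (fi_sat fi).
exact: (fi_Phi_left fi).
Qed.

Lemma base_dom_self p : base_dom p (emb p).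
Proof. by apply/base_dom_emb; rewrite (fg_mulVg fg); exact: (fi_one fi). Qed.

Section ConstAlong.
Context {N' : topologicalType} {k : nat}.
Variables (B : set (chart R N' k)) (f : N' -> T).
Hypotheses (Bch : forall d, B d -> is_chart d) (conN : connected [set: N']).
(** Near each point [f] is smooth in suitable charts and tangent to E0. Formulated in this way, it
    applies both to integral manifolds and to a coset followed by an isometry. *)
Hypothesis tang : forall n, exists d c W, [/\ B d, A c, cdom d n &
  [/\ open W, W (cto d n), W `<=` loc_dom d c f, smooth_on W (loc d c f) &
  forall y, W y -> forall w, exists t,
    'D_w (loc d c f) y = t *: eps emb E c i0 (loc d c f y)]].

(** The derivative of [psi] along E0 is zero by [fi_E0], so the base coordinate of [f] has zero
    derivative near the point and is constant on a ball of the chart. *)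
Lemma Phi_locally_const n : \forall n' \near n, Phi (f n') = Phi (f n).
Proof.
have [d [c [W [Bd Ac dn [oW Wn WL sW tW]]]]] := tang n.
have cd := Bch Bd; have cc := eg_is_chart Ac.
pose p := f n.
have phiE y : W y -> phi emb c (loc d c f y) = emb (f (cinv d y)).
  by move=> Wy; rewrite /phi /= (loc_cinv cc (WL _ Wy)).
have sphi : smooth_on W (phi emb c \o loc d c f).
  apply: (smooth_comp oW (cimg_open cc) _ sW (phi_smooth Ac)) => y /WL Ly.
  exact: loc_cimg.
pose W' := W `&` (phi emb c \o loc d c f) @^-1` base_dom p.
have oW' : open W'.
  rewrite openE => y [Wy Oy]; apply: filterI; first exact: open_nbhs_nbhs.
  by apply: (smooth_continuous sphi Wy); apply: open_nbhs_nbhs; split=> //; exact: base_dom_open.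
have su : smooth_on W' (base_coord p \o (phi emb c \o loc d c f)).
  apply: (smooth_comp oW' (@base_dom_open p) _ _ (base_coord_smooth p)).
    by move=> y [].
  by apply: smooth_subset sphi => y [].
have u0 y : W' y -> forall w, 'D_w (base_coord p \o (phi emb c \o loc d c f)) y = 0.
  move=> [Wy Oy] w; have [t Ht] := tW _ Wy w.
  have cl : cimg c (loc d c f y) by apply: loc_cimg => //; exact: WL.
  have d1 := is_derive_comp_diff (smooth_derivable w sW Wy) (phi_diff Ac cl).
  have d2 := is_derive_comp_diff (@ex_derive _ _ _ _ _ _ _ d1)
     (smooth_differentiable (@base_dom_open p) (base_coord_smooth p) Oy).
  refine (etrans (@derive_val _ _ _ _ _ _ _ d2) _).
  rewrite (@derive_val _ _ _ _ _ _ _ d1) Ht.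
  rewrite (derive_dirZ (phi_diff Ac cl)) (eps_spec fg i0 Ac cl).
  rewrite (derive_dirZ (smooth_differentiable (@base_dom_open p) (base_coord_smooth p) Oy)).
  move: Oy; rewrite /= (phiE _ Wy) => Oy.
  rewrite base_coord_derive // (fi_E0 fi) ?scaler0 //.
  exact/base_dom_emb.
have Kn : cinv d (cto d n) = n by have [_ _ dK _ _] := cd; rewrite dK.
have W'n : W' (cto d n).
  by split=> //=; rewrite phiE // Kn; exact: base_dom_self.
have : \forall y \near cto d n, W' y by exact: open_nbhs_nbhs.
move=> /nbhs_ballP[e /= e0 BW].
have [od _ dK dt _] := cd.
have n1 : \forall n' \near n, cdom d n' by exact: open_nbhs_nbhs.
have n2 : \forall n' \near n, ball (cto d n) e (cto d n') by apply: (dt _ dn); exact: nbhsx_ballx.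
near=> n'.
have dn' : cdom d n' by near: n'.
have bn' : ball (cto d n) e (cto d n') by near: n'.
have [Wn' On'] := BW _ bn'.
have := zero_derivative_ball oW' su u0 BW bn'.
move: On'; rewrite /= (phiE _ Wn') (phiE _ Wn) Kn dK // => On'.
by move/(base_coord_Phi On' (base_dom_self p)).
Unshelve. all: by end_near. Qed.

(** A level set is open and so is its complement; the source is connected. *)
Lemma Phi_const n n' : Phi (f n) = Phi (f n').
Proof.
suff H : [set a | Phi (f a) = Phi (f n')] = [set: N'].
  by have : [set: N'] n by []; rewrite -H.
apply: conN.
- by exists n'.
- exists [set a | Phi (f a) = Phi (f n')]; last by rewrite setTI.
  rewrite openE => a Ha; have := Phi_locally_const a; apply: filterS => a' /=.
  by move=> ->.
- exists [set a | Phi (f a) = Phi (f n')]; last by rewrite setTI.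
  rewrite -[X in closed X]setCK; apply: open_closedC.
  rewrite openE => a Ha; have := Phi_locally_const a; apply: filterS => a' /= Ea H.
  by apply: Ha; rewrite /= -Ea.
Qed.

End ConstAlong.
End Leaves.

(** * The leaves of symmetry are the fibres of the projection *)

Section Quotient.
Context {R : realType} {N m : nat} {T : topologicalType}.
Context {emb : T -> 'rV[R]_N} {mul : T -> T -> T} {one : T} {inv : T -> T}.
Context {Lt : T -> 'rV[R]_N -> 'rV[R]_N} {E : 'I_3 -> 'rV[R]_N -> 'rV[R]_N}.
Context {Phi : T -> 'rV[R]_m} {O : set 'rV[R]_N} {psi : 'rV[R]_N -> 'rV[R]_2}.
Context {U : set 'rV[R]_2} {sig : 'rV[R]_2 -> T} {h : 'rV[R]_2 -> 'M[R]_2}.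
Context {N' : nat} {K : topologicalType} {embK : K -> 'rV[R]_N'} {mulK : K -> K -> K}.
Context {oneK : K} {invK : K -> K} {LtK : K -> 'rV[R]_N' -> 'rV[R]_N'}.
Context {EK : 'I_1 -> 'rV[R]_N' -> 'rV[R]_N'} {kap : K -> T} {kt : 'rV[R]_N' -> 'rV[R]_N} {r : R}.
Context {b c lam : R} {y0 y1 y2 a : 'rV[R]_N -> R}.
Hypothesis fg : framed_group emb mul one inv Lt E.
Hypothesis fi : fibration emb mul one E Phi O psi U sig h.
Hypothesis fk : fibre_group emb one E Phi embK mulK oneK invK LtK EK kap kt r.
Hypothesis fb : frame_brackets emb E b c.
Hypothesis rf : rotation_field emb one E b c y0 y1 y2 a.
Hypotheses (lam_gt0 : 0 < lam) (b0 : b != 0) (clb : c != lam * b).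
Let G := @EmbeddedGroup R T 'rV[R]_N emb mul one.
Let A := eg_atlas G 3.
Variable g : metric R T 3.
Hypothesis metric_g : is_metric A g.
Hypothesis left_g : forall a, pullback_eq A g A g (mul a).
Hypothesis g_one : forall ch, A ch -> cdom ch one -> forall i j,
  form (g ch (cto ch one)) (eps emb E ch i (cto ch one)) (eps emb E ch j (cto ch one)) =
  diag3 lam 1 1 i j.
Implicit Types ch d : chart R T 3.

Let cemb := fg_emb_cont fg.

Definition orbit p : set T := [set q | Phi q = Phi p].

Lemma orbitE p q : Phi q = Phi p <-> exists k, mul p (kap k) = q.
Proof.
split=> [H|[k <-]].
  have /(fk_range fk)[k kq] : Phi (mul (inv p) q) = Phi one.
    by rewrite -(fg_mulVg fg p); exact: (fi_Phi_left fi).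
  by exists k; rewrite kq (fg_mulVKg fg).
rewrite -[RHS](congr1 Phi (fg_mulg1 fg p)); apply: (fi_Phi_left fi).
by apply/(fk_range fk); exists k.
Qed.

(** The inclusion of K carries its generator to r E0, and left translation by [p] preserves E0. *)
Lemma orbit_tangent p bk ch y w : let f := mul p \o kap in
  eg_atlas (@EmbeddedGroup R K 'rV[R]_N' embK mulK oneK) 1 bk -> A ch ->
  loc_dom bk ch f y ->
  'D_(w *: eps embK EK bk ord0 y) (loc bk ch f) y = (w * r) *: eps emb E ch i0 (loc bk ch f y).
Proof.
move=> f Ab Ac Ly; have [fgK _ skt eKt kI _ r0 eEK] := fk.
have cK := fg_emb_cont fgK; have [by_ _] := Ly; have cc := eg_is_chart Ac.
have sF : smooth_on setT (Lt p \o kt).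
  by apply: (smooth_comp openT openT _ skt (fg_Lt_smooth fg p)).
have fF k : emb (f k) = (Lt p \o kt) (embK k) by rewrite /f /= (fg_Lt_emb fg) eKt.
have sm := group_smooth_map fg 1 mulK oneK cK sF fF.
have sL := sm.2 _ _ Ab Ac.
have dL := smooth_differentiable (loc_dom_open (eg_is_chart Ab) cc sm.1) sL Ly.
rewrite (derive_dirZ dL) -scalerA; congr (_ *: _).
have cl := loc_cimg cc Ly; have dphi := phi_diff Ac cl.
apply: (phi_derive_inj cemb Ac cl).
refine (etrans (loc_derive cemb sm.1 sF fF _ Ab Ac Ly) _).
rewrite (derive_dirZ dphi) (eps_spec fg i0 Ac cl) (eps_spec fgK ord0 Ab by_).
have d := is_derive_comp_diff (smooth_derivable (EK ord0 (phi embK bk y)) skt (I : setT (phi embK bk y)))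
  (smooth_differentiable openT (fg_Lt_smooth fg p) I).
refine (etrans (@derive_val _ _ _ _ _ _ _ d) _).
rewrite eEK -eKt.
rewrite (derive_dirZ (smooth_differentiable openT (fg_Lt_smooth fg p) I)) (fg_E_left fg).
by rewrite /phi /= (loc_cinv cc Ly).
Qed.

Lemma eps_dim1 bk y w : eg_atlas (@EmbeddedGroup R K 'rV[R]_N' embK mulK oneK) 1 bk ->
  cimg bk y -> exists s, w = s *: eps embK EK bk ord0 y.
Proof.
move=> Ab by_; exists (eps_coord (emb := embK) (E := EK) bk y w 0 ord0).
by have := eps_decomp (fk_group fk) w Ab by_; rewrite big_ord1.
Qed.

Lemma orbit_integral p : is_integral_manifold A g (orbit p).
Proof.
have [fgK cK skt eKt kI rK r0 eEK] := fk.
have sF : smooth_on setT (Lt p \o kt).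
  by apply: (smooth_comp openT openT _ skt (fg_Lt_smooth fg p)).
have fF k : emb (mul p (kap k)) = (Lt p \o kt) (embK k) by rewrite /= (fg_Lt_emb fg) eKt.
have sm := group_smooth_map fg 1 mulK oneK (fg_emb_cont fgK) sF fF.
exists K, 1%N, (eg_atlas (@EmbeddedGroup R K 'rV[R]_N' embK mulK oneK) 1), (mul p \o kap).
split; first split=> //.
- exact: group_manifold fgK.
- by move=> k k' /= E'; apply: kI; rewrite -(fg_mulKg fg p (kap k)) E' (fg_mulKg fg).
split.
  apply/seteqP; split=> q; first by move=> [k _ <-]; apply/orbitE; exists k.
  by move=> /orbitE[k kq]; exists k.
move=> bk ch Ab Ac y Ly; have [by_ _] := Ly; have cl := loc_cimg (eg_is_chart Ac) Ly.
have e0 : eps emb E ch i0 (loc bk ch (mul p \o kap) y) != 0.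
  apply/eqP => e0.
  have := @eps_free _ _ _ _ _ _ _ _ _ _ fg ch _ (delta_mx 0 i0) Ac cl.
  rewrite sum3 !mxE /= e0 !scale0r scaler0 !addr0 => /(_ erefl)/rowP/(_ i0).
  by rewrite !mxE /= => /eqP; rewrite oner_eq0.
split=> [w w'|].
  have [s ->] := eps_dim1 w Ab by_; have [s' ->] := eps_dim1 w' Ab by_.
  rewrite !orbit_tangent // => /eqP; rewrite -subr_eq0 -scalerBl scaler_eq0 (negbTE e0) orbF.
  by rewrite -mulrBl mulf_eq0 (negbTE r0) orbF subr_eq0 => /eqP ->.
rewrite (symmetry_distrE fg fb rf lam_gt0 b0 clb metric_g left_g g_one Ac cl).
apply/seteqP; split=> v.
  by move=> [w _ <-]; have [s ->] := eps_dim1 w Ab by_; exists (s * r); rewrite orbit_tangent.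
move=> [t ->]; exists ((t / r) *: eps embK EK bk ord0 y) => //.
by rewrite orbit_tangent // divfK.
Qed.

(** Its tangent spaces are lines along E0 by [symmetry_distrE], so [Phi_const] applies to the
    immersion. Maximality of the cosets follows. *)
Lemma integral_sub_orbit L p : is_integral_manifold A g L -> L p -> L `<=` orbit p.
Proof.
move=> [N1 [k [B [f [[mB conN sf fI] [<- dfL]]]]]] [n _ <-] _ [n' _ <-].
rewrite /orbit /=.
apply: (@Phi_const _ _ _ _ _ _ _ _ _ _ _ _ _ _ _ _ fg fi N1 k B) => //; first by case: mB.
move=> n1; have [_ _ Bch Bcov _] := mB; have [d Bd dn1] := Bcov n1.
have [ch Ac cn1] := chart_at fg (f n1).
have cd := Bch _ Bd; have cc := eg_is_chart Ac; have [i1' k1] := chart_cto cd dn1.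
exists d, ch, (loc_dom d ch f); split=> //; split.
- exact: loc_dom_open cd cc sf.1.
- by split=> //; rewrite k1.
- by [].
- exact: sf.2.
- move=> y Ly w; have [_ rg] := dfL _ _ Bd Ac _ Ly.
  have : symmetry_distr A g ch (loc d ch f y) ('D_w (loc d ch f) y) by rewrite -rg; exists w.
  by rewrite (symmetry_distrE fg fb rf lam_gt0 b0 clb metric_g left_g g_one Ac (loc_cimg cc Ly)).
Qed.

Lemma orbit_leaf p : is_leaf A g (orbit p).
Proof.
split=> [|L intL sub]; first exact: orbit_integral.
by apply/seteqP; split=> //; apply: integral_sub_orbit => //; exact: sub.
Qed.

Lemma leaf_orbit L : is_leaf A g L -> exists p, L = orbit p.
Proof.
move=> [intL maxL]; have [L0|/set0P[p Lp]] := eqVneq L set0.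
  (* An empty integral manifold would lie in the coset of the identity, hence would not be
     maximal. *)
  have := maxL _ (orbit_integral one); rewrite L0 => /(_ (@sub0set _ _)) O0.
  by have : orbit one one by []; rewrite O0.
by exists p; rewrite (maxL _ (orbit_integral p)) //; exact: integral_sub_orbit.
Qed.

Lemma leaf_projP p q : leaf_proj A g p = leaf_proj A g q <-> Phi p = Phi q.
Proof.
split.
  move=> /eqquotP/asboolP/(_ _ (orbit_leaf q)) [_ H].
  by apply: H.
move=> H; apply/eqquotP/asboolP => L /leaf_orbit[p' ->].
by rewrite /orbit /= H.
Qed.

Lemma leaf_proj_fibre p : is_leaf A g [set q | leaf_proj A g q = leaf_proj A g p].
Proof.
rewrite (_ : mkset _ = orbit p); first exact: orbit_leaf.
by apply/seteqP; split=> q /leaf_projP.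
Qed.

End Quotient.

(** * The leaf space *)

Section Orthonormal2.
Context {R : realType}.
Implicit Types (H : 'M[R]_2) (u v : 'rV[R]_2).

(** For the matrix M with rows v1 and v2, orthonormality says M (H M^T) = 1. A one-sided inverse of
    a square matrix is two-sided, so u = (u H M^T) M. *)
Lemma orthonormal_basis2 H v1 v2 u : H^T = H ->
  form H v1 v1 = 1 -> form H v1 v2 = 0 -> form H v2 v2 = 1 ->
  exists a b, u = a *: v1 + b *: v2.
Proof.
move=> sH h11 h12 h22; have h21 : form H v2 v1 = 0 by rewrite form_sym.
pose M : 'M[R]_2 := \matrix_i (if i == 0 then v1 else v2).
have M1 : M *m (H *m M^T) = 1%:M.
  apply/matrixP => i j; rewrite mulmxA.
  have -> : (M *m H *m M^T) i j = form H (row i M) (row j M).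
    rewrite /form mxE [RHS]mxE; apply: eq_bigr => k _; congr (_ * _).
      by rewrite -row_mul [RHS]mxE.
    by rewrite !mxE.
  rewrite !rowK mxE.
  by case: (splitP (i : 'I_(1 + 1))) => [[[]]|[[]]] //= ? Ei;
     case: (splitP (j : 'I_(1 + 1))) => [[[]]|[[]]] //= ? Ej;
     rewrite -!val_eqE /= Ei Ej /= ?h11 ?h12 ?h21 ?h22.
have M2 := mulmx1C M1.
exists ((u *m (H *m M^T)) 0 0), ((u *m (H *m M^T)) 0 1).
have uE : u = (u *m (H *m M^T)) *m M by rewrite -mulmxA M2 mulmx1.
rewrite {1}uE mulmx_sum_row big_ord_recl big_ord1.
have -> : lift ord0 ord0 = 1 :> 'I_2 by exact: val_inj.
by rewrite !rowK.
Qed.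

Lemma orthonormal_transport2 H H' (L : 'rV[R]_2 -> 'rV[R]_2) v1 v2 :
  (forall u v, L (u + v) = L u + L v) -> (forall k u, L (k *: u) = k *: L u) ->
  H^T = H -> H'^T = H' ->
  [/\ form H v1 v1 = 1, form H v1 v2 = 0 & form H v2 v2 = 1] ->
  [/\ form H' (L v1) (L v1) = 1, form H' (L v1) (L v2) = 0 & form H' (L v2) (L v2) = 1] ->
  forall u v, form H' (L u) (L v) = form H u v.
Proof.
move=> LD LZ sH sH' [h11 h12 h22] [l11 l12 l22] u v.
have h21 : form H v2 v1 = 0 by rewrite form_sym.
have l21 : form H' (L v2) (L v1) = 0 by rewrite form_sym.
have [a [b ->]] := orthonormal_basis2 u sH h11 h12 h22.
have [a' [b' ->]] := orthonormal_basis2 v sH h11 h12 h22.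
rewrite !LD !LZ !formDl !formDr !formZl !formZr.
by rewrite h11 h12 h21 h22 l11 l12 l21 l22.
Qed.

Lemma orthonormal_pos2 H v1 v2 u : H^T = H ->
  form H v1 v1 = 1 -> form H v1 v2 = 0 -> form H v2 v2 = 1 ->
  u != 0 -> 0 < form H u u.
Proof.
move=> sH h11 h12 h22 u0; have h21 : form H v2 v1 = 0 by rewrite form_sym.
have [a [b uE]] := orthonormal_basis2 u sH h11 h12 h22.
have -> : form H u u = a ^+ 2 + b ^+ 2.
  by rewrite uE !formDl !formDr !formZl !formZr h11 h12 h21 h22; ring.
rewrite lt_def addr_ge0 ?sqr_ge0 // andbT paddr_eq0 ?sqr_ge0 // !sqrf_eq0.
by apply: contra u0 => /andP[/eqP a0 /eqP b0]; rewrite uE a0 b0 !scale0r addr0.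
Qed.

Lemma submersion_form (lam : R) (G : 'M[R]_3) (e : 'I_3 -> 'rV[R]_3) H (P : 'rV[R]_3 -> 'rV[R]_2)
    (a0 a1 a2 c0 c1 c2 : R) :
  lam != 0 -> (forall i j, form G (e i) (e j) = diag3 lam 1 1 i j) ->
  (forall x y, P (x + y) = P x + P y) -> (forall k x, P (k *: x) = k *: P x) ->
  H^T = H -> P (e i0) = 0 ->
  [/\ form H (P (e i1)) (P (e i1)) = 1, form H (P (e i1)) (P (e i2)) = 0 &
      form H (P (e i2)) (P (e i2)) = 1] ->
  let x := a0 *: e i0 + a1 *: e i1 + a2 *: e i2 in
  let y := c0 *: e i0 + c1 *: e i1 + c2 *: e i2 in
  form G x (e i0) = 0 -> form G y (e i0) = 0 -> form H (P x) (P y) = form G x y.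
Proof.
move=> l0 Ge PD PZ sH P0 [h11 h12 h22] /=.
have h21 : form H (P (e i2)) (P (e i1)) = 0 by rewrite form_sym.
rewrite !PD !PZ P0 !scaler0 !add0r !formDl !formDr !formZl !formZr !Ge !mxE /=.
rewrite h11 h12 h21 h22 !(mulr0, addr0, add0r, mulr1) => /eqP ul /eqP vl.
have -> : a0 = 0 by apply/eqP; move: ul; rewrite mulf_eq0 mulr1n (negbTE l0) orbF.
by rewrite !(mulr0n, mulr0, mul0r, addr0, add0r, mulr1n, mulr1).
Qed.

End Orthonormal2.

(** * Charts and metric of the leaf space, and the maps induced by isometries *)

Section BaseCharts.
Local Open Scope quotient_scope.
Context {R : realType} {N m : nat} {T : topologicalType}.
Context {emb : T -> 'rV[R]_N} {mul : T -> T -> T} {one : T} {inv : T -> T}.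
Context {Lt : T -> 'rV[R]_N -> 'rV[R]_N} {E : 'I_3 -> 'rV[R]_N -> 'rV[R]_N}.
Context {Phi : T -> 'rV[R]_m} {O : set 'rV[R]_N} {psi : 'rV[R]_N -> 'rV[R]_2}.
Context {U : set 'rV[R]_2} {sig : 'rV[R]_2 -> T} {h : 'rV[R]_2 -> 'M[R]_2}.
Context {N' : nat} {K : topologicalType} {embK : K -> 'rV[R]_N'} {mulK : K -> K -> K}.
Context {oneK : K} {invK : K -> K} {LtK : K -> 'rV[R]_N' -> 'rV[R]_N'}.
Context {EK : 'I_1 -> 'rV[R]_N' -> 'rV[R]_N'} {kap : K -> T} {kt : 'rV[R]_N' -> 'rV[R]_N} {r : R}.
Context {b c lam : R} {y0 y1 y2 a : 'rV[R]_N -> R}.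
Hypothesis fg : framed_group emb mul one inv Lt E.
Hypothesis fi : fibration emb mul one E Phi O psi U sig h.
Hypothesis fk : fibre_group emb one E Phi embK mulK oneK invK LtK EK kap kt r.
Hypothesis fb : frame_brackets emb E b c.
Hypothesis rf : rotation_field emb one E b c y0 y1 y2 a.
Hypotheses (lam_gt0 : 0 < lam) (b0 : b != 0) (clb : c != lam * b).
Let G := @EmbeddedGroup R T 'rV[R]_N emb mul one.
Let A := eg_atlas G 3.
Variable g : metric R T 3.
Hypothesis metric_g : is_metric A g.
Hypothesis left_g : forall a, pullback_eq A g A g (mul a).
Hypothesis g_one : forall ch, A ch -> cdom ch one -> forall i j,
  form (g ch (cto ch one)) (eps emb E ch i (cto ch one)) (eps emb E ch j (cto ch one)) =
  diag3 lam 1 1 i j.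
Implicit Types ch d : chart R T 3.
Let cemb := fg_emb_cont fg.

(** With [j] parametrizing the coset of q' by K, the map f after j is again tangent to E0, by
    [isometry_direction], so [Phi_const] applies to it. *)
Lemma isometry_Phi f q q' : is_isometry A g f -> Phi q = Phi q' -> Phi (f q) = Phi (f q').
Proof.
move=> If /(orbitE fg fi fk)[k <-].
have [fgK cK skt eKt kI rK r0 eEK] := fk.
pose j := mul q' \o kap.
have sF : smooth_on setT (Lt q' \o kt).
  by apply: (smooth_comp openT openT _ skt (fg_Lt_smooth fg q')).
have fF k' : emb (mul q' (kap k')) = (Lt q' \o kt) (embK k') by rewrite /= (fg_Lt_emb fg) eKt.
have sj := group_smooth_map fg 1 mulK oneK (fg_emb_cont fgK) sF fF.
have [[f' [fK f'K sf sf']] pf] := If.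
have [k1 k1E] : exists k1, kap k1 = one by apply/(fk_range fk).
rewrite -[X in _ = Phi (f X)](fg_mulg1 fg) -k1E -/(j k1) -/(j k) -/((f \o j) k) -/((f \o j) k1).
have mK := group_manifold fgK.
apply: (@Phi_const _ _ _ _ _ _ _ _ _ _ _ _ _ _ _ _ fg fi K 1
  (eg_atlas (@EmbeddedGroup R K 'rV[R]_N' embK mulK oneK) 1)) => //.
  by move=> d; exact: eg_is_chart.
move=> k0; have [bk Ab bk0] := chart_at fgK k0.
have [ch Ac c0] := chart_at fg (j k0); have [d Ad d0] := chart_at fg (f (j k0)).
have cb := eg_is_chart Ab; have cc := eg_is_chart Ac; have cd := eg_is_chart Ad.
have oL := loc_dom_open cb cc sj.1; have sL := sj.2 _ _ Ab Ac.
have oL' := loc_dom_open cc cd sf.1.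
pose W := loc_dom bk ch j `&` (loc bk ch j) @^-1` (loc_dom ch d f).
have oW : open W.
  rewrite openE => y [Ly L'y]; apply: filterI; first exact: open_nbhs_nbhs.
  by apply: (smooth_continuous sL Ly); exact: open_nbhs_nbhs.
have WE y : W y -> loc bk d (f \o j) y = loc ch d f (loc bk ch j y).
  by move=> [Ly L'y]; rewrite /loc /= -[cinv ch _]/(cinv ch (loc bk ch j y)) (loc_cinv cc Ly).
have WL : W `<=` loc_dom bk d (f \o j).
  move=> y [Ly [L1 L2]]; have [Ly1 Ly2] := Ly; split=> //=.
  by move: L2; rewrite (loc_cinv cc Ly).
have [ib kb] := chart_cto cb bk0.
have Wk : W (cto bk k0).
  have Lk : loc_dom bk ch j (cto bk k0) by split=> //; rewrite kb.
  split=> //=; split; first exact: loc_cimg.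
  by rewrite (loc_cinv cc Lk) kb.
have sW : smooth_on W (loc ch d f \o loc bk ch j).
  apply: (smooth_comp oW oL' _ _ (sf.2 _ _ Ac Ad)); first by move=> y [].
  by apply: smooth_subset sL => y [].
exists bk, d, W; split=> //; split=> //.
  by apply: (smooth_eq oW _ sW) => y Wy; rewrite WE.
move=> y Wy w; have [Ly L'y] := Wy; have [yb _] := Ly.
have [s ->] := eps_dim1 fk w Ab yb.
have [t Ht] := isometry_direction fg fb rf lam_gt0 b0 clb metric_g left_g g_one If Ac Ad L'y.
exists (s * r * t).
rewrite (@near_eq_derive _ _ _ _ (loc ch d f \o loc bk ch j)); last first.
  have nW : \forall y \near y, W y by exact: open_nbhs_nbhs.
  by apply: filterS nW => z Wz; rewrite WE.
have dl := smooth_differentiable oL' (sf.2 _ _ Ac Ad) L'y.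
have dd := is_derive_comp_diff (smooth_derivable (s *: eps embK EK bk ord0 y) sL Ly) dl.
refine (etrans (@derive_val _ _ _ _ _ _ _ dd) _).
rewrite (orbit_tangent fg fk s Ab Ac Ly) (derive_dirZ dl) Ht scalerA.
by rewrite WE.
Qed.

Let Q : topologicalType := leaf_space A g.
Let pi : T -> Q := leaf_proj A g.
Let piP p q : pi p = pi q <-> Phi p = Phi q.
Proof. exact: (leaf_projP fg fi fk fb rf lam_gt0 b0 clb metric_g left_g g_one). Qed.

Let pi_cont : continuous pi. Proof. exact: pi_continuous. Qed.

(** An arbitrary point of each leaf, without any continuity. What is applied to it depends only on
    the leaf of the point. *)
Definition leaf_repr (z : leaf_space A g) : T := repr (z : {eq_quot leaf_equiv A g}).

Let rpK z : pi (leaf_repr z) = z. Proof. exact: reprK. Qed.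
Let Phi_rp q : Phi (leaf_repr (pi q)) = Phi q. Proof. by apply/piP; rewrite rpK. Qed.

(** The saturation of V is a union of right translates of V by elements of K, and right translations
    are continuous. *)
Let pi_open V : open V -> open (pi @` V).
Proof.
move=> oV; rewrite /open /= /quotient_open.
have -> : (\pi_(quotient_topology {eq_quot leaf_equiv A g}) @^-1` (pi @` V)) =
    \bigcup_(k in [set: K]) [set q | V (mul q (kap k))].
  apply/seteqP; split=> q /=.
    move=> [v Vv /piP/(orbitE fg fi fk)[k kv]]; exists k => //=.
    by rewrite kv.
  move=> [k _ /= Vk]; exists (mul q (kap k)) => //.
  by apply/piP; apply/(orbitE fg fi fk); exists k.
apply: bigcup_open => k _.
apply: (open_comp (f := mul^~ (kap k))) => // x _.
exact: (fi_right fi).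
Qed.

Definition leaf_chart p : chart R (leaf_space A g) 2 :=
  @Chart R (leaf_space A g) 2
    [set z | base_dom (inv := inv) (Lt := Lt) (O := O) p (emb (leaf_repr z))]
    (fun z => base_coord (inv := inv) (Lt := Lt) (psi := psi) p (emb (leaf_repr z)))
    (fun x => leaf_proj A g (mul p (sig x))).

Definition leaf_atlas : set (chart R (leaf_space A g) 2) := range leaf_chart.

Let bd p q := base_dom (inv := inv) (Lt := Lt) (O := O) p (emb q).
Let bc p q := base_coord (inv := inv) (Lt := Lt) (psi := psi) p (emb q).

Let cdom_pi p q : cdom (leaf_chart p) (pi q) <-> bd p q.
Proof.
have e : Phi (leaf_repr (pi q)) = Phi q := Phi_rp q.
by split; apply: (base_dom_sat fg fi); rewrite -?e.
Qed.

Let cto_pi p q : bd p q -> cto (leaf_chart p) (pi q) = bc p q.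
Proof.
move=> bq; have e : Phi (leaf_repr (pi q)) = Phi q := Phi_rp q.
have bq' : bd p (leaf_repr (pi q)) by apply/cdom_pi.
exact/(base_coord_Phi fg fi bq' bq).
Qed.

Let bc_U p q : bd p q -> U (bc p q).
Proof.
by move=> /(base_dom_emb fg) Oq; rewrite /bc (base_coord_emb fg); exact: (fi_psi_U fi).
Qed.

Let bd_sig p x : U x -> bd p (mul p (sig x)) /\ bc p (mul p (sig x)) = x.
Proof.
move=> Ux; have [s1 s2] := fi_sig fi Ux; split.
  by apply/(base_dom_emb fg); rewrite (fg_mulKg fg).
by rewrite /bc (base_coord_emb fg) (fg_mulKg fg).
Qed.

Let cimg_leaf p : cimg (leaf_chart p) = U.
Proof.
apply/seteqP; split=> x; first by move=> [z zd <-]; exact: bc_U.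
move=> Ux; have [b1 b2] := bd_sig p Ux; exists (pi (mul p (sig x))); first exact/cdom_pi.
by rewrite cto_pi.
Qed.

Let sig_bc p q : bd p q -> Phi (mul p (sig (bc p q))) = Phi q.
Proof.
move=> bq; have [b1 b2] := bd_sig p (bc_U bq).
by apply/(base_coord_Phi fg fi b1 bq).
Qed.

Let s_smooth p : smooth_on U (emb \o (mul p \o sig)).
Proof.
have oU := fi_U_open fi.
have s1 : smooth_on U (Lt p \o (emb \o sig)).
  by apply: (smooth_comp oU openT _ (fi_sig_smooth fi) (fg_Lt_smooth fg p)).
by apply: (smooth_eq oU _ s1) => x _ /=; rewrite (fg_Lt_emb fg).
Qed.

Let s_cont p x : U x -> {for x, continuous (mul p \o sig)}.
Proof. by move=> Ux; apply: (initial_cont fg); exact: (smooth_continuous (s_smooth p) Ux). Qed.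

Let bd_open p : open [set q | bd p q].
Proof.
apply: (open_comp (f := emb)); last exact: (base_dom_open fg fi).
by move=> x _; exact: cemb.
Qed.

Lemma leaf_is_chart p : is_chart (leaf_chart p).
Proof.
split.
- rewrite /open /= /quotient_open (_ : _ @^-1` _ = [set q | bd p q]) //.
  by apply/seteqP; split=> q; [move/cdom_pi|move=> bq; apply/cdom_pi].
- rewrite cimg_leaf; exact: (fi_U_open fi).
- move=> z zd; rewrite -[RHS]rpK; apply/piP; exact: sig_bc.
- move=> z zd V Vz.
  have nV : nbhs (leaf_repr z) [set q | bd p q /\ V (bc p q)].
    apply: filterI; first by apply: open_nbhs_nbhs; split=> //; exact: bd_open.
    have cb : {for leaf_repr z, continuous (bc p)}.
      apply: continuous_comp; first exact: cemb.
      exact: (smooth_continuous (base_coord_smooth fg fi p) zd).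
    exact: cb.
  move: nV; rewrite nbhsE => -[V' [oV' V'z] sV'].
  have nz : nbhs z (pi @` V').
    by apply: open_nbhs_nbhs; split; [exact: pi_open|exists (leaf_repr z) => //; exact: rpK].
  apply: (@filterS _ (nbhs z) _ _ _ _ nz) => _ [q /sV'[bq Vq] <-].
  have e : cto (leaf_chart p) (pi q) = bc p q := cto_pi bq.
  change (V (cto (leaf_chart p) (pi q))); rewrite e; exact: Vq.
- move=> x; rewrite cimg_leaf => Ux.
  by apply: continuous_comp; [exact: s_cont|exact: pi_cont].
Qed.

Let loc_dom_leaf p p' f (fbar : Q -> Q) x : (forall q, fbar (pi q) = pi (f q)) ->
  loc_dom (leaf_chart p) (leaf_chart p') fbar x <-> U x /\ bd p' (f (mul p (sig x))).
Proof.
move=> H; rewrite /loc_dom /= cimg_leaf.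
by rewrite -[leaf_proj A g _]/(pi _) H; split=> -[Ux /cdom_pi].
Qed.

Let loc_leaf p p' f (fbar : Q -> Q) q : (forall q, fbar (pi q) = pi (f q)) ->
  (forall q q', Phi q = Phi q' -> Phi (f q) = Phi (f q')) ->
  bd p q -> bd p' (f q) ->
  loc (leaf_chart p) (leaf_chart p') fbar (bc p q) = bc p' (f q).
Proof.
move=> H fP bq bfq; rewrite /loc /= -[leaf_proj A g _]/(pi _) H.
have E1 := fP _ _ (sig_bc bq).
rewrite -[LHS]/(cto (leaf_chart p') (pi (f (mul p (sig (bc p q)))))).
have -> : pi (f (mul p (sig (bc p q)))) = pi (f q) by apply/piP.
exact: cto_pi.
Qed.

(** An isometry is only known to be smooth between charts of the group, while the section takes
    values in the ambient space; the retraction of a chart of the group connects the two. *)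
Let f_sig_smooth p f : smooth_map A A f -> smooth_on U (emb \o f \o (mul p \o sig)).
Proof.
move=> sf; have oU := fi_U_open fi; apply: smooth_local => x Ux.
pose s := mul p \o sig.
have [ch Ac cs] := chart_at fg (s x); have [d Ad ds] := chart_at fg (f (s x)).
have cc := eg_is_chart Ac; have cd := eg_is_chart Ad.
have [oc _ cK _ _] := cc; have [od _ _ _ _] := cd.
have [i1' k1] := chart_cto cc cs.
have [UF [F [oF UFx sF FE _]]] := chart_retract cemb Ac i1'.
pose W := [set y | U y /\ [/\ cdom ch (s y), cdom d (f (s y)) & UF (emb (s y))]].
have oW : open W.
  rewrite openE => y [Uy [h1 h2 h3]].
  have csy : {for y, continuous s} := @s_cont p y Uy.
  have n1 : \forall y' \near y, cdom ch (s y').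
    by apply: csy; exact: open_nbhs_nbhs.
  have n2 : \forall y' \near y, cdom d (f (s y')).
    have cfs : {for y, continuous (f \o s)}.
      by apply: continuous_comp; [exact: csy|exact: sf.1].
    by apply: cfs; exact: open_nbhs_nbhs.
  have n3 : \forall y' \near y, UF (emb (s y')).
    by apply: (smooth_continuous (s_smooth p) Uy); exact: open_nbhs_nbhs.
  have n0 : \forall y' \near y, U y' by exact: open_nbhs_nbhs.
  near=> y'; split; [by near: y'|split; by near: y'].
have sk : smooth_on W (F \o (emb \o s)).
  apply: (smooth_comp oW oF _ _ sF); first by move=> y [_ []].
  by apply: smooth_subset (s_smooth p) => y [].
have kE y : W y -> (F \o (emb \o s)) y = cto ch (s y).
  by move=> [Uy [h1 h2 h3]]; rewrite /= FE.
have kL y : W y -> loc_dom ch d f ((F \o (emb \o s)) y).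
  move=> Wy; have [Uy [h1 h2 h3]] := Wy; have [j1 j2] := chart_cto cc h1.
  by rewrite kE //; split=> //; rewrite j2.
exists W; first by split=> //; split=> //; rewrite -/(s x) -k1.
have oL := loc_dom_open cc cd sf.1.
have s1 : smooth_on W (loc ch d f \o (F \o (emb \o s))).
  exact: (smooth_comp oW oL kL sk (sf.2 _ _ Ac Ad)).
have s2 : smooth_on W (phi emb d \o (loc ch d f \o (F \o (emb \o s)))).
  apply: (smooth_comp oW (cimg_open cd) _ s1 (phi_smooth Ad)) => y /kL Ly.
  exact: loc_cimg.
apply: (smooth_eq oW _ s2) => y Wy.
have [Uy [h1 h2 h3]] := Wy; have [j1 j2] := chart_cto cc h1.
have Ly := kL _ Wy; rewrite /phi /= -/(loc ch d f).
by rewrite (loc_cinv cd Ly) /= FE // j2.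
Unshelve. all: by end_near. Qed.

(** The components are the same in all charts: two charts differ by a left translation, and the
    metric upstairs is left invariant. *)
Definition leaf_metric : metric R (leaf_space A g) 2 := fun _ x => h x.

Let w_orth p q : bd p q ->
  let w i := 'D_(E i (emb q)) (base_coord (inv := inv) (Lt := Lt) (psi := psi) p) (emb q) in
  w i0 = 0 /\ [/\ form (h (bc p q)) (w i1) (w i1) = 1, form (h (bc p q)) (w i1) (w i2) = 0 &
  form (h (bc p q)) (w i2) (w i2) = 1].
Proof.
move=> bq; rewrite /= !(base_coord_derive fg fi _ bq).
have Oq := (base_dom_emb fg p q).1 bq.
by rewrite /bc (base_coord_emb fg); split; [exact: (fi_E0 fi)|exact: (fi_h fi)].
Qed.

Let base_phi p ch x i : A ch -> cimg ch x -> bd p (cinv ch x) ->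
  'D_(eps emb E ch i x) (base_coord (inv := inv) (Lt := Lt) (psi := psi) p \o phi emb ch) x =
  'D_(E i (emb (cinv ch x))) (base_coord (inv := inv) (Lt := Lt) (psi := psi) p) (emb (cinv ch x)).
Proof.
move=> Ac cx bx.
have dd := is_derive_comp_diff (smooth_derivable (eps emb E ch i x) (phi_smooth Ac) cx)
  (smooth_differentiable (@base_dom_open _ _ _ _ _ _ _ _ _ _ _ _ _ _ _ _ fg fi p) (base_coord_smooth fg fi p) bx).
by refine (etrans (@derive_val _ _ _ _ _ _ _ dd) _); rewrite (eps_spec fg i Ac cx).
Qed.

Let base_phi_smooth p ch : A ch -> let W := [set x | cimg ch x /\ bd p (cinv ch x)] in
  open W /\ smooth_on W (base_coord (inv := inv) (Lt := Lt) (psi := psi) p \o phi emb ch).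
Proof.
move=> Ac /=; set W := [set x | _]; have cc := eg_is_chart Ac.
have oW : open W.
  rewrite openE => y [cy by_]; apply: filterI; first exact: near_cimg.
  by apply: (smooth_continuous (phi_smooth Ac) cy); apply: open_nbhs_nbhs; split=> //; exact: (base_dom_open fg fi).
split=> //.
apply: (smooth_comp oW (@base_dom_open _ _ _ _ _ _ _ _ _ _ _ _ _ _ _ _ fg fi p) _ _ (base_coord_smooth fg fi p)).
  by move=> y [].
by apply: smooth_subset (phi_smooth Ac) => y [].
Qed.

Let tr p := base_coord (inv := inv) (Lt := Lt) (psi := psi) p.

Let frame_form ch x i j (Ac : A ch) (cx : cimg ch x) :
  form (g ch x) (eps emb E ch i x) (eps emb E ch j x) = diag3 lam 1 1 i j :=
  metric_frame fg left_g g_one i j Ac cx.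

Let horizontal_form p ch x u v : A ch -> cimg ch x -> bd p (cinv ch x) ->
  form (g ch x) u (eps emb E ch i0 x) = 0 -> form (g ch x) v (eps emb E ch i0 x) = 0 ->
  form (h (bc p (cinv ch x))) ('D_u (tr p \o phi emb ch) x) ('D_v (tr p \o phi emb ch) x) =
  form (g ch x) u v.
Proof.
move=> Ac cx bx.
have [oW sW] := base_phi_smooth p Ac.
have dW := smooth_differentiable oW sW (conj cx bx).
have [w0 [w11 w12 w22]] := w_orth bx.
have [a0 [a1 [a2 ->]]] := eps_basis3 fg u Ac cx.
have [c0 [c1 [c2 ->]]] := eps_basis3 fg v Ac cx.
apply: (@submersion_form R lam (g ch x) (fun i => eps emb E ch i x) (h (bc p (cinv ch x)))
  (fun u => 'D_u (tr p \o phi emb ch) x)).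
- exact: lt0r_neq0.
- by move=> i j; exact: frame_form.
- exact: derive_dirD.
- exact: derive_dirZ.
- exact: (fi_h_sym fi (bc_U bx)).
- exact: (etrans (base_phi i0 Ac cx bx) w0).
- by rewrite (base_phi i1 Ac cx bx) (base_phi i2 Ac cx bx); split.
Qed.

Section BaseMap.
(** For [f] the identity the conclusions of this section become the smoothness of the chart changes
    and the transformation rule of [leaf_metric]; they are also used for an isometry and for its
    inverse. *)
Variables (f : T -> T) (fbar : leaf_space A g -> leaf_space A g).
Hypothesis If : is_isometry A g f.
Hypothesis fbarE : forall q, fbar (leaf_proj A g q) = leaf_proj A g (f q).

Let sf : smooth_map A A f. Proof. by have [[f' [_ _ ? _]] _] := If. Qed.
Let fP q q' : Phi q = Phi q' -> Phi (f q) = Phi (f q'). Proof. exact: isometry_Phi. Qed.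

Let base_loc_smooth p p' :
  open (loc_dom (leaf_chart p) (leaf_chart p') fbar) /\
  smooth_on (loc_dom (leaf_chart p) (leaf_chart p') fbar) (loc (leaf_chart p) (leaf_chart p') fbar).
Proof.
have oU := fi_U_open fi; have ob := @base_dom_open _ _ _ _ _ _ _ _ _ _ _ _ _ _ _ _ fg fi p'.
set W := loc_dom _ _ _; have WE x : W x <-> U x /\ bd p' (f (mul p (sig x))) by exact: loc_dom_leaf.
have sF := f_sig_smooth p sf.
have oW : open W.
  rewrite openE => x /WE[Ux bx].
  have n1 : \forall y \near x, bd p' (f (mul p (sig y))).
    by apply: (smooth_continuous sF Ux); apply: open_nbhs_nbhs; split.
  have n2 : \forall y \near x, U y by exact: open_nbhs_nbhs.
  near=> y; apply/WE; split; near: y; [exact: n2|exact: n1].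
split=> //.
have s1 : smooth_on W (tr p' \o (emb \o f \o (mul p \o sig))).
  apply: (smooth_comp oW ob _ _ (base_coord_smooth fg fi p')); first by move=> x /WE[].
  by apply: smooth_subset sF => x /WE[].
apply: (smooth_eq oW _ s1) => x /WE[Ux bx].
rewrite /loc /= -[LHS]/(bc p' (f (mul p (sig x)))) -cto_pi //.
by rewrite -[leaf_proj A g (mul p (sig x))]/(pi _) fbarE.
Unshelve. all: by end_near. Qed.

Lemma base_map_smooth : smooth_map leaf_atlas leaf_atlas fbar.
Proof.
split.
  apply/quotient_continuous => q.
  have -> : fbar \o \pi_{eq_quot leaf_equiv A g} = pi \o f by apply/funext => q'; exact: fbarE.
  by apply: continuous_comp; [exact: sf.1|exact: pi_cont].
by move=> _ _ [p _ <-] [p' _ <-]; have [] := base_loc_smooth p p'.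
Qed.

Let base_derive p p' ch d x0 v : A ch -> A d -> loc_dom ch d f x0 ->
  bd p (cinv ch x0) -> bd p' (f (cinv ch x0)) ->
  'D_('D_v (tr p \o phi emb ch) x0) (loc (leaf_chart p) (leaf_chart p') fbar) (bc p (cinv ch x0)) =
  'D_('D_v (loc ch d f) x0) (tr p' \o phi emb d) (loc ch d f x0).
Proof.
move=> Ac Ad Lx bx bfx; have [cx dx] := Lx.
have cc := eg_is_chart Ac; have cd := eg_is_chart Ad.
have kd := loc_cinv cd Lx.
have [oW sW] := base_phi_smooth p Ac; have [oW' sW'] := base_phi_smooth p' Ad.
have oL := loc_dom_open cc cd sf.1; have sL := sf.2 _ _ Ac Ad.
have [oM sM] := base_loc_smooth p p'.
have Wx : [set x | cimg ch x /\ bd p (cinv ch x)] x0 by [].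
have Wx' : [set x | cimg d x /\ bd p' (cinv d x)] (loc ch d f x0).
  by split; [exact: loc_cimg|rewrite kd].
have Mx : loc_dom (leaf_chart p) (leaf_chart p') fbar ((tr p \o phi emb ch) x0).
  apply/(loc_dom_leaf _ _ _ fbarE); split; first exact: bc_U.
  by apply: (base_dom_sat fg fi) bfx; apply/esym/fP/sig_bc.
have d1 := is_derive_comp_diff (smooth_derivable v sW Wx) (smooth_differentiable oM sM Mx).
have d2 := is_derive_comp_diff (smooth_derivable v sL Lx) (smooth_differentiable oW' sW' Wx').
refine (etrans (esym (@derive_val _ _ _ _ _ _ _ d1)) _).
refine (etrans _ (@derive_val _ _ _ _ _ _ _ d2)).
apply: near_eq_derive.
have n1 : \forall y \near x0, loc_dom ch d f y by exact: open_nbhs_nbhs.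
have n2 : \forall y \near x0, cimg ch y /\ bd p (cinv ch y).
  by apply: (open_nbhs_nbhs (A := [set x | cimg ch x /\ bd p (cinv ch x)])).
have n3 : \forall y \near x0, cimg d (loc ch d f y) /\ bd p' (cinv d (loc ch d f y)).
  have cL : {for x0, continuous (loc ch d f)} := smooth_continuous sL Lx.
  apply: (cL [set x | cimg d x /\ bd p' (cinv d x)]).
  by apply: (open_nbhs_nbhs (A := [set x | cimg d x /\ bd p' (cinv d x)])).
near=> y.
have Ly : loc_dom ch d f y by near: y; exact: n1.
have [_ by_] : cimg ch y /\ bd p (cinv ch y) by near: y; exact: n2.
have [_ by'] : cimg d (loc ch d f y) /\ bd p' (cinv d (loc ch d f y)) by near: y; exact: n3.
have kdy := loc_cinv cd Ly; rewrite kdy in by'.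
refine (etrans (loc_leaf fbarE fP by_ by') _).
by rewrite /bc /tr /phi /= kdy.
Unshelve. all: by end_near. Qed.

(** The differential of [f] preserves the line of E0, hence also its orthogonal complement. So E1
    and E2 project to an orthonormal pair before and after applying [f], and a linear map between
    planes that carries one orthonormal pair to another preserves the forms. *)
Lemma base_map_pullback : pullback_eq leaf_atlas leaf_metric leaf_atlas leaf_metric fbar.
Proof.
move=> _ _ [p _ <-] [p' _ <-] x Lx; have [Ux bfq] := (loc_dom_leaf _ _ _ fbarE).1 Lx.
have [bq xE] := bd_sig p Ux.
set q := mul p (sig x) in bfq bq xE.
have [ch Ac cq] := chart_at fg q; have [d Ad dq] := chart_at fg (f q).
have cc := eg_is_chart Ac; have cd := eg_is_chart Ad.
have [cx k] := chart_cto cc cq; set x0 := cto ch q in cx k.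
have Lx0 : loc_dom ch d f x0 by split=> //; rewrite k.
have kd := loc_cinv cd Lx0; have cdx := loc_cimg cd Lx0.
have [oM sM] := base_loc_smooth p p'; have dM := smooth_differentiable oM sM Lx.
have bx : bd p (cinv ch x0) by rewrite k.
have bfx : bd p' (f (cinv ch x0)) by rewrite k.
have bfd : bd p' (cinv d (loc ch d f x0)) by rewrite kd.
have xE' : bc p (cinv ch x0) = x by rewrite k.
have tE : loc (leaf_chart p) (leaf_chart p') fbar x = bc p' (cinv d (loc ch d f x0)).
  by rewrite -xE' (loc_leaf fbarE fP bx bfx) kd.
have [_ pf] := If.
have dL := smooth_differentiable (loc_dom_open cc cd sf.1) (sf.2 _ _ Ac Ad) Lx0.
have [t Ht] := isometry_direction fg fb rf lam_gt0 b0 clb metric_g left_g g_one If Ac Ad Lx0.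
have hor i : form (g ch x0) (eps emb E ch i x0) (eps emb E ch i0 x0) = 0 ->
    form (g d (loc ch d f x0)) ('D_(eps emb E ch i x0) (loc ch d f) x0)
      (eps emb E d i0 (loc ch d f x0)) = 0.
  move=> H0.
  have H1 := pf _ _ Ac Ad _ Lx0 (eps emb E ch i x0) (eps emb E ch i0 x0).
  have H2 := pf _ _ Ac Ad _ Lx0 (eps emb E ch i0 x0) (eps emb E ch i0 x0).
  rewrite H0 Ht formZr in H1; rewrite (frame_form i0 i0 Ac cx) Ht formZr formZl in H2.
  (* Preservation of the length of E0 gives t^2 times its squared length at the image equal to
     [lam], which is positive. *)
  have t0 : t != 0.
    apply/eqP => t0; rewrite t0 !mul0r !mxE /= mulr1n in H2.
    by move: lam_gt0; rewrite -H2 ltxx.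
  by apply/eqP; move/eqP: H1; rewrite mulf_eq0 (negbTE t0).
have e10 : form (g ch x0) (eps emb E ch i1 x0) (eps emb E ch i0 x0) = 0.
  by rewrite (frame_form i1 i0 Ac cx) !mxE.
have e20 : form (g ch x0) (eps emb E ch i2 x0) (eps emb E ch i0 x0) = 0.
  by rewrite (frame_form i2 i0 Ac cx) !mxE.
have FE i j : form (g ch x0) (eps emb E ch i x0) (eps emb E ch i0 x0) = 0 ->
    form (g ch x0) (eps emb E ch j x0) (eps emb E ch i0 x0) = 0 ->
    form (h (bc p' (cinv d (loc ch d f x0))))
     ('D_('D_(eps emb E ch i x0) (tr p \o phi emb ch) x0) (loc (leaf_chart p) (leaf_chart p') fbar) x)
     ('D_('D_(eps emb E ch j x0) (tr p \o phi emb ch) x0) (loc (leaf_chart p) (leaf_chart p') fbar) x) =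
    diag3 lam 1 1 i j.
  move=> Hi Hj; rewrite -xE'.
  rewrite (base_derive (eps emb E ch i x0) Ac Ad Lx0 bx bfx).
  rewrite (base_derive (eps emb E ch j x0) Ac Ad Lx0 bx bfx).
  rewrite (horizontal_form Ad cdx bfd (hor _ Hi) (hor _ Hj)).
  by rewrite (pf _ _ Ac Ad _ Lx0) (frame_form i j Ac cx).
have FB i j : form (g ch x0) (eps emb E ch i x0) (eps emb E ch i0 x0) = 0 ->
    form (g ch x0) (eps emb E ch j x0) (eps emb E ch i0 x0) = 0 ->
    form (h x) ('D_(eps emb E ch i x0) (tr p \o phi emb ch) x0)
     ('D_(eps emb E ch j x0) (tr p \o phi emb ch) x0) = diag3 lam 1 1 i j.
  move=> Hi Hj; rewrite -[in h x]xE' (horizontal_form Ac cx bx Hi Hj).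
  exact: (frame_form i j Ac cx).
move=> u v; rewrite /leaf_metric tE.
apply: (@orthonormal_transport2 R (h x) (h (bc p' (cinv d (loc ch d f x0))))
  (fun u => 'D_u (loc (leaf_chart p) (leaf_chart p') fbar) x)
  ('D_(eps emb E ch i1 x0) (tr p \o phi emb ch) x0)
  ('D_(eps emb E ch i2 x0) (tr p \o phi emb ch) x0)).
- exact: derive_dirD.
- exact: derive_dirZ.
- exact: (fi_h_sym fi Ux).
- exact: (fi_h_sym fi (bc_U bfd)).
- split; [refine (etrans (FB i1 i1 e10 e10) _)|refine (etrans (FB i1 i2 e10 e20) _)|
    refine (etrans (FB i2 i2 e20 e20) _)]; by rewrite !mxE.
- split; [refine (etrans (FE i1 i1 e10 e10) _)|refine (etrans (FE i1 i2 e10 e20) _)|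
    refine (etrans (FE i2 i2 e20 e20) _)]; by rewrite !mxE.
Qed.

End BaseMap.

Let mT := group_manifold fg.

Let id_isometry : is_isometry A g id.
Proof.
have [_ _ _ _ s] := mT; apply: identity_isometry => //; split=> //.
by move=> x; exact: cvg_id.
Qed.

Lemma leaf_manifold : is_manifold leaf_atlas.
Proof.
have [_ sT _ _ _] := mT; split.
(* [Phi] descends to a continuous injection of the leaf space into R^m; this gives the Hausdorff
   property although representatives are not chosen continuously. *)
- apply: (@hausdorff_pull _ _ (Phi \o leaf_repr)); last exact: hausdorff_rV.
    apply/quotient_continuous.
    have -> : (Phi \o leaf_repr) \o \pi_{eq_quot leaf_equiv A g} = Phi.
      by apply/funext => q; exact: Phi_rp.
    exact: (fi_Phi_cont fi).
  by move=> z z' /= /piP; rewrite !rpK.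
- refine (@second_countable_push _ _ pi pi_cont _ pi_open sT).
  by move=> z; exists (leaf_repr z); exact: rpK.
- by move=> _ [p _ <-]; exact: leaf_is_chart.
- move=> z; exists (leaf_chart (leaf_repr z)); first by exists (leaf_repr z).
  exact: (base_dom_self fg fi).
- exact: (base_map_smooth id_isometry (fun q => erefl)).2.
Qed.

Lemma leaf_metric_is_metric : is_metric leaf_atlas leaf_metric.
Proof.
split; last exact: (base_map_pullback id_isometry (fun q => erefl)).
move=> _ [p _ <-]; rewrite cimg_leaf; split; first exact: (fi_h_smooth fi).
move=> x Ux; have sx := fi_h_sym fi Ux; split=> // v v0.
have [bq xE] := bd_sig p Ux; have [_ [w1 w2 w3]] := w_orth bq.
by rewrite xE in w1 w2 w3; exact: (orthonormal_pos2 sx w1 w2 w3 v0).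
Qed.

Lemma leaf_proj_submersion : riemannian_submersion A g leaf_atlas leaf_metric pi.
Proof.
have lE ch p x : cimg ch x -> bd p (cinv ch x) ->
    loc ch (leaf_chart p) pi x = (tr p \o phi emb ch) x.
  by move=> _; exact: cto_pi.
have dE ch p : loc_dom ch (leaf_chart p) pi = [set x | cimg ch x /\ bd p (cinv ch x)].
  by apply/seteqP; split=> x [cx /cdom_pi].
split.
  split; first exact: pi_cont.
  move=> ch _ Ac [p _ <-]; rewrite dE; have [oW sW] := base_phi_smooth p Ac.
  by apply: (smooth_eq oW _ sW) => x [cx bx]; rewrite lE.
move=> ch _ Ac [p _ <-] x; rewrite dE => -[cx bx].
have [oW sW] := base_phi_smooth p Ac.
have Wx : [set x | cimg ch x /\ bd p (cinv ch x)] x by [].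
have DE u : 'D_u (loc ch (leaf_chart p) pi) x = 'D_u (tr p \o phi emb ch) x.
  apply: near_eq_derive.
  have nW : \forall y \near x, [set x | cimg ch x /\ bd p (cinv ch x)] y by exact: open_nbhs_nbhs.
  by apply: filterS nW => y [cy by_]; exact: lE.
have dW := smooth_differentiable oW sW Wx.
have [w0 [w1 w2 w3]] := w_orth bx.
split=> [w|u v hu hv].
  have sh := fi_h_sym fi (bc_U bx).
  have [s [t ->]] := orthonormal_basis2 w sh w1 w2 w3.
  exists (s *: eps emb E ch i1 x + t *: eps emb E ch i2 x).
  rewrite DE (derive_dirD dW) !(derive_dirZ dW).
  by rewrite (base_phi i1 Ac cx bx) (base_phi i2 Ac cx bx).
have e0 : 'D_(eps emb E ch i0 x) (loc ch (leaf_chart p) pi) x = 0.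
  by rewrite DE (base_phi i0 Ac cx bx).
have -> : loc ch (leaf_chart p) pi x = bc p (cinv ch x) by exact: lE.
rewrite !DE; exact: (horizontal_form Ac cx bx (hu _ e0) (hv _ e0)).
Qed.

Let induced_map f : is_isometry A g f ->
  forall q, pi (f (leaf_repr (pi q))) = pi (f q).
Proof. by move=> If q; apply/piP; apply: (isometry_Phi If); exact: Phi_rp. Qed.

Theorem leaf_space_metric : leaf_space_has_invariant_metric A g.
Proof.
split; first exact: (leaf_proj_fibre fg fi fk fb rf lam_gt0 b0 clb metric_g left_g g_one).
exists 2%N, leaf_atlas, leaf_metric; split.
- exact: leaf_manifold.
- exact: leaf_metric_is_metric.
- exact: leaf_proj_submersion.
move=> f /connected_component_sub If.
have Ach d : A d -> is_chart d by exact: eg_is_chart.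
(* The inverse isometry descends as well and provides the smooth inverse of the induced map. *)
have [f' [fK f'K If']] := isometry_inverse Ach If.
have H := induced_map If; have H' := induced_map If'.
exists (fun z => pi (f (leaf_repr z))); split; first by apply/funext => q; exact: H.
split; last exact: (base_map_pullback If H).
exists (fun z => pi (f' (leaf_repr z))); split.
- by move=> z; rewrite H' fK rpK.
- by move=> z; rewrite H f'K rpK.
- exact: (base_map_smooth If H).
- exact: (base_map_smooth If' H').
Qed.

End BaseCharts.

(** * Directional derivatives and smoothness of concrete maps *)

Section DirectionalRules.
Context {R : realType} {V W : normedModType R}.
Implicit Types (f g : V -> R) (x v : V).

Lemma is_derive_cst_fun (c : R) x v : is_derive x v (fun=> c) 0.
Proof. exact: is_derive_cst. Qed.

Lemma is_derive_add f g x v a b : is_derive x v f a -> is_derive x v g b ->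
  is_derive x v (fun y => f y + g y) (a + b).
Proof. by move=> df dg; exact: is_deriveD. Qed.

Lemma is_derive_opp f x v a : is_derive x v f a -> is_derive x v (fun y => - f y) (- a).
Proof. by move=> df; exact: is_deriveN. Qed.

Lemma is_derive_mul f g x v a b : is_derive x v f a -> is_derive x v g b ->
  is_derive x v (fun y => f y * g y) (f x * b + g x * a).
Proof. by move=> df dg; exact: is_deriveM. Qed.

Lemma is_derive_sqr f x v a : is_derive x v f a ->
  is_derive x v (fun y => f y ^+ 2) (f x * a + f x * a).
Proof.
move=> df; have := is_derive_mul df df.
by rewrite (_ : (fun y => f y * f y) = (fun y => f y ^+ 2)) //; apply/funext => y; rewrite expr2.
Qed.

Lemma is_derive_inv f x v a : f x != 0 -> is_derive x v f a ->
  is_derive x v (fun y => (f y)^-1) (- a / f x ^+ 2).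
Proof.
move=> f0 df; have d : derivable f x v by exact: ex_derive.
apply: DeriveDef; first exact: derivableV.
by rewrite deriveV // (@derive_val _ _ _ _ _ _ _ df) mulNr mulrC -mulNr.
Qed.

Lemma derive_eq f x v (a b : R) : is_derive x v f a -> a = b -> 'D_v f x = b.
Proof. by move=> d <-; exact: (@derive_val _ _ _ _ _ _ _ d). Qed.

Lemma is_derive_val f x v (a b : R) : is_derive x v f a -> a = b -> is_derive x v f b.
Proof. by move=> d <-. Qed.

Lemma is_derive_coord n (x v : 'rV[R]_n) i : is_derive x v (fun y => y 0 i) (v 0 i).
Proof.
have s := @smooth_coord R n setT i openT.
apply: DeriveDef; first exact: (smooth_derivable v s I).
have E := @derive_mxE R n 1 n setT id x v 0 i (smooth_id openT) I.
by rewrite -E derive_id.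
Qed.

Lemma is_derive_linear (f : V -> W) x v :
  (forall k u w, f (k *: u + w) = k *: f u + f w) -> is_derive x v f (f v).
Proof.
move=> fl.
have E : (fun h : R => h^-1 *: ((f \o shift x) (h *: v) - f x)) @ 0^' --> f v.
  apply: (cvg_trans _ (@cvg_cst _ (f v) _ (0 : R)^' _)).
  apply: near_eq_cvg; near=> h.
  rewrite /= fl addrK scalerA mulVf ?scale1r //.
  by near: h; exact: nbhs_dnbhs_neq.
have d : derivable f x v by apply/cvg_ex; exists (f v).
refine (DeriveDef d _); exact: (cvg_lim _ E).
Unshelve. all: by end_near. Qed.

End DirectionalRules.

Ltac derive_rules := repeat first
  [ exact: is_derive_coord | exact: is_derive_cst_fun | apply: is_derive_add | apply: is_derive_opp
  | apply: is_derive_sqr | apply: is_derive_inv | apply: is_derive_mul ].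

Ltac smooth_rules := repeat first
  [ exact: openT | apply: smooth_coord | apply: smooth_cst | apply: smoothD | apply: smoothN
  | apply: smoothX | apply: smoothV | apply: smoothM ].

Lemma linear_smooth {R : realType} n m (f : 'rV[R]_n -> 'rV[R]_m) :
  (forall k u w, f (k *: u + w) = k *: f u + f w) -> smooth_on setT f.
Proof.
move=> fl; apply: smooth_rowP => [|j]; first exact: openT.
have f0 : f 0 = 0 by have := fl 1 0 0; rewrite !scale1r addr0 => /(congr1 (fun z => z - f 0)); rewrite addrK subrr => <-.
have fs (F : 'I_n -> R) : f (\sum_i F i *: delta_mx 0 i) = \sum_i F i *: f (delta_mx 0 i).
  by elim/big_rec2 : _ => // i u w _ <-; rewrite fl.
have E x : f x 0 j = \sum_i x 0 i * f (delta_mx 0 i) 0 j.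
  rewrite {1}(row_sum_delta x) fs summxE; apply: eq_bigr => i _.
  by rewrite mxE.
apply: (@smooth_eq R 'rV[R]_n R setT (fun x => \sum_i x 0 i * f (delta_mx 0 i) 0 j)).
- exact: openT.
- by move=> x _; rewrite E.
- by apply: smooth_sum => [|i]; [exact: openT|smooth_rules].
Qed.

(** * Charts given by global formulas, and change of ambient space *)

Section RetractionChart.
Context {R : realType} {N n : nat} {T : topologicalType}.
Context {emb : T -> 'rV[R]_N} {mul : T -> T -> T} {one : T}.
Hypotheses (cemb : continuous emb)
  (nbhs_emb : forall p A, nbhs p A -> exists2 B, nbhs (emb p) B & emb @^-1` B `<=` A).
Variables (D : set 'rV[R]_N) (F : 'rV[R]_N -> 'rV[R]_n) (V : set 'rV[R]_n) (S : 'rV[R]_n -> T).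
Hypotheses (oD : open D) (sF : smooth_on D F) (oV : open V) (sS : smooth_on V (emb \o S)).
Hypotheses (DS : forall x, V x -> D (emb (S x))) (FS : forall x, V x -> F (emb (S x)) = x).
Hypotheses (VF : forall p, D (emb p) -> V (F (emb p))) (SF : forall p, D (emb p) -> S (F (emb p)) = p).

Lemma retraction_chart :
  eg_atlas (@EmbeddedGroup R T 'rV[R]_N emb mul one) n
    (@Chart R T n (emb @^-1` D) (F \o emb) S).
Proof.
set c := Chart _ _ _.
have cE : cimg c = V.
  apply/seteqP; split=> x; first by move=> [p Dp <-]; exact: VF.
  by move=> Vx; exists (S x); [exact: DS|exact: FS].
split; [split|rewrite cE; exact: sS|].
- by apply: open_comp oD => x _; exact: cemb.
- by rewrite cE.
- exact: SF.
- move=> p Dp; apply: continuous_comp; first exact: cemb.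
  exact: (smooth_continuous sF Dp).
- rewrite cE => x Vx A /nbhs_emb[B Bx BA].
  have nB := smooth_continuous sS Vx Bx.
  by move: nB; apply: (@filterS _ (nbhs x)) => y; exact: BA.
- by move=> p Dp; exists D, F; split.
Qed.

End RetractionChart.

Section Transfer.
Context {R : realType} {T : topologicalType} {V W : normedModType R}.
Context {emb : T -> V} {emb' : T -> W} {mul : T -> T -> T} {one : T}.
Variables (L : V -> W) (J : W -> V).
Hypotheses (LL : forall k u w, L (k *: u + w) = k *: L u + L w) (cL : continuous L).
Hypotheses (embL : emb' =1 L \o emb) (embJ : emb =1 J \o emb').

Let LZ k u : L (k *: u) = k *: L u.
Proof.
have L0 : L 0 = 0.
  by have := LL 1 0 0; rewrite !scale1r addr0 => /(congr1 (fun z => z - L 0)); rewrite addrK subrr => <-.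
by rewrite -[k *: u]addr0 LL L0 addr0.
Qed.

Let LB u w : L (u - w) = L u - L w.
Proof. by rewrite addrC -scaleN1r LL scaleN1r addrC. Qed.

Lemma is_derive_linear_comp (Z : normedModType R) (g : Z -> V) x v :
  derivable g x v -> is_derive x v (L \o g) (L ('D_v g x)).
Proof.
move=> dg; have E : (fun h : R => h^-1 *: (((L \o g) \o shift x) (h *: v) - (L \o g) x)) =
  L \o (fun h : R => h^-1 *: ((g \o shift x) (h *: v) - g x)).
by apply/funext => h /=; rewrite LZ LB.
have C : (fun h : R => h^-1 *: (((L \o g) \o shift x) (h *: v) - (L \o g) x)) @ 0^' --> L ('D_v g x).
rewrite E; apply: continuous_cvg; [exact: cL|exact: dg].
have d : derivable (L \o g) x v by apply/cvg_ex; exists (L ('D_v g x)); exact: C.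
refine (DeriveDef d _).
exact: (cvg_lim _ C).
Qed.

Lemma Ck_linear_comp (Z : normedModType R) k (U : set Z) (f : Z -> V) : open U ->
  Ck k U f -> Ck k U (L \o f).
Proof.
move=> oU; elim: k f => [|k IH] f [cf dfk]; split=> //.
- by move=> x Ux; apply: continuous_comp; [exact: cf|exact: cL].
- by move=> x Ux; apply: continuous_comp; [exact: cf|exact: cL].
- move=> v; have [d1 d2] := dfk v; split.
    by move=> x Ux; have d := is_derive_linear_comp (d1 x Ux); exact: (@ex_derive _ _ _ _ _ _ _ d).
  apply: (Ck_eq oU _ (IH _ d2)) => x Ux /=.
  by have d := is_derive_linear_comp (d1 x Ux); rewrite (@derive_val _ _ _ _ _ _ _ d).
Qed.

Lemma Ck_comp_linear (Z : normedModType R) k (U : set W) (f : W -> Z) :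
  Ck k U f -> Ck k (L @^-1` U) (f \o L).
Proof.
have df (g : W -> Z) x v : (fun h : R => h^-1 *: (((g \o L) \o shift x) (h *: v) - (g \o L) x)) =
    (fun h : R => h^-1 *: ((g \o shift (L x)) (h *: L v) - g (L x))).
  by apply/funext => h /=; rewrite LL.
elim: k f => [|k IH] f [cf dfk]; split=> //.
- by move=> x Ux; apply: continuous_comp; [exact: cL|exact: cf].
- by move=> x Ux; apply: continuous_comp; [exact: cL|exact: cf].
- move=> v; have [d1 d2] := dfk (L v); split.
    by move=> x Ux; rewrite /derivable df; exact: d1.
  by rewrite (_ : 'D_v (f \o L) = 'D_(L v) f \o L); [exact: IH|apply/funext => x; rewrite /derive df].
Qed.

End Transfer.

(** [L] and [J] are inverse to each other on the images of the group. [L] carries the inverse of a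
    chart to the new ambient space, and precomposition with [J] carries the ambient extension of the
    chart. *)
Lemma eg_atlas_sub (R : realType) (T : topologicalType) (V W : normedModType R)
    (emb : T -> V) (emb' : T -> W) mul mul' one one' n (L : V -> W) (J : W -> V) :
  (forall k u w, L (k *: u + w) = k *: L u + L w) -> continuous L ->
  (forall k u w, J (k *: u + w) = k *: J u + J w) -> continuous J ->
  (forall p, emb' p = L (emb p)) -> (forall p, emb p = J (emb' p)) ->
  eg_atlas (@EmbeddedGroup R T V emb mul one) n `<=`
  eg_atlas (@EmbeddedGroup R T W emb' mul' one') n.
Proof.
move=> LL cL JL cJ embL embJ c [cc sc lc]; have [_ oi _ _ _] := cc; split=> //.
  rewrite (_ : _ \o cinv c = L \o (emb \o cinv c)); last by apply/funext => x /=; exact: embL.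
  by move=> k; exact: (Ck_linear_comp LL cL oi (sc k)).
move=> p cp; have [U [F [oU Up sF FE]]] := lc p cp.
exists (J @^-1` U), (F \o J); split.
- by apply: open_comp oU => x _; exact: cJ.
- by rewrite /= -embJ.
- by move=> k; exact: (Ck_comp_linear JL cJ (sF k)).
- by move=> q cq /=; rewrite -embJ; exact: FE.
Qed.

(** Turns the Gram matrix prescribed on the given basis into the one of the frame at the identity;
    [s] allows the frame to list the basis in another order. *)
Lemma represented_frame (R : realType) (T : topologicalType) (V : normedModType R)
    (emb : T -> V) (mul : T -> T -> T) (one : T) (N : nat) (emb' : T -> 'rV[R]_N)
    (inv : T -> T) (Lt : T -> 'rV[R]_N -> 'rV[R]_N) (E : 'I_3 -> 'rV[R]_N -> 'rV[R]_N)
    (J : 'rV[R]_N -> V) (g : metric R T 3) (X : 'I_3 -> V) (D : 'M[R]_3) (s : 'I_3 -> 'I_3) :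
  let G := @EmbeddedGroup R T V emb mul one in
  let G' := @EmbeddedGroup R T 'rV[R]_N emb' mul one in
  framed_group emb' mul one inv Lt E -> eg_atlas G 3 = eg_atlas G' 3 ->
  (forall k u w, J (k *: u + w) = k *: J u + J w) -> continuous J ->
  (forall p, emb p = J (emb' p)) -> (forall i, J (E i (emb' one)) = X (s i)) ->
  @represented_at_one R G 3 g X D ->
  forall ch, eg_atlas G' 3 ch -> cdom ch one -> forall i j,
  form (g ch (cto ch one)) (eps emb' E ch i (cto ch one)) (eps emb' E ch j (cto ch one)) =
  D (s i) (s j).
Proof.
move=> G G' fg AE JL cJ embJ JE rep ch Ac c1 i j.
have Ac' : eg_atlas G 3 ch by rewrite AE.
have [cx k1] := chart_cto (eg_is_chart Ac) c1.
have D1 k : 'D_(eps emb' E ch k (cto ch one)) (emb \o cinv ch) (cto ch one) =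
    \sum_l (delta_mx 0 (s k) : 'rV[R]_3) 0 l *: X l.
  rewrite (_ : emb \o cinv ch = J \o phi emb' ch); last by apply/funext => x /=; exact: embJ.
  have d := is_derive_linear_comp JL cJ
    (smooth_derivable (eps emb' E ch k (cto ch one)) (phi_smooth Ac) cx).
  refine (etrans (@derive_val _ _ _ _ _ _ _ d) _).
  rewrite (eps_spec fg k Ac cx) /phi /= k1 JE.
  rewrite (bigD1 (s k)) //= mxE !eqxx scale1r big1 ?addr0 // => l lk.
  by rewrite mxE (negbTE lk) andbF scale0r.
rewrite (rep ch Ac' c1 _ _ _ _ (D1 i) (D1 j)) /form -rowE trmx_delta.
by rewrite mxE (bigD1 (s j)) //= !mxE !eqxx mulr1 big1 ?addr0 // => l lj; rewrite !mxE (negbTE lj) mulr0.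
Qed.

(** * The circle and the line *)

Lemma initial_nbhs (S : choiceType) (T : topologicalType) (f : S -> T)
    (p : initial_topology f) (A : set (initial_topology f)) :
  nbhs p A -> exists2 B, nbhs (f p) B & f @^-1` B `<=` A.
Proof.
rewrite nbhsE => -[_ [[B oB <-] Bp] BA]; exists B => //.
by exists B; first split.
Qed.

Lemma section_curve (R : realType) (N n : nat) (T : Type) (emb : T -> 'rV[R]_N) (one : T)
    (V : set 'rV[R]_n) (S : 'rV[R]_n -> T) w :
  smooth_on V (emb \o S) -> V 0 -> S 0 = one ->
  exists2 c : R -> T, c 0 = one & is_derive (0 : R) 1 (emb \o c) ('D_w (emb \o S) 0).
Proof.
move=> sS V0 S0; exists (fun t => S (t *: w)); first by rewrite scale0r.
have E : 0 + (0 : R) *: w = 0 by rewrite scale0r addr0.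
have d : derivable (emb \o S) (0 + (0 : R) *: w) w by rewrite E; exact: (smooth_derivable w sS V0).
have := is_derive_line d; rewrite E.
by under [X in is_derive _ _ X _]eq_fun do rewrite add0r.
Qed.

Section Circle.
Variable R : realType.

Definition k0 : 'I_2 := @Ordinal 2 0 isT.
Definition k1 : 'I_2 := @Ordinal 2 1 isT.
Definition rv2 (a b : R) : 'rV[R]_2 := \row_i [:: a; b]`_i.

Lemma forall2 (P : 'I_2 -> Prop) : P k0 -> P k1 -> forall i, P i.
Proof.
move=> h0 h1 [[|[|//]] Hi].
- by rewrite (_ : Ordinal Hi = k0) //; exact: val_inj.
- by rewrite (_ : Ordinal Hi = k1) //; exact: val_inj.
Qed.

Lemma row2P (u v : 'rV[R]_2) : u 0 k0 = v 0 k0 -> u 0 k1 = v 0 k1 -> u = v.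
Proof. by move=> h0 h1; apply/rowP; exact: forall2. Qed.

Lemma rv2E0 a b : rv2 a b 0 k0 = a. Proof. by rewrite mxE. Qed.
Lemma rv2E1 a b : rv2 a b 0 k1 = b. Proof. by rewrite mxE. Qed.

Definition circle_type : Type := {v : 'rV[R]_2 | v 0 k0 ^+ 2 + v 0 k1 ^+ 2 == 1}.
Let on_circle (v : 'rV[R]_2) := v 0 k0 ^+ 2 + v 0 k1 ^+ 2 == 1.

Definition circle : topologicalType :=
  @initial_topology circle_type 'rV[R]_2 val.
Definition circle_emb (p : circle) : 'rV[R]_2 := val (p : circle_type).

Lemma circle_norm (p : circle) : circle_emb p 0 k0 ^+ 2 + circle_emb p 0 k1 ^+ 2 = 1.
Proof. exact/eqP/(valP (p : circle_type)). Qed.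

Definition cmul (u v : 'rV[R]_2) : 'rV[R]_2 :=
  rv2 (u 0 k0 * v 0 k0 - u 0 k1 * v 0 k1) (u 0 k0 * v 0 k1 + u 0 k1 * v 0 k0).

Fact circle_mul_subproof (p q : circle) :
  (cmul (circle_emb p) (circle_emb q)) 0 k0 ^+ 2 + (cmul (circle_emb p) (circle_emb q)) 0 k1 ^+ 2 == 1.
Proof.
apply/eqP; rewrite rv2E0 rv2E1; move: (circle_norm p) (circle_norm q).
move: (circle_emb p 0 k0) (circle_emb p 0 k1) (circle_emb q 0 k0) (circle_emb q 0 k1) => a b c d h h'.
by rewrite (_ : _ + _ = (a ^+ 2 + b ^+ 2) * (c ^+ 2 + d ^+ 2)); [rewrite h h' mulr1|ring].
Qed.

Definition circle_mul (p q : circle) : circle := exist on_circle _ (circle_mul_subproof p q).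

Fact circle_one_subproof : rv2 1 0 0 k0 ^+ 2 + rv2 1 0 0 k1 ^+ 2 == 1.
Proof. by apply/eqP; rewrite rv2E0 rv2E1; ring. Qed.

Definition circle_one : circle := exist on_circle _ circle_one_subproof.

Fact circle_inv_subproof (p : circle) :
  (rv2 (circle_emb p 0 k0) (- circle_emb p 0 k1)) 0 k0 ^+ 2 +
  (rv2 (circle_emb p 0 k0) (- circle_emb p 0 k1)) 0 k1 ^+ 2 == 1.
Proof. by apply/eqP; rewrite rv2E0 rv2E1 sqrrN circle_norm. Qed.

Definition circle_inv (p : circle) : circle := exist on_circle _ (circle_inv_subproof p).

Fact circle_param_subproof (t : R) :
  (rv2 ((1 - t ^+ 2) / (1 + t ^+ 2)) (2 * t / (1 + t ^+ 2))) 0 k0 ^+ 2 +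
  (rv2 ((1 - t ^+ 2) / (1 + t ^+ 2)) (2 * t / (1 + t ^+ 2))) 0 k1 ^+ 2 == 1.
Proof.
have d : 1 + t ^+ 2 != 0 by rewrite gt_eqF // ltr_pwDl // sqr_ge0.
by apply/eqP; rewrite rv2E0 rv2E1; field.
Qed.

(** Inverse stereographic projection from (-1, 0): a rational parametrization, which keeps
    trigonometric functions out. *)
Definition circle_param (x : 'rV[R]_1) : circle := exist on_circle _ (circle_param_subproof (x 0 0)).

Definition circle_frame (i : 'I_1) (v : 'rV[R]_2) : 'rV[R]_2 := rv2 (- v 0 k1) (v 0 k0).

Lemma circle_mulE p q : circle_emb (circle_mul p q) = cmul (circle_emb p) (circle_emb q).
Proof. by []. Qed.

Lemma circle_invE p : circle_emb (circle_inv p) = rv2 (circle_emb p 0 k0) (- circle_emb p 0 k1).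
Proof. by []. Qed.

Lemma circle_oneE : circle_emb circle_one = rv2 1 0. Proof. by []. Qed.

Lemma circle_paramE x : circle_emb (circle_param x) =
  rv2 ((1 - x 0 0 ^+ 2) / (1 + x 0 0 ^+ 2)) (2 * x 0 0 / (1 + x 0 0 ^+ 2)).
Proof. by []. Qed.

Lemma circle_emb_inj : injective circle_emb.
Proof. exact: val_inj. Qed.

Lemma circle_emb_cont : continuous circle_emb.
Proof. exact: initial_continuous. Qed.

Lemma cmul_linear u k v w : cmul u (k *: v + w) = k *: cmul u v + cmul u w.
Proof. by apply: row2P; rewrite !mxE /=; ring. Qed.

Lemma circle_frame_linear i k v w :
  circle_frame i (k *: v + w) = k *: circle_frame i v + circle_frame i w.
Proof. by apply: row2P; rewrite !mxE /=; ring. Qed.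

Let den (x : 'rV[R]_1) : 1 + x 0 0 ^+ 2 != 0.
Proof. by rewrite gt_eqF // ltr_pwDl // sqr_ge0. Qed.

Lemma circle_param_smooth : smooth_on setT (circle_emb \o circle_param).
Proof.
apply: smooth_rowP => [|]; first exact: openT.
apply: forall2; rewrite /circle_emb /=.
- under eq_fun do rewrite rv2E0.
  by smooth_rules.
- under eq_fun do rewrite rv2E1.
  by smooth_rules.
Qed.

Definition circle_stereo (v : 'rV[R]_2) : 'rV[R]_1 := \row_i (v 0 k1 / (1 + v 0 k0)).

Definition circle_slit : set 'rV[R]_2 := [set v | 1 + v 0 k0 != 0].

Lemma neq_open n (f : 'rV[R]_n -> R) : smooth_on setT f -> open [set v | f v != 0].
Proof.
move=> sf; apply: (@open_comp _ _ f [set y | y != 0]); last exact: open_neq.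
by move=> x _; exact: (smooth_continuous sf I).
Qed.

Lemma circle_slit_open : open circle_slit.
Proof. by apply: (neq_open (f := fun v => 1 + v 0 k0)); smooth_rules. Qed.

Lemma circle_chart :
  eg_atlas (@EmbeddedGroup R circle 'rV[R]_2 circle_emb circle_mul circle_one) 1
    (@Chart R circle 1 (circle_emb @^-1` circle_slit) (circle_stereo \o circle_emb) circle_param).
Proof.
apply: (@retraction_chart _ _ _ _ _ _ _ _ _ circle_slit circle_stereo setT circle_param).
- exact: circle_emb_cont.
- exact: initial_nbhs.
- exact: circle_slit_open.
- apply: smooth_rowP => [|i]; first exact: circle_slit_open.
  under eq_fun do rewrite mxE.
  have o := circle_slit_open.
  apply: smoothM => //; first exact: smooth_coord.
  apply: smoothV => //; apply: smoothD => //; [exact: smooth_cst|exact: smooth_coord].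
- exact: openT.
- exact: circle_param_smooth.
- move=> x _; rewrite /circle_slit /circle_emb /= rv2E0.
  have d := den x; rewrite (_ : _ + _ = 2 / (1 + x 0 0 ^+ 2)); last by field.
  by rewrite mulf_neq0 // invr_neq0.
- move=> x _; apply/rowP => i; rewrite ord1 mxE /circle_emb /= rv2E0 rv2E1.
  have d := den x; field; apply/andP; split=> //.
  by rewrite (_ : _ + _ = 2) //; ring.
- by [].
- move=> p; rewrite /circle_slit /= => Dp; apply: circle_emb_inj.
  move: (circle_norm p) Dp; rewrite {3}/circle_emb /=.
  set a := circle_emb p 0 k0; set b := circle_emb p 0 k1 => h Dp.
  have E : 1 + (b / (1 + a)) ^+ 2 = 2 / (1 + a).
    by rewrite exprMn (_ : b ^+ 2 = (1 - a) * (1 + a)); [field|rewrite -[b ^+ 2](addKr (a ^+ 2)) h; ring].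
  apply: row2P; rewrite ?rv2E0 ?rv2E1 mxE -/a -/b E.
    have -> : 1 - (b / (1 + a)) ^+ 2 = 2 - 2 / (1 + a) by rewrite -E; ring.
    by field.
  by field.
Qed.

Lemma circle_framed : framed_group circle_emb circle_mul circle_one circle_inv
  (fun a => cmul (circle_emb a)) circle_frame.
Proof.
have sS := circle_param_smooth.
have P0 : circle_param 0 = circle_one.
  by apply: circle_emb_inj; apply: row2P; rewrite /circle_emb /= ?rv2E0 ?rv2E1 !mxE expr0n /= !(subr0, addr0, divr1, mulr0).
split.
- move=> a; apply: circle_emb_inj; apply: row2P; rewrite /circle_emb /= !(rv2E0, rv2E1).
    by rewrite mulr1 mulr0 subr0.
  by rewrite mulr1 mulr0 add0r.
- move=> a b; apply: circle_emb_inj; move: (circle_norm a) => h.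
  by apply: row2P; rewrite !circle_mulE circle_invE /cmul !(rv2E0, rv2E1) -[RHS]mul1r -h; ring.
- move=> a b; apply: circle_emb_inj; move: (circle_norm a) => h.
  by apply: row2P; rewrite !circle_mulE circle_invE /cmul !(rv2E0, rv2E1) -[RHS]mul1r -h; ring.
- exact: circle_emb_inj.
- exact: circle_emb_cont.
- exact: initial_nbhs.
- by move=> a; exact: linear_smooth (cmul_linear _).
- by [].
- by move=> i; exact: linear_smooth (circle_frame_linear i).
- move=> a b i; have d := is_derive_linear (circle_emb b) (circle_frame i (circle_emb b)) (cmul_linear (circle_emb a)).
  refine (etrans (@derive_val _ _ _ _ _ _ _ d) _).
  by apply: row2P; rewrite circle_mulE /cmul /circle_frame !(rv2E0, rv2E1); ring.
- move=> u; rewrite big_ord1 => /rowP/(_ k1) u0; apply/rowP => i; rewrite ord1.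
  by move: u0; rewrite mxE mxE circle_oneE rv2E0 /= mulr1 !mxE.
(* The parametrization has velocity (0, 2) at 0, and the frame vector there is (0, 1). *)
- move=> i; pose w : 'rV[R]_1 := const_mx 2^-1.
  have [c c0 dc] := section_curve w sS I P0; exists c => //.
  rewrite (_ : circle_frame _ _ = 'D_w (circle_emb \o circle_param) 0) //.
  apply: row2P.
    rewrite (derive_mxE _ _ _ sS I) /circle_frame rv2E0 circle_oneE rv2E1 oppr0; apply/esym.
    rewrite (_ : (fun y => _) = (fun y : 'rV[R]_1 => (1 - y 0 0 ^+ 2) / (1 + y 0 0 ^+ 2))); last first.
      by apply/funext => y; rewrite /= circle_paramE rv2E0.
    by apply: derive_eq; [derive_rules; exact: (den 0)|rewrite !mxE; ring].
  rewrite (derive_mxE _ _ _ sS I) /circle_frame rv2E1 circle_oneE rv2E0; apply/esym.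
  rewrite (_ : (fun y => _) = (fun y : 'rV[R]_1 => 2 * y 0 0 / (1 + y 0 0 ^+ 2))); last first.
    by apply/funext => y; rewrite /= circle_paramE rv2E1.
  apply: derive_eq; [derive_rules; exact: (den 0)|].
  by rewrite !mxE; field.
- exists (@Chart R circle 1 (circle_emb @^-1` circle_slit) (circle_stereo \o circle_emb) circle_param).
    exact: circle_chart.
  have h : (0 : R) < 1 + 1 by rewrite addr_gt0.
  by change (is_true (1 + (circle_emb circle_one) 0 k0 != 0)); rewrite circle_oneE rv2E0; exact: lt0r_neq0 h.
Qed.

End Circle.

Section Line.
Variable R : realType.

Lemma line_connected : connected [set: 'rV[R]_1].
Proof.
have -> : [set: 'rV[R]_1] = (fun t : R => t *: (const_mx 1 : 'rV[R]_1)) @` setT.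
  apply/seteqP; split=> // x _; exists (x 0 0) => //.
  by apply/rowP => i; rewrite !mxE mulr1 !ord1.
apply: connected_continuous_connected; first by apply/connected_intervalP => x y _ _ z _.
by move=> t; apply: continuous_subspaceT => {}t; exact: scalel_continuous.
Qed.

(** The parametrization misses only the point -1; together with its translate by -1 it covers the
    circle, and the two images meet at the point (0, 1). *)
Lemma circle_connected : connected [set: circle R].
Proof.
have pc : continuous (@circle_param R).
  move=> x; apply: (initial_cont (circle_framed R)).
  exact: (smooth_continuous (circle_param_smooth R) I).
have cc := line_connected.
(* The element -1 is the square of the point of parameter 1, which is (0, 1). *)
have [m mE] : exists m : circle R, circle_emb m = rv2 (- 1) 0.
  exists (circle_mul (@circle_param R (const_mx 1)) (@circle_param R (const_mx 1))).
  rewrite circle_mulE circle_paramE /cmul !(rv2E0, rv2E1) !mxE.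
  by congr rv2; field.
pose p1 := @circle_param R.
pose p2 := circle_mul m \o p1.
have pc2 : continuous p2.
  by move=> x; apply: continuous_comp; [exact: pc|exact: (mul_continuous (circle_framed R))].
have c1 : connected (range p1).
  by apply: connected_continuous_connected => //; apply: continuous_subspaceT.
have c2 : connected (range p2).
  by apply: connected_continuous_connected => //; apply: continuous_subspaceT.
have paramK (p : circle R) : circle_slit (circle_emb p) -> range p1 p.
  move=> Dp; exists (circle_stereo (circle_emb p)) => //.
  by have [[_ _ H _ _] _ _] := circle_chart R; exact: H.
have mK (p : circle R) : circle_mul m (circle_mul m p) = p.
  apply: circle_emb_inj; rewrite !circle_mulE mE /cmul.
  by apply: row2P; rewrite !(rv2E0, rv2E1); ring.
have -> : [set: circle R] = range p1 `|` range p2.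
  apply/seteqP; split=> // p _.
  have [H|H] := eqVneq (1 + circle_emb p 0 k0) 0; last by left; exact: paramK.
  right; have : circle_slit (circle_emb (circle_mul m p)).
    rewrite /circle_slit /= circle_mulE mE /cmul !(rv2E0, rv2E1).
    have -> : 1 + (-1 * circle_emb p 0 k0 - 0 * circle_emb p 0 k1) = 1 + 1 - (1 + circle_emb p 0 k0) by ring.
    by rewrite H subr0 lt0r_neq0 // addr_gt0.
  by move=> /paramK[x _ xE]; exists x => //; rewrite /p2 /= xE mK.
apply: connectedU => //.
exists (p1 (const_mx 1)); split; first by exists (const_mx 1).
exists (const_mx (- 1)) => //; apply: circle_emb_inj.
rewrite /p2 /p1 /= circle_mulE mE !circle_paramE /cmul !(rv2E0, rv2E1) !mxE.
by congr rv2; field.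
Qed.

Lemma line_framed : framed_group id (fun u v : 'rV[R]_1 => u + v) 0 (fun u => - u) (fun u v => u + v)
  (fun (i : 'I_1) _ => const_mx 1).
Proof.
have sid n : smooth_on setT (@id 'rV[R]_n) by apply: smooth_id; exact: openT.
have sS : smooth_on setT (id \o @id 'rV[R]_1) by exact: sid.
split=> //.
- by move=> a; rewrite addr0.
- by move=> a b; rewrite addKr.
- by move=> a b; rewrite addNKr.
- by move=> x; exact: cvg_id.
- by move=> p A pA; exists A.
- move=> a; apply: smoothD; [exact: openT|exact: smooth_cst|exact: sid].
- by move=> i; exact: smooth_cst.
- move=> a b i.
  by rewrite deriveD //= derive_cst add0r derive_id.
- move=> u; rewrite big_ord1 => /rowP/(_ 0); rewrite !mxE mulr1 => u0.
  by apply/rowP => i; rewrite ord1 mxE.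
- move=> i; have [c c0 dc] := section_curve (const_mx 1) sS I (erefl : (id (0 : 'rV[R]_1) = 0)); exists c => //.
  by move: dc; rewrite /= derive_id.
- exists (@Chart R 'rV[R]_1 1 (id @^-1` setT) (id \o id) id); last exact: I.
  by apply: (@retraction_chart _ _ _ _ _ _ _ _ _ setT id setT id) => //; [move=> x; exact: cvg_id
    |move=> p A pA; exists A|exact: openT|exact: openT].
Qed.

End Line.

(** * Quaternion groups *)

Definition j0 : 'I_4 := @Ordinal 4 0 isT.
Definition j1 : 'I_4 := @Ordinal 4 1 isT.
Definition j2 : 'I_4 := @Ordinal 4 2 isT.
Definition j3 : 'I_4 := @Ordinal 4 3 isT.

Lemma forall4 (P : 'I_4 -> Prop) : P j0 -> P j1 -> P j2 -> P j3 -> forall i, P i.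
Proof.
move=> h0 h1 h2 h3 [[|[|[|[|//]]]] Hi].
- by rewrite (_ : Ordinal Hi = j0) //; exact: val_inj.
- by rewrite (_ : Ordinal Hi = j1) //; exact: val_inj.
- by rewrite (_ : Ordinal Hi = j2) //; exact: val_inj.
- by rewrite (_ : Ordinal Hi = j3) //; exact: val_inj.
Qed.

Lemma row3P (R : Type) (u v : 'rV[R]_3) :
  u 0 i0 = v 0 i0 -> u 0 i1 = v 0 i1 -> u 0 i2 = v 0 i2 -> u = v.
Proof. by move=> h0 h1 h2; apply/rowP; exact: forall3. Qed.

Lemma row4P (R : Type) (u v : 'rV[R]_4) :
  u 0 j0 = v 0 j0 -> u 0 j1 = v 0 j1 -> u 0 j2 = v 0 j2 -> u 0 j3 = v 0 j3 -> u = v.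
Proof. by move=> h0 h1 h2 h3; apply/rowP; exact: forall4. Qed.

Lemma lincombE (R : pzRingType) n k (v w : 'rV[R]_n) i : (k *: v + w) 0 i = k * v 0 i + w 0 i.
Proof. by rewrite !mxE. Qed.

Section QuaternionAlgebra.
Context {R : realType}.
Variables e s : R.
Implicit Types u v w : 'rV[R]_4.

Definition rv4 (a b c d : R) : 'rV[R]_4 := \row_i [:: a; b; c; d]`_i.

Lemma rv4E a b c d : (rv4 a b c d 0 j0 = a) * (rv4 a b c d 0 j1 = b) *
  (rv4 a b c d 0 j2 = c) * (rv4 a b c d 0 j3 = d).
Proof. by rewrite !mxE. Qed.

Definition qnorm v := v 0 j0 ^+ 2 + v 0 j1 ^+ 2 - e * (v 0 j2 ^+ 2 + v 0 j3 ^+ 2).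

Definition qmul u v : 'rV[R]_4 := rv4
  (u 0 j0 * v 0 j0 - u 0 j1 * v 0 j1 + e * (u 0 j2 * v 0 j2) + e * (u 0 j3 * v 0 j3))
  (u 0 j0 * v 0 j1 + u 0 j1 * v 0 j0 - e * (u 0 j2 * v 0 j3) + e * (u 0 j3 * v 0 j2))
  (u 0 j0 * v 0 j2 + u 0 j2 * v 0 j0 - u 0 j1 * v 0 j3 + u 0 j3 * v 0 j1)
  (u 0 j0 * v 0 j3 + u 0 j3 * v 0 j0 + u 0 j1 * v 0 j2 - u 0 j2 * v 0 j1).

Definition qconj v := rv4 (v 0 j0) (- v 0 j1) (- v 0 j2) (- v 0 j3).

(** Right multiplication by s i, s j and s k, which commutes with left translations. SU(2) takes s =
    1/2 and SL(2, R) takes s = 1. *)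
Definition qframe (i : 'I_3) v : 'rV[R]_4 :=
  match i : nat with
  | 0 => rv4 (s * - v 0 j1) (s * v 0 j0) (s * v 0 j3) (s * - v 0 j2)
  | 1 => rv4 (s * (e * v 0 j2)) (s * (e * v 0 j3)) (s * v 0 j0) (s * v 0 j1)
  | _ => rv4 (s * (e * v 0 j3)) (s * - (e * v 0 j2)) (s * - v 0 j1) (s * v 0 j0)
  end.

(** For v = alpha + beta j, the four functions are |alpha|^2, |beta|^2 and the real and imaginary
    parts of alpha beta. *)
Definition qA v := v 0 j0 ^+ 2 + v 0 j1 ^+ 2.
Definition qB v := v 0 j2 ^+ 2 + v 0 j3 ^+ 2.
Definition qX v := v 0 j2 * v 0 j0 - v 0 j3 * v 0 j1.
Definition qY v := v 0 j1 * v 0 j2 + v 0 j0 * v 0 j3.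

(** This is v i conj(v), see [hopfE]. On the elements of norm 1 its fibres are the cosets of the
    stabilizer of i under conjugation, the circle of the a + b i; for e = -1 it is the Hopf map. *)
Definition hopf v := rv4 0 (qA v + e * qB v) (2 * qY v) (- (2 * qX v)).

Definition hopf_coord v := rv2 (qX v / qA v) (- (qY v / qA v)).
Definition hopf_dom : set 'rV[R]_4 := [set v | qA v != 0].

(** For the coordinate z = conj(beta) / alpha of an element of norm 1 this is 1 / |alpha|^2. Its
    positivity describes the whole plane if e = -1 and the unit disc if e = 1. *)
Definition base_den (z : 'rV[R]_2) := 1 - e * (z 0 k0 ^+ 2 + z 0 k1 ^+ 2).
Definition base_dom2 : set 'rV[R]_2 := [set z | 0 < base_den z].
(** The point above z whose component alpha is a positive real number; then beta = alpha conj(z). *)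
Definition hopf_lift z := let r := (Num.sqrt (base_den z))^-1 in
  rv4 r 0 (r * z 0 k0) (r * - z 0 k1).
(** The metric |dz|^2 / (s^2 (1 - e |z|^2)^2): round for e = -1, hyperbolic for e = 1. *)
Definition base_metric z : 'M[R]_2 := (s ^+ 2 * base_den z ^+ 2)^-1%:M.

(* the coefficients of [conj v i v - i] in the frame *)
Definition rot0 v := (qA v + e * qB v - 1) / (2 * s).
Definition rot1 v := (v 0 j1 * v 0 j2 - v 0 j0 * v 0 j3) / s.
Definition rot2 v := (v 0 j1 * v 0 j3 + v 0 j0 * v 0 j2) / s.
Definition rota v := qA v + e * qB v.

Lemma qmulA u v w : qmul u (qmul v w) = qmul (qmul u v) w.
Proof. by apply: row4P; rewrite /qmul !rv4E; ring. Qed.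

Lemma qmul_conjl u v : qmul (qconj u) (qmul u v) = qnorm u *: v.
Proof. by apply: row4P; rewrite [RHS]mxE /qmul /qconj !rv4E /qnorm; ring. Qed.

Lemma qmul_conjr u v : qmul u (qmul (qconj u) v) = qnorm u *: v.
Proof. by apply: row4P; rewrite [RHS]mxE /qmul /qconj !rv4E /qnorm; ring. Qed.

Lemma qmul_linearr u k v w : qmul u (k *: v + w) = k *: qmul u v + qmul u w.
Proof. by apply: row4P; rewrite lincombE /qmul !rv4E !lincombE; ring. Qed.

Lemma qmul_linearl u k v w : qmul (k *: v + w) u = k *: qmul v u + qmul w u.
Proof. by apply: row4P; rewrite lincombE /qmul !rv4E !lincombE; ring. Qed.

Lemma qframe_linear i k v w : qframe i (k *: v + w) = k *: qframe i v + qframe i w.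
Proof.
by move: i; apply: forall3; apply: row4P; rewrite /qframe /= !lincombE !rv4E; ring.
Qed.

Lemma qframe_left i u v : qmul u (qframe i v) = qframe i (qmul u v).
Proof. by move: i; apply: forall3; apply: row4P; rewrite /qframe /= /qmul !rv4E; ring. Qed.

Lemma qconjM u v : qconj (qmul u v) = qmul (qconj v) (qconj u).
Proof. by apply: row4P; rewrite /qmul /qconj !rv4E; ring. Qed.

Lemma hopfE v : hopf v = qmul (qmul v (rv4 0 1 0 0)) (qconj v).
Proof. by apply: row4P; rewrite /hopf /qmul /qconj /qA /qB /qX /qY !rv4E; ring. Qed.

Lemma hopf_left u v : hopf (qmul u v) = qmul (qmul u (hopf v)) (qconj u).
Proof. by rewrite !hopfE qconjM -!qmulA. Qed.

End QuaternionAlgebra.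

Section QuaternionGroup.
Context {R : realType} (e s : R).
Hypotheses (e_neq0 : e != 0) (s_neq0 : s != 0).
Context {T : topologicalType} {emb : T -> 'rV[R]_4} {mul : T -> T -> T} {one : T}.
Context {unq : 'rV[R]_4 -> T}.
Hypotheses (emb_inj : injective emb) (emb_cont : continuous emb).
Hypothesis emb_nbhs : forall p A, nbhs p A -> exists2 B, nbhs (emb p) B & emb @^-1` B `<=` A.
Hypothesis emb_norm : forall p, qnorm e (emb p) = 1.
Hypothesis emb_mul : forall p q, emb (mul p q) = qmul e (emb p) (emb q).
Hypothesis emb_one : emb one = rv4 1 0 0 0.
Hypothesis unqK : forall v, qnorm e v = 1 -> emb (unq v) = v.

Definition qinv p := unq (qconj (emb p)).

Lemma qinvE p : emb (qinv p) = qconj (emb p).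
Proof.
by apply: unqK; rewrite -[RHS](emb_norm p) /qnorm /qconj !rv4E !sqrrN.
Qed.

Definition qn (x : 'rV[R]_3) := x 0 i0 ^+ 2 - e * (x 0 i1 ^+ 2 + x 0 i2 ^+ 2).
(** The Cayley transform (1 + x) / (1 - x) of a pure quaternion x, whose square is minus its norm
    [qn x]; [qstereo] inverts it. *)
Definition qcayley (x : 'rV[R]_3) := rv4 ((1 - qn x) / (1 + qn x)) (2 * x 0 i0 / (1 + qn x))
  (2 * x 0 i1 / (1 + qn x)) (2 * x 0 i2 / (1 + qn x)).
Definition qcayley_dom : set 'rV[R]_3 := [set x | 1 + qn x != 0].
Definition qstereo (v : 'rV[R]_4) : 'rV[R]_3 :=
  \row_i ((\row_k [:: v 0 j1; v 0 j2; v 0 j3]`_k) 0 i / (1 + v 0 j0)).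
Definition qslit : set 'rV[R]_4 := [set v | 1 + v 0 j0 != 0].

Lemma qcayley_norm x : qcayley_dom x -> qnorm e (qcayley x) = 1.
Proof. by rewrite /qcayley_dom /= /qnorm /qcayley !rv4E => d; move: d; rewrite /qn => d; field. Qed.

Lemma qcayley_emb x : qcayley_dom x -> emb (unq (qcayley x)) = qcayley x.
Proof. by move=> d; apply: unqK; exact: qcayley_norm. Qed.

Lemma qcayley_dom_open : open qcayley_dom.
Proof. by apply: (neq_open (f := fun x => 1 + qn x)); rewrite /qn; smooth_rules. Qed.

Lemma qslit_open : open qslit.
Proof. by apply: (neq_open (f := fun v => 1 + v 0 j0)); smooth_rules. Qed.

Lemma qn_smooth U : open U -> smooth_on U qn.
Proof. by move=> oU; rewrite /qn; smooth_rules. Qed.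

Lemma qcayley_smooth : smooth_on qcayley_dom qcayley.
Proof.
have oU := qcayley_dom_open; have sn := qn_smooth oU.
have sV : smooth_on qcayley_dom (fun x => (1 + qn x)^-1).
  by apply: smoothV => //; apply: smoothD => //; exact: smooth_cst.
have sc (i : 'I_3) : smooth_on qcayley_dom (fun x => 2 * x 0 i / (1 + qn x)).
  apply: smoothM => //; apply: smoothM => //; [exact: smooth_cst|exact: smooth_coord].
apply: smooth_rowP => //; apply: forall4.
- under eq_fun do rewrite rv4E.
  by apply: smoothM => //; apply: smoothB => //; exact: smooth_cst.
- under eq_fun do rewrite rv4E.
  exact: sc.
- under eq_fun do rewrite rv4E.
  exact: sc.
- under eq_fun do rewrite rv4E.
  exact: sc.
Qed.

Lemma qsection_smooth : smooth_on qcayley_dom (emb \o (unq \o qcayley)).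
Proof.
apply: (smooth_eq qcayley_dom_open _ qcayley_smooth) => x dx.
by rewrite /= qcayley_emb.
Qed.

Lemma qstereoE v : (qstereo v 0 i0 = v 0 j1 / (1 + v 0 j0)) *
  (qstereo v 0 i1 = v 0 j2 / (1 + v 0 j0)) * (qstereo v 0 i2 = v 0 j3 / (1 + v 0 j0)).
Proof. by rewrite !mxE. Qed.

Lemma qstereo_qn v : qslit v -> qnorm e v = 1 -> 1 + qn (qstereo v) = 2 / (1 + v 0 j0).
Proof.
rewrite /qslit /= => Dv N1.
have -> : 1 + qn (qstereo v) = ((1 + v 0 j0) ^+ 2 + (qnorm e v - v 0 j0 ^+ 2)) / (1 + v 0 j0) ^+ 2.
  by rewrite /qn !qstereoE /qnorm; field.
by rewrite N1; field.
Qed.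

Lemma quat_chart :
  eg_atlas (@EmbeddedGroup R T 'rV[R]_4 emb mul one) 3
    (@Chart R T 3 (emb @^-1` qslit) (qstereo \o emb) (unq \o qcayley)).
Proof.
have oD := qslit_open.
apply: (@retraction_chart _ _ _ _ _ _ _ emb_cont emb_nbhs qslit qstereo qcayley_dom (unq \o qcayley)).
- exact: oD.
- have si : smooth_on qslit (fun v => (1 + v 0 j0)^-1).
    by apply: smoothV => //; apply: smoothD => //; [exact: smooth_cst|exact: smooth_coord].
  apply: smooth_rowP => //; apply: forall3.
  + under eq_fun do rewrite qstereoE.
    by apply: smoothM => //; exact: smooth_coord.
  + under eq_fun do rewrite qstereoE.
    by apply: smoothM => //; exact: smooth_coord.
  + under eq_fun do rewrite qstereoE.
    by apply: smoothM => //; exact: smooth_coord.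
- exact: qcayley_dom_open.
- exact: qsection_smooth.
- move=> x Vx; rewrite /= /qslit /= qcayley_emb // rv4E.
  have d : 1 + qn x != 0 by exact: Vx.
  by rewrite (_ : 1 + _ = 2 / (1 + qn x)); [rewrite mulf_neq0 ?invr_neq0|field].
- move=> x Vx; have d : 1 + qn x != 0 by exact: Vx.
  have d2 : 2 != 0 :> R by rewrite pnatr_eq0.
  have d3 : 1 + (1 - qn x) / (1 + qn x) = 2 / (1 + qn x) by field.
  by rewrite /= qcayley_emb //; apply: row3P; rewrite !qstereoE /qcayley !rv4E d3; field; rewrite ?d ?d2.
- move=> p Dp; rewrite /qcayley_dom /= (qstereo_qn Dp (emb_norm p)).
  have d : 1 + emb p 0 j0 != 0 by exact: Dp.
  by rewrite mulf_neq0 ?invr_neq0 // pnatr_eq0.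
- move=> p Dp; have d : 1 + emb p 0 j0 != 0 by exact: Dp.
  have E := qstereo_qn Dp (emb_norm p).
  have Vx : qcayley_dom (qstereo (emb p)).
    by rewrite /qcayley_dom /= E mulf_neq0 ?invr_neq0 // pnatr_eq0.
  have E2 : qn (qstereo (emb p)) = 2 / (1 + emb p 0 j0) - 1 by rewrite -E; ring.
  apply: emb_inj; rewrite /= qcayley_emb //.
  by apply: row4P; rewrite /qcayley !rv4E ?qstereoE E ?E2; field.
Qed.

Lemma qcayley_derive0 w : 'D_w qcayley 0 = rv4 0 (2 * w 0 i0) (2 * w 0 i1) (2 * w 0 i2).
Proof.
have n0 : qn 0 = 0 by rewrite /qn !mxE; ring.
have V0 : qcayley_dom 0 by rewrite /qcayley_dom /= n0 addr0 oner_neq0.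
have dn : is_derive (0 : 'rV[R]_3) w qn 0.
  apply: is_derive_val; first by rewrite /qn; derive_rules.
  by rewrite /= !mxE; ring.
have di : is_derive (0 : 'rV[R]_3) w (fun x => (1 + qn x)^-1) 0.
  have d1 : 1 + qn 0 != 0 by exact: V0.
  refine (is_derive_val (is_derive_inv (f := fun x => 1 + qn x) d1 (is_derive_add (is_derive_cst_fun 1 0 w) dn)) _).
  by rewrite addr0 oppr0 mul0r.
have dc (i : 'I_3) : is_derive (0 : 'rV[R]_3) w (fun x => 2 * x 0 i / (1 + qn x)) (2 * w 0 i).
  refine (is_derive_val (is_derive_mul (is_derive_mul (is_derive_cst_fun 2 0 w) (is_derive_coord 0 w i)) di) _).
  by rewrite /= n0 !mxE addr0 invr1; ring.
apply: row4P; rewrite (derive_mxE _ _ _ qcayley_smooth V0) rv4E.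
- rewrite (_ : (fun y : 'rV[R]_3 => _) = (fun y : 'rV[R]_3 => (1 - qn y) / (1 + qn y))); last by apply/funext => y; rewrite rv4E.
  refine (derive_eq (is_derive_mul (is_derive_add (is_derive_cst_fun 1 0 w) (is_derive_opp dn)) di) _).
  by rewrite /= n0; ring.
- rewrite (_ : (fun y : 'rV[R]_3 => _) = (fun y : 'rV[R]_3 => 2 * y 0 i0 / (1 + qn y))); last by apply/funext => y; rewrite rv4E.
  exact: derive_eq (dc i0) erefl.
- rewrite (_ : (fun y : 'rV[R]_3 => _) = (fun y : 'rV[R]_3 => 2 * y 0 i1 / (1 + qn y))); last by apply/funext => y; rewrite rv4E.
  exact: derive_eq (dc i1) erefl.
- rewrite (_ : (fun y : 'rV[R]_3 => _) = (fun y : 'rV[R]_3 => 2 * y 0 i2 / (1 + qn y))); last by apply/funext => y; rewrite rv4E.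
  exact: derive_eq (dc i2) erefl.
Qed.

Lemma quat_framed : framed_group emb mul one qinv (fun a => qmul e (emb a)) (qframe e s).
Proof.
have n0 : qn 0 = 0 by rewrite /qn !mxE; ring.
have V0 : qcayley_dom 0 by rewrite /qcayley_dom /= n0 addr0 oner_neq0.
have S0 : (unq \o qcayley) 0 = one.
  apply: emb_inj; rewrite /= qcayley_emb // emb_one.
  by apply: row4P; rewrite /qcayley !rv4E n0 ?mxE; field.
split.
- move=> a; apply: emb_inj; rewrite emb_mul emb_one.
  by apply: row4P; rewrite /qmul !rv4E; ring.
- by move=> a b; apply: emb_inj; rewrite !emb_mul qinvE qmul_conjl emb_norm scale1r.
- by move=> a b; apply: emb_inj; rewrite !emb_mul qinvE qmul_conjr emb_norm scale1r.
- exact: emb_inj.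
- exact: emb_cont.
- exact: emb_nbhs.
- by move=> a; exact: linear_smooth (qmul_linearr _ _).
- exact: emb_mul.
- by move=> i; exact: linear_smooth (qframe_linear _ _ i).
- move=> a b i.
  have d := is_derive_linear (emb b) (qframe e s i (emb b)) (qmul_linearr e (emb a)).
  by refine (etrans (@derive_val _ _ _ _ _ _ _ d) _); rewrite qframe_left emb_mul.
- move=> u; rewrite sum3 emb_one /qframe /= => /rowP H; apply: row3P.
  + by move: (H j1); rewrite !mxE /=; clear H => H; apply: (mulIf s_neq0); rewrite mul0r -[RHS]H; ring.
  + by move: (H j2); rewrite !mxE /=; clear H => H; apply: (mulIf s_neq0); rewrite mul0r -[RHS]H; ring.
  + by move: (H j3); rewrite !mxE /=; clear H => H; apply: (mulIf s_neq0); rewrite mul0r -[RHS]H; ring.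
(* The Cayley transform has derivative 2 w at 0, by [qcayley_derive0], and s w' is wanted for a unit
   vector w'. *)
- move=> i; pose w : 'rV[R]_3 := \row_k (if k == i then s / 2 else 0).
  have [c c0 dc] := section_curve w qsection_smooth V0 S0; exists c => //.
  rewrite (_ : qframe _ _ _ _ = 'D_w (emb \o (unq \o qcayley)) 0) //.
  rewrite (@near_eq_derive _ _ _ _ qcayley); last first.
    have nV : \forall x \near (0 : 'rV[R]_3), qcayley_dom x.
      by apply: open_nbhs_nbhs; split=> //; exact: qcayley_dom_open.
    by apply: filterS nV => x Vx; exact: qcayley_emb.
  clear c c0 dc; rewrite qcayley_derive0 emb_one /w; clear w; move: i; apply: forall3; apply: row4P;
    by rewrite /qframe /= !rv4E ?mxE /=; field.
- exists (@Chart R T 3 (emb @^-1` qslit) (qstereo \o emb) (unq \o qcayley)); first exact: quat_chart.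
  by rewrite /= /qslit /= emb_one rv4E lt0r_neq0 // addr_gt0.
Qed.

Let frame_derive i v w : 'D_w (qframe e s i) v = qframe e s i w.
Proof.
have d := is_derive_linear v w (qframe_linear e s i).
exact: (@derive_val _ _ _ _ _ _ _ d).
Qed.

(** The frame fields are linear in the point, so their brackets come from the commutators ij - ji =
    2 k, ki - ik = 2 j and jk - kj = - 2 e i. *)
Lemma quat_brackets : frame_brackets emb (qframe e s) (- (2 * e * s)) (2 * s).
Proof.
split=> q.
- rewrite !frame_derive.
  by apply: row4P; rewrite /qframe /= !mxE /=; ring.
- rewrite !frame_derive.
  by apply: row4P; rewrite /qframe /= !mxE /=; ring.
- rewrite !frame_derive.
  by apply: row4P; rewrite /qframe /= !mxE /=; ring.
Qed.

Lemma quat_rotation : rotation_field emb one (qframe e s) (- (2 * e * s)) (2 * s)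
  (rot0 e s) (rot1 s) (rot2 s) (rota e).
Proof.
have sA : smooth_on setT (fun v : 'rV[R]_4 => qA v) by rewrite /qA; smooth_rules.
have sB : smooth_on setT (fun v : 'rV[R]_4 => qB v) by rewrite /qB; smooth_rules.
split.
- split.
  + apply: smoothM; [exact: openT| |exact: smooth_cst].
    apply: smoothB; [exact: openT| |exact: smooth_cst].
    by apply: smoothD => //; [exact: openT|apply: smoothM => //; [exact: openT|exact: smooth_cst]].
  + by rewrite /rot1; smooth_rules.
  + by rewrite /rot2; smooth_rules.
- by rewrite /rot0 /rot1 /rot2 /rota /qA /qB emb_one !rv4E; split; ring.
- move=> q /=; split; (apply: derive_eq; [rewrite /rot0 /rot1 /rot2 /qA /qB; derive_rules|]);
    by rewrite /rot0 /rot1 /rot2 /qframe /= !rv4E; field.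
- move=> q /=; split; (apply: derive_eq; [rewrite /rot0 /rot1 /rot2 /qA /qB; derive_rules|]);
    by rewrite /rot0 /rot1 /rot2 /rota /qA /qB /qframe /= !rv4E; field.
- move=> q /=; split; (apply: derive_eq; [rewrite /rot0 /rot1 /rot2 /qA /qB; derive_rules|]);
    by rewrite /rot0 /rot1 /rot2 /rota /qA /qB /qframe /= !rv4E; field.
Qed.

Let kt (z : 'rV[R]_2) := rv4 (z 0 k0) (z 0 k1) 0 0.

Let kt_linear k u w : kt (k *: u + w) = k *: kt u + kt w.
Proof. by apply: row4P; rewrite lincombE !rv4E ?lincombE; ring. Qed.

Let kt_norm (z : circle R) : qnorm e (kt (circle_emb z)) = 1.
Proof. by rewrite -[RHS](circle_norm z) /qnorm !rv4E; ring. Qed.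

Lemma hopf_dom_emb q : qA (emb q) = 2^-1 * (1 + hopf e (emb q) 0 j1).
Proof.
rewrite /hopf rv4E (_ : 1 + _ = qnorm e (emb q) + (qA (emb q) + e * qB (emb q))).
  by rewrite /qnorm /qA /qB; field.
by rewrite emb_norm.
Qed.

(** The circle is included as the quaternions a + b i. Its generator is right multiplication by i,
    while E0 is right multiplication by s i; hence the ratio 1 / s. *)
Lemma quat_fibre : fibre_group emb one (qframe e s) (fun q => hopf e (emb q))
  (@circle_emb R) (@circle_mul R) (circle_one R) (@circle_inv R) (fun a => cmul (circle_emb a))
  (@circle_frame R) (fun z => unq (kt (circle_emb z))) kt s^-1.
Proof.
have E z : emb (unq (kt (circle_emb z))) = kt (circle_emb z) by apply: unqK; exact: kt_norm.
split.
- exact: circle_framed.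
- exact: circle_connected.
- exact: linear_smooth kt_linear.
- exact: E.
- move=> z z' /(congr1 emb); rewrite !E => H; apply: circle_emb_inj.
  by apply: row2P; [move: (congr1 (fun v : 'rV[R]_4 => v 0 j0) H)|move: (congr1 (fun v : 'rV[R]_4 => v 0 j1) H)];
    rewrite !rv4E.
- move=> q; split=> [H|[z <-]]; last first.
    rewrite E emb_one; have h := circle_norm z.
    by apply: row4P; rewrite /hopf /qA /qB /qX /qY !rv4E ?h; ring.
  (* On this fibre |alpha|^2 + e |beta|^2 = 1, and the norm condition is |alpha|^2 - e |beta|^2 =
     1. *)
  have A1 : qA (emb q) = 1.
    rewrite hopf_dom_emb H emb_one /hopf rv4E /qA /qB !rv4E.
    by field.
  have B0 : qB (emb q) = 0.
    apply: (mulfI e_neq0); rewrite mulr0; have := emb_norm q; rewrite /qnorm -/(qA _) A1 => h.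
    by apply/eqP; rewrite -oppr_eq0 -(subrr 1) -{1}h; apply/eqP; rewrite /qB; ring.
  move: B0 => /eqP; rewrite /qB paddr_eq0 ?sqr_ge0 // !sqrf_eq0 => /andP[/eqP q2 /eqP q3].
  have hz : rv2 (emb q 0 j0) (emb q 0 j1) 0 k0 ^+ 2 + rv2 (emb q 0 j0) (emb q 0 j1) 0 k1 ^+ 2 == 1.
    by rewrite rv2E0 rv2E1; apply/eqP.
  exists (exist (fun v : 'rV[R]_2 => v 0 k0 ^+ 2 + v 0 k1 ^+ 2 == 1) _ hz); apply: emb_inj; rewrite E.
  by apply: row4P; rewrite /kt !rv4E ?q2 ?q3 // /circle_emb /= ?rv2E0 ?rv2E1.
- exact: invr_neq0.
- move=> z; have d := is_derive_linear (circle_emb z) (circle_frame ord0 (circle_emb z)) kt_linear.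
  refine (etrans (@derive_val _ _ _ _ _ _ _ d) _); rewrite E.
  by apply: row4P; rewrite [RHS]mxE /kt /circle_frame /qframe /= !rv4E ?rv2E0 ?rv2E1; field.
Qed.

Lemma base_den_coord v : qnorm e v = 1 -> qA v != 0 -> base_den e (hopf_coord v) = (qA v)^-1.
Proof.
move=> N1 A0; have -> : (qA v)^-1 = qnorm e v / qA v by rewrite N1 div1r.
move: A0; rewrite /base_den /hopf_coord rv2E0 rv2E1 /qX /qY /qnorm /qA => A0.
by field.
Qed.

Let qA_gt0 (v : 'rV[R]_4) : qA v != 0 -> 0 < qA v.
Proof. by rewrite lt_def => ->; rewrite /qA addr_ge0 ?sqr_ge0. Qed.

Let lift_sq z : base_dom2 e z -> (Num.sqrt (base_den e z))^-1 ^+ 2 = (base_den e z)^-1.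
Proof. by move=> zd; rewrite exprVn sqr_sqrtr //; exact: ltW. Qed.

Lemma hopf_lift_norm z : base_dom2 e z -> qnorm e (hopf_lift e z) = 1.
Proof.
move=> zd; rewrite /qnorm /hopf_lift !rv4E; set r := _^-1.
have -> : r ^+ 2 + 0 ^+ 2 - e * ((r * z 0 k0) ^+ 2 + (r * - z 0 k1) ^+ 2) = r ^+ 2 * base_den e z.
  by rewrite /base_den; ring.
by rewrite lift_sq // mulVf // lt0r_neq0.
Qed.

Lemma base_den_smooth U : open U -> smooth_on U (base_den e).
Proof. by move=> oU; rewrite /base_den; smooth_rules. Qed.

Lemma base_dom2_open : open (base_dom2 e).
Proof.
apply: (@open_comp _ _ (base_den e) [set y | 0 < y]); last exact: open_gt.
by move=> x _; exact: (smooth_continuous (base_den_smooth openT) I).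
Qed.

Lemma hopf_lift_smooth : smooth_on (base_dom2 e) (hopf_lift e).
Proof.
have oU := base_dom2_open.
have sr : smooth_on (base_dom2 e) (fun z => (Num.sqrt (base_den e z))^-1).
  apply: smoothV => //; last by apply: smooth_sqrt => //; exact: base_den_smooth.
  by move=> z zd; rewrite lt0r_neq0 // sqrtr_gt0.
apply: smooth_rowP => //; apply: forall4.
- by under eq_fun do rewrite rv4E.
- under eq_fun do rewrite rv4E.
  exact: smooth_cst.
- under eq_fun do rewrite rv4E.
  by apply: smoothM => //; exact: smooth_coord.
- under eq_fun do rewrite rv4E.
  by apply: smoothM => //; apply: smoothN => //; exact: smooth_coord.
Qed.

Lemma hopf_coord_lift z : base_dom2 e z ->
  qA (hopf_lift e z) != 0 /\ hopf_coord (hopf_lift e z) = z.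
Proof.
move=> zd; have r0 : (Num.sqrt (base_den e z))^-1 != 0.
  by rewrite invr_neq0 // lt0r_neq0 // sqrtr_gt0.
rewrite /hopf_coord /qA /qX /qY /hopf_lift !rv4E; move: r0; set r := _^-1 => r0.
have A0 : r ^+ 2 + 0 ^+ 2 != 0 by rewrite expr0n addr0 expf_neq0.
by split=> //; apply: row2P; rewrite ?rv2E0 ?rv2E1; field.
Qed.

Lemma qX_smooth U : open U -> smooth_on U (fun v : 'rV[R]_4 => qX v).
Proof. by move=> oU; rewrite /qX; smooth_rules. Qed.
Lemma qY_smooth U : open U -> smooth_on U (fun v : 'rV[R]_4 => qY v).
Proof. by move=> oU; rewrite /qY; smooth_rules. Qed.
Lemma qA_smooth U : open U -> smooth_on U (fun v : 'rV[R]_4 => qA v).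
Proof. by move=> oU; rewrite /qA; smooth_rules. Qed.
Lemma qB_smooth U : open U -> smooth_on U (fun v : 'rV[R]_4 => qB v).
Proof. by move=> oU; rewrite /qB; smooth_rules. Qed.

Lemma hopf_dom_open : open (@hopf_dom R).
Proof. by apply: (neq_open (f := fun v => qA v)); exact: qA_smooth openT. Qed.

Lemma hopf_coord_smooth : smooth_on (@hopf_dom R) (@hopf_coord R).
Proof.
have oU := hopf_dom_open.
have si : smooth_on (@hopf_dom R) (fun v => (qA v)^-1) by apply: smoothV => //; exact: qA_smooth.
apply: smooth_rowP => //; apply: forall2.
- under eq_fun do rewrite rv2E0.
  by apply: smoothM => //; exact: qX_smooth.
- under eq_fun do rewrite rv2E1.
  by apply: smoothN => //; apply: smoothM => //; exact: qY_smooth.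
Qed.

Lemma hopf_smooth : smooth_on setT (hopf e).
Proof.
have oU := @openT 'rV[R]_4.
apply: smooth_rowP => //; apply: forall4.
- under eq_fun do rewrite rv4E.
  exact: smooth_cst.
- under eq_fun do rewrite rv4E.
  by apply: smoothD => //; [exact: qA_smooth|apply: smoothM => //; [exact: smooth_cst|exact: qB_smooth]].
- under eq_fun do rewrite rv4E.
  by apply: smoothM => //; [exact: smooth_cst|exact: qY_smooth].
- under eq_fun do rewrite rv4E.
  by apply: smoothN => //; apply: smoothM => //; [exact: smooth_cst|exact: qX_smooth].
Qed.

(** In complex notation the derivatives of z along E0, E1, E2 are 0, s / alpha^2 and - i s /
    alpha^2. The last two are orthogonal of length s / |alpha|^2, which is s [base_den]: this is the
    origin of [base_metric]. *)
Lemma hopf_coord_derive v : qnorm e v = 1 -> hopf_dom v ->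
  [/\ 'D_(qframe e s i0 v) (@hopf_coord R) v = 0,
      'D_(qframe e s i1 v) (@hopf_coord R) v =
        (s / qA v ^+ 2) *: rv2 (v 0 j0 ^+ 2 - v 0 j1 ^+ 2) (- (2 * (v 0 j0 * v 0 j1))) &
      'D_(qframe e s i2 v) (@hopf_coord R) v =
        (s / qA v ^+ 2) *: rv2 (- (2 * (v 0 j0 * v 0 j1))) (- (v 0 j0 ^+ 2 - v 0 j1 ^+ 2))].
Proof.
move=> N1 Dv; have A0 : v 0 j0 ^+ 2 + v 0 j1 ^+ 2 != 0 by exact: Dv.
have D0 w : ('D_w (@hopf_coord R) v) 0 k0 = 'D_w (fun y : 'rV[R]_4 => (y 0 j2 * y 0 j0 - y 0 j3 * y 0 j1) / (y 0 j0 ^+ 2 + y 0 j1 ^+ 2)) v.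
  by rewrite (derive_mxE _ _ _ hopf_coord_smooth Dv); under eq_fun do rewrite rv2E0.
have D1 w : ('D_w (@hopf_coord R) v) 0 k1 = 'D_w (fun y : 'rV[R]_4 => - ((y 0 j1 * y 0 j2 + y 0 j0 * y 0 j3) / (y 0 j0 ^+ 2 + y 0 j1 ^+ 2))) v.
  by rewrite (derive_mxE _ _ _ hopf_coord_smooth Dv); under eq_fun do rewrite rv2E1.
split; apply: row2P; rewrite ?D0 ?D1;
  (apply: derive_eq; [derive_rules; exact: A0|]); rewrite /qframe /= !rv4E.
- by rewrite mxE; field.
- by rewrite mxE; field.
(* A factor [qnorm e v], equal to 1, is inserted to turn the claim into an identity of rational
   functions. *)
- rewrite mxE rv2E0; transitivity (s / qA v ^+ 2 * (((v 0 j0 ^+ 2 - v 0 j1 ^+ 2)) * qnorm e v)).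
    by rewrite /qA /qnorm; field.
  by rewrite N1 mulr1.
- rewrite mxE rv2E1; transitivity (s / qA v ^+ 2 * ((- (2 * (v 0 j0 * v 0 j1))) * qnorm e v)).
    by rewrite /qA /qnorm; field.
  by rewrite N1 mulr1.
- rewrite mxE rv2E0; transitivity (s / qA v ^+ 2 * ((- (2 * (v 0 j0 * v 0 j1))) * qnorm e v)).
    by rewrite /qA /qnorm; field.
  by rewrite N1 mulr1.
- rewrite mxE rv2E1; transitivity (s / qA v ^+ 2 * ((- (v 0 j0 ^+ 2 - v 0 j1 ^+ 2)) * qnorm e v)).
    by rewrite /qA /qnorm; field.
  by rewrite N1 mulr1.
Qed.

Lemma base_metric_form z u w : form (base_metric e s z) u w =
  (s ^+ 2 * base_den e z ^+ 2)^-1 * (u 0 k0 * w 0 k0 + u 0 k1 * w 0 k1).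
Proof.
rewrite /form /base_metric mul_mx_scalar -scalemxAl mxE; congr (_ * _).
rewrite mxE big_ord_recl big_ord1 !mxE.
by congr (u _ _ * w _ _ + u _ _ * w _ _); apply: val_inj.
Qed.

Lemma quat_fibration : fibration emb mul one (qframe e s) (fun q => hopf e (emb q))
  (@hopf_dom R) (@hopf_coord R) (base_dom2 e) (fun z => unq (hopf_lift e z)) (base_metric e s).
Proof.
have sigE z : base_dom2 e z -> emb (unq (hopf_lift e z)) = hopf_lift e z.
  by move=> zd; apply: unqK; exact: hopf_lift_norm.
have oU := base_dom2_open.
split.
- move=> q p; apply: (initial_cont quat_framed).
  rewrite (_ : emb \o mul^~ q = (fun v => qmul e v (emb q)) \o emb); last first.
    by apply/funext => p'; exact: emb_mul.
  apply: continuous_comp; first exact: emb_cont.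
  exact: (smooth_continuous (linear_smooth (qmul_linearl e (emb q))) I).
- move=> q; apply: continuous_comp; first exact: emb_cont.
  exact: (smooth_continuous hopf_smooth I).
- by move=> p q q' H; rewrite !emb_mul !hopf_left H.
- exact: hopf_dom_open.
- by rewrite /hopf_dom /= emb_one /qA !rv4E expr0n addr0 expr1n oner_neq0.
- by move=> q q' H; rewrite /hopf_dom /= !hopf_dom_emb H.
- exact: hopf_coord_smooth.
- move=> q q' Oq Oq'; split=> [H|H].
    (* The coordinate z determines |alpha|^2, by [base_den_coord], hence also alpha beta and, with
       the norm, e |beta|^2. *)
    have AE : qA (emb q) = qA (emb q').
      by apply: invr_inj; rewrite -!base_den_coord ?H.
    have XE : qX (emb q) = qX (emb q').
      have := congr1 (fun z : 'rV[R]_2 => z 0 k0) H; rewrite !rv2E0 AE.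
      by move=> /(mulIf (invr_neq0 Oq')).
    have YE : qY (emb q) = qY (emb q').
      have := congr1 (fun z : 'rV[R]_2 => z 0 k1) H; rewrite !rv2E1 AE => /oppr_inj.
      by move=> /(mulIf (invr_neq0 Oq')).
    have BE : e * qB (emb q) = e * qB (emb q').
      have h1 := emb_norm q; have h2 := emb_norm q'; rewrite /qnorm -/(qA _) -/(qB _) AE in h1.
      rewrite /qnorm -/(qA _) -/(qB _) in h2.
      by apply: oppr_inj; apply: (addrI (qA (emb q'))); rewrite h1 h2.
    by rewrite /hopf AE XE YE BE.
  have AE : qA (emb q) = qA (emb q') by rewrite !hopf_dom_emb H.
  have two : 2 != 0 :> R by rewrite pnatr_eq0.
  have YE : qY (emb q) = qY (emb q').
    by have := congr1 (fun v : 'rV[R]_4 => v 0 j2) H; rewrite !rv4E => /(mulfI two).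
  have XE : qX (emb q) = qX (emb q').
    by have := congr1 (fun v : 'rV[R]_4 => v 0 j3) H; rewrite !rv4E => /oppr_inj/(mulfI two).
  by rewrite /hopf_coord AE XE YE.
- exact: oU.
- by move=> q Oq; rewrite /base_dom2 /= base_den_coord // invr_gt0 qA_gt0.
- by apply: (smooth_eq oU _ hopf_lift_smooth) => z zd; rewrite /= sigE.
- by move=> z zd; rewrite sigE //; exact: hopf_coord_lift.
- by move=> q Oq; have [] := hopf_coord_derive (emb_norm q) Oq.
- have sd : smooth_on (base_dom2 e) (fun z => (s ^+ 2 * base_den e z ^+ 2)^-1).
    apply: smoothV => //.
      by move=> z zd; rewrite mulf_neq0 // expf_neq0 // lt0r_neq0.
    apply: smoothM => //; first exact: smooth_cst.
    by apply: smoothX => //; exact: base_den_smooth.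
  apply/smooth_mxP => // i j; under eq_fun do rewrite /base_metric mxE.
  case: (i == j); first exact: sd.
  by under eq_fun do rewrite mulr0n; exact: smooth_cst.
- by move=> z _; rewrite /base_metric tr_scalar_mx.
- move=> q Oq; have [_ D1 D2] := hopf_coord_derive (emb_norm q) Oq.
  rewrite /= D1 D2 !base_metric_form base_den_coord //; move: Oq; rewrite /hopf_dom /=.
  have scE (x : R) (u : 'rV[R]_2) i : (x *: u) 0 i = x * u 0 i by rewrite mxE.
  rewrite !scE !rv2E0 !rv2E1 /qA => A0.
  by split; field; rewrite ?s_neq0 ?A0.
Qed.

End QuaternionGroup.

(** * From quaternions in R^4 to a group of matrices *)

Section Wrapper.
Context {R : realType} (e s lam : R).
Hypotheses (e_neq0 : e != 0) (s_neq0 : s != 0) (lam_gt0 : 0 < lam) (e_lam : 1 + lam * e != 0).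
Context {T : topologicalType} {V : normedModType R} {embV : T -> V}.
Context {mul : T -> T -> T} {one : T} {unq : 'rV[R]_4 -> T}.
Variables (L : V -> 'rV[R]_4) (J : 'rV[R]_4 -> V).
Let emb p := L (embV p).
Hypotheses (LL : forall k u w, L (k *: u + w) = k *: L u + L w) (cL : continuous L).
Hypotheses (JL : forall k u w, J (k *: u + w) = k *: J u + J w) (cJ : continuous J).
Hypothesis (embJ : forall p, embV p = J (emb p)).
Hypotheses (embV_inj : injective embV) (embV_cont : continuous embV).
Hypothesis embV_nbhs : forall p A, nbhs p A -> exists2 B, nbhs (embV p) B & embV @^-1` B `<=` A.
Hypothesis emb_norm : forall p, qnorm e (emb p) = 1.
Hypothesis emb_mul : forall p q, emb (mul p q) = qmul e (emb p) (emb q).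
Hypothesis emb_one : emb one = rv4 1 0 0 0.
Hypothesis unqK : forall v, qnorm e v = 1 -> emb (unq v) = v.
Let G := @EmbeddedGroup R T V embV mul one.
Variables (g : metric R T 3) (X : 'I_3 -> V) (D : 'M[R]_3) (sg : 'I_3 -> 'I_3).
Hypothesis frameX : forall i, J (qframe e s i (rv4 1 0 0 0)) = X (sg i).
Hypothesis sgD : forall i j, D (sg i) (sg j) = diag3 lam 1 1 i j.

Theorem quaternion_leaf_space : @left_invariant_metric R G 3 g ->
  @represented_at_one R G 3 g X D -> leaf_space_has_invariant_metric (eg_atlas G 3) g.
Proof.
move=> [metric_g left_g] rep.
have emb_inj : injective emb by move=> p q E; apply: embV_inj; rewrite !embJ E.
have emb_cont : continuous emb.
  by move=> p; apply: continuous_comp; [exact: embV_cont|exact: cL].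
have emb_nbhs p A : nbhs p A -> exists2 B, nbhs (emb p) B & emb @^-1` B `<=` A.
  move=> /embV_nbhs[B Bp BA]; exists (J @^-1` B); first by apply: cJ; rewrite -embJ.
  by move=> q; rewrite /= -embJ; exact: BA.
have AE : eg_atlas G 3 = eg_atlas (@EmbeddedGroup R T 'rV[R]_4 emb mul one) 3.
  apply/seteqP; split.
    exact: (@eg_atlas_sub R T V _ embV emb mul mul one one 3 L J LL cL JL cJ (fun p => erefl) embJ).
  exact: (@eg_atlas_sub R T _ V emb embV mul mul one one 3 J L JL cJ LL cL embJ (fun p => erefl)).
have fg := quat_framed s_neq0 emb_inj emb_cont emb_nbhs emb_norm emb_mul emb_one unqK.
have g1 := represented_frame fg AE JL cJ embJ _ rep.
rewrite AE in metric_g left_g *.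
have fi := quat_fibration s_neq0 emb_inj emb_cont emb_nbhs emb_norm emb_mul emb_one unqK.
have fk := quat_fibre e_neq0 s_neq0 emb_inj emb_norm emb_one unqK.
have fb := @quat_brackets R e s T emb.
have rf := @quat_rotation R e s s_neq0 T emb one emb_one.
apply: (leaf_space_metric fg fi fk fb rf lam_gt0 _ _ metric_g).
- by rewrite oppr_eq0 !mulf_neq0 // pnatr_eq0.
(* Here b = - 2 e s and c = 2 s, so the condition [c != lam b] becomes [e_lam]. *)
- rewrite -subr_eq0 (_ : _ - _ = 2 * s * (1 + lam * e)); last by ring.
  by rewrite !mulf_neq0 // pnatr_eq0.
- by move=> a; have [_ ?] := left_g a.
- move=> ch Ac c1 i j; rewrite -sgD; apply: g1 => // k.
  by rewrite emb_one.
Qed.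

End Wrapper.

(** * SL(2, R) *)

Lemma mx2E (T : Type) (a b c d : T) : (mx2 a b c d k0 k0 = a) * (mx2 a b c d k0 k1 = b) *
  (mx2 a b c d k1 k0 = c) * (mx2 a b c d k1 k1 = d).
Proof. by rewrite !mxE. Qed.

Lemma mat2P (T : Type) (A B : 'M[T]_2) : A k0 k0 = B k0 k0 -> A k0 k1 = B k0 k1 ->
  A k1 k0 = B k1 k0 -> A k1 k1 = B k1 k1 -> A = B.
Proof. by move=> h00 h01 h10 h11; apply/matrixP; apply: forall2; apply: forall2. Qed.

Lemma mulmx2E (S : pzSemiRingType) m n (A : 'M[S]_(m, 2)) (B : 'M[S]_(2, n)) i j :
  (A *m B) i j = A i k0 * B k0 j + A i k1 * B k1 j.
Proof.
rewrite mxE big_ord_recl big_ord1.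
by congr (A _ _ * B _ _ + A _ _ * B _ _); apply: val_inj.
Qed.

Lemma det2E (S : comPzRingType) (A : 'M[S]_2) : \det A = A k0 k0 * A k1 k1 - A k0 k1 * A k1 k0.
Proof.
rewrite (expand_det_row _ k0) big_ord_recl big_ord1 /cofactor !det_mx11 !mxE /= expr0 expr1 mul1r mulN1r mulrN.
by congr (A _ _ * A _ _ - A _ _ * A _ _); apply: val_inj.
Qed.

Lemma scalar2E (S : pzSemiRingType) : 1%:M = mx2 1 0 0 1 :> 'M[S]_2.
Proof. by apply: mat2P; rewrite !mxE. Qed.

Lemma linear_continuous_mx (R : realType) n p q (f : 'rV[R]_n -> 'M[R]_(p, q)) :
  (forall i j, smooth_on setT (fun v => f v i j)) -> continuous f.
Proof.
by move=> H x; apply: (smooth_continuous (U := setT)) => //; apply/smooth_mxP => //; exact: openT.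
Qed.

Lemma rv4_continuous (R : realType) (V : normedModType R) (a b c d : V -> R) :
  continuous a -> continuous b -> continuous c -> continuous d ->
  continuous (fun x => rv4 (a x) (b x) (c x) (d x)).
Proof.
move=> ca cb cc cd.
have H (f : V -> R) : continuous f -> Ck 0 setT f by move=> cf; split=> // x _; exact: cf.
have s : Ck 0 setT (fun x => rv4 (a x) (b x) (c x) (d x)).
  apply/Ck_mxP; first exact: openT.
  move=> i; rewrite (ord1 i); apply: forall4.
  - by apply: (Ck_eq openT _ (H _ ca)) => y _; rewrite rv4E.
  - by apply: (Ck_eq openT _ (H _ cb)) => y _; rewrite rv4E.
  - by apply: (Ck_eq openT _ (H _ cc)) => y _; rewrite rv4E.
  - by apply: (Ck_eq openT _ (H _ cd)) => y _; rewrite rv4E.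
by move=> x; have [h _] := s; exact: (h x I).
Qed.

Section SL2Instance.
Variable R : realType.

(** The split quaternions as real matrices; i, j, k go to the three vectors of [sl2_basis], whence s
    = 1. *)
Definition sl2_of (v : 'rV[R]_4) : 'M[R]_2 :=
  mx2 (v 0 j0 + v 0 j3) (v 0 j1 + v 0 j2) (v 0 j2 - v 0 j1) (v 0 j0 - v 0 j3).
Definition of_sl2 (A : 'M[R]_2) : 'rV[R]_4 :=
  rv4 ((A k0 k0 + A k1 k1) / 2) ((A k0 k1 - A k1 k0) / 2)
      ((A k0 k1 + A k1 k0) / 2) ((A k0 k0 - A k1 k1) / 2).

Lemma of_sl2K A : sl2_of (of_sl2 A) = A.
Proof. by apply: mat2P; rewrite /sl2_of /of_sl2 !mx2E !rv4E; field. Qed.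

Lemma sl2_ofK v : of_sl2 (sl2_of v) = v.
Proof. by apply: row4P; rewrite /sl2_of /of_sl2 !mx2E !rv4E; field. Qed.

Lemma sl2_of_mul u v : sl2_of u *m sl2_of v = sl2_of (qmul 1 u v).
Proof. by apply: mat2P; rewrite mulmx2E /sl2_of !mx2E /qmul !rv4E; ring. Qed.

Lemma sl2_of_det v : \det (sl2_of v) = qnorm 1 v.
Proof. by rewrite det2E /sl2_of !mx2E /qnorm; ring. Qed.

Theorem SL2_leaf_space (lam : R) (g : metric R (SL2 R) 3) : 0 < lam ->
  left_invariant_metric g -> represented_at_one g (@sl2_basis R) (diag3 lam 1 1) ->
  leaf_space_has_invariant_metric (eg_atlas (SL2 R) 3) g.
Proof.
move=> lam0; have lcE (k : R) (A B : 'M[R]_2) i j : (k *: A + B) i j = k * A i j + B i j by rewrite !mxE.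
(* The inverse of the embedding takes the identity as default value on vectors of norm different
   from 1. *)
apply: (@quaternion_leaf_space R 1 1 lam (oner_neq0 _) (oner_neq0 _) lam0 _ (SL2 R) _ _ _ _
  (fun v => insubd (@eg_one R (SL2 R)) (sl2_of v)) of_sl2 sl2_of _ _ _ _ _ _ _ _ _ _ _ _ g
  (@sl2_basis R) (diag3 lam 1 1) id).
- by rewrite mulr1 lt0r_neq0 // addr_gt0.
- by move=> k u w; apply: row4P; rewrite lincombE /of_sl2 !rv4E !lcE; field.
- have cE i j : continuous (fun A : 'M[R]_2 => A i j) by exact: coord_continuous.
  by apply: rv4_continuous => A; [exact: (cvgM (cvgD (cE _ _ A) (cE _ _ A)) (cvg_cst _))|
    exact: (cvgM (cvgB (cE _ _ A) (cE _ _ A)) (cvg_cst _))|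
    exact: (cvgM (cvgD (cE _ _ A) (cE _ _ A)) (cvg_cst _))|
    exact: (cvgM (cvgB (cE _ _ A) (cE _ _ A)) (cvg_cst _))].
- by move=> k u w; apply: mat2P; rewrite lcE /sl2_of !mx2E !lincombE; ring.
- apply: linear_continuous_mx; apply: forall2; apply: forall2; under eq_fun do rewrite mx2E; smooth_rules.
- by move=> p; rewrite of_sl2K.
- exact: val_inj.
- exact: initial_continuous.
- exact: initial_nbhs.
- by move=> p; rewrite -sl2_of_det of_sl2K; apply/eqP; exact: (valP (p : SL2_type R)).
- by move=> p q; rewrite -[RHS]sl2_ofK -sl2_of_mul !of_sl2K.
- by rewrite -[RHS]sl2_ofK; congr of_sl2; rewrite /= scalar2E; apply: mat2P; rewrite /sl2_of !mx2E !rv4E; ring.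
- move=> v nv; rewrite -[RHS]sl2_ofK; congr of_sl2.
  by rewrite /= val_insubd sl2_of_det nv eqxx.
- apply: forall3; rewrite /sl2_basis /=; apply: mat2P; rewrite /sl2_of /qframe /= !mx2E !rv4E; ring.
- by [].
Qed.

End SL2Instance.

(** * SU(2) *)

Section SU2Instance.
Local Open Scope sesquilinear_scope.
Variable R : realType.
Implicit Types v u : 'rV[R]_4.

Lemma complexME (a b c d : R) : Complex a b * Complex c d = Complex (a * c - b * d) (a * d + b * c).
Proof. by []. Qed.
Lemma complexDE (a b c d : R) : Complex a b + Complex c d = Complex (a + c) (b + d).
Proof. by []. Qed.
Lemma complexNE (a b : R) : - Complex a b = Complex (- a) (- b).
Proof. by []. Qed.
Lemma complex1E : 1 = Complex (1 : R) 0. Proof. by []. Qed.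
Lemma complex0E : 0 = Complex (0 : R) 0. Proof. by []. Qed.

(** The quaternions as complex matrices; i, j, k go to twice the vectors of [su2_basis], whence s =
    1/2. *)
Definition su2_of v : 'M[R[i]]_2 := mx2
  (Complex (v 0 j0) (v 0 j1)) (Complex (- v 0 j2) (- v 0 j3))
  (Complex (v 0 j2) (- v 0 j3)) (Complex (v 0 j0) (- v 0 j1)).

Definition of_re_im (A : 'M[R]_2 * 'M[R]_2) : 'rV[R]_4 :=
  rv4 (A.1 k0 k0) (A.2 k0 k0) (A.1 k1 k0) (- A.2 k1 k0).

Lemma re_imE (A : 'M[R[i]]_2) i j :
  ((re_im A).1 i j = complex.Re (A i j)) * ((re_im A).2 i j = complex.Im (A i j)).
Proof. by rewrite !mxE. Qed.

Lemma su2_ofK v : of_re_im (re_im (su2_of v)) = v.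
Proof. by apply: row4P; rewrite /of_re_im rv4E !re_imE /su2_of mx2E //= opprK. Qed.

Lemma su2_of_mul u v : su2_of u *m su2_of v = su2_of (qmul (- 1) u v).
Proof.
by apply: mat2P; rewrite mulmx2E /su2_of !mx2E !complexME complexDE /qmul !rv4E;
  congr Complex; ring.
Qed.

Lemma su2_of_det v : \det (su2_of v) = Complex (qnorm (- 1) v) 0.
Proof.
rewrite det2E /su2_of !mx2E !complexME complexNE complexDE /qnorm.
by congr Complex; ring.
Qed.

Lemma adjointE (A : 'M[R[i]]_2) i j : (A ^t*) i j = conjc (A j i).
Proof. by rewrite !mxE. Qed.

Lemma su2_of_adjoint v : (su2_of v) ^t* = su2_of (qconj v).
Proof. by apply: mat2P; rewrite adjointE /su2_of !mx2E /qconj !rv4E /= ?opprK. Qed.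

Lemma su2_of_one : su2_of (rv4 1 0 0 0) = 1%:M.
Proof.
by rewrite scalar2E; apply: mat2P; rewrite /su2_of !mx2E !rv4E ?oppr0.
Qed.

Lemma su2_of_SU2 v : qnorm (- 1) v = 1 ->
  (su2_of v \is unitarymx) && (\det (su2_of v) == 1).
Proof.
move=> nv; rewrite su2_of_det nv eqxx andbT; apply/unitarymxP.
rewrite su2_of_adjoint su2_of_mul -su2_of_one; congr su2_of.
by apply: row4P; rewrite /qmul /qconj !rv4E; [rewrite -[RHS]nv /qnorm| | |]; ring.
Qed.

(** For determinant 1 the adjugate is the inverse, and for a unitary matrix so is the adjoint;
    comparing their entries gives the quaternionic shape. *)
Lemma SU2_su2_of (p : SU2_type R) : val p = su2_of (of_re_im (re_im (val p))).
Proof.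
have /andP[/unitarymxP AU /eqP dA] := valP p; move: (val p) AU dA => A AU dA.
pose B := mx2 (A k1 k1) (- A k0 k1) (- A k1 k0) (A k0 k0).
have BA : B *m A = 1%:M.
  rewrite scalar2E; apply: mat2P; rewrite mulmx2E /B !mx2E; [rewrite -[RHS]dA det2E| | |rewrite -[RHS]dA det2E]; ring.
have AB : A ^t* = B by rewrite -[RHS]mulmx1 -AU mulmxA BA mul1mx.
have e00 := congr1 (fun M : 'M[R[i]]_2 => M k0 k0) AB.
have e10 := congr1 (fun M : 'M[R[i]]_2 => M k1 k0) AB.
rewrite /= adjointE /B mx2E in e00; rewrite /= adjointE /B mx2E in e10.
have e10' : A k1 k0 = - conjc (A k0 k1) by rewrite e10 opprK.
apply: mat2P; rewrite /su2_of /of_re_im !mx2E !rv4E !re_imE -?e00 ?e10'.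
- by case: (A k0 k0).
- by case: (A k0 k1) => a b /=; rewrite ?opprK.
- by case: (A k0 k1) => a b /=; rewrite complexNE !opprK.
- by case: (A k0 k0).
Qed.

Lemma re_im_inj : injective (@re_im R).
Proof.
move=> A B H; apply/matrixP => i j.
have h1 := congr1 (fun z : 'M[R]_2 * 'M[R]_2 => z.1 i j) H.
have h2 := congr1 (fun z : 'M[R]_2 * 'M[R]_2 => z.2 i j) H.
rewrite !mxE in h1; rewrite !mxE in h2.
by apply/eqP; rewrite eq_complex h1 h2 !eqxx.
Qed.

Lemma of_re_im_linear k (u w : 'M[R]_2 * 'M[R]_2) :
  of_re_im (k *: u + w) = k *: of_re_im u + of_re_im w.
Proof.
by apply: row4P; rewrite lincombE /of_re_im !rv4E !mxE; ring.
Qed.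

Lemma of_re_im_continuous : continuous of_re_im.
Proof.
have cE i j : continuous (fun A : 'M[R]_2 => A i j) by exact: coord_continuous.
have c1 i j : continuous (fun z : 'M[R]_2 * 'M[R]_2 => z.1 i j).
  have cp : continuous (@fst 'M[R]_2 'M[R]_2) by move=> z; exact: cvg_fst.
  by move=> z; exact: (@continuous_comp _ _ _ fst (fun A : 'M[R]_2 => A i j) z (cp z) (cE i j _)).
have c2 i j : continuous (fun z : 'M[R]_2 * 'M[R]_2 => z.2 i j).
  have cp : continuous (@snd 'M[R]_2 'M[R]_2) by move=> z; exact: cvg_snd.
  by move=> z; exact: (@continuous_comp _ _ _ snd (fun A : 'M[R]_2 => A i j) z (cp z) (cE i j _)).
apply: rv4_continuous; [exact: c1|exact: c2|exact: c1|].
by move=> z; exact: (cvgN (c2 _ _ z)).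
Qed.

Lemma re_im_su2_of v : re_im (su2_of v) =
  (mx2 (v 0 j0) (- v 0 j2) (v 0 j2) (v 0 j0), mx2 (v 0 j1) (- v 0 j3) (- v 0 j3) (- v 0 j1)).
Proof. by congr pair; apply: mat2P; rewrite mxE /su2_of !mx2E. Qed.

Lemma re_im_su2_linear k u v : re_im (su2_of (k *: u + v)) = k *: re_im (su2_of u) + re_im (su2_of v).
Proof.
have lcE (A B : 'M[R]_2) i j : (k *: A + B) i j = k * A i j + B i j by rewrite !mxE.
rewrite !re_im_su2_of; congr pair; apply: mat2P; rewrite /= lcE !mx2E !lincombE; ring.
Qed.

Lemma re_im_su2_continuous : continuous (fun v => re_im (su2_of v)).
Proof.
have cm (f : 'rV[R]_4 -> 'M[R]_2) := @linear_continuous_mx R 4 2 2 f.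
have -> : (fun v => re_im (su2_of v)) = (fun v : 'rV[R]_4 =>
    (mx2 (v 0 j0) (- v 0 j2) (v 0 j2) (v 0 j0), mx2 (v 0 j1) (- v 0 j3) (- v 0 j3) (- v 0 j1))).
  by apply/funext => v; exact: re_im_su2_of.
have c1 : continuous (fun v : 'rV[R]_4 => mx2 (v 0 j0) (- v 0 j2) (v 0 j2) (v 0 j0)).
  by apply: cm; apply: forall2; apply: forall2; under eq_fun do rewrite mx2E; smooth_rules.
have c2 : continuous (fun v : 'rV[R]_4 => mx2 (v 0 j1) (- v 0 j3) (- v 0 j3) (- v 0 j1)).
  by apply: cm; apply: forall2; apply: forall2; under eq_fun do rewrite mx2E; smooth_rules.
by move=> v; exact: (cvg_pair (c1 v) (c2 v)).
Qed.

Section Rotated.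
(** An automorphism of the quaternions, put between the group and R^4, lets any vector of the basis
    play the role of E0. *)
Variables rho rhoI : 'rV[R]_4 -> 'rV[R]_4.
Hypotheses (rhoK : cancel rho rhoI) (rhoIK : cancel rhoI rho).
Hypotheses (rho_linear : forall k u w, rho (k *: u + w) = k *: rho u + rho w)
  (rhoI_linear : forall k u w, rhoI (k *: u + w) = k *: rhoI u + rhoI w).
Hypotheses (rho_norm : forall v, qnorm (- 1) (rho v) = qnorm (- 1) v)
  (rho_mul : forall u v, rho (qmul (- 1) u v) = qmul (- 1) (rho u) (rho v))
  (rho_one : rho (rv4 1 0 0 0) = rv4 1 0 0 0).

Lemma SU2_leaf_space_rotated (lam : R) (g : metric R (SU2 R) 3) (D : 'M[R]_3) (sg : 'I_3 -> 'I_3) :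
  0 < lam -> lam != 1 ->
  (forall i, re_im (su2_of (rhoI (qframe (- 1) 2^-1 i (rv4 1 0 0 0)))) = @su2_basis R (sg i)) ->
  (forall i j, D (sg i) (sg j) = diag3 lam 1 1 i j) ->
  left_invariant_metric g -> represented_at_one g (@su2_basis R) D ->
  leaf_space_has_invariant_metric (eg_atlas (SU2 R) 3) g.
Proof.
move=> lam0 lam1 HX HD.
have e0 : -1 != 0 :> R by rewrite oppr_eq0 oner_neq0.
have s0 : 2^-1 != 0 :> R by rewrite invr_neq0 // pnatr_eq0.
have el : 1 + lam * -1 != 0 by rewrite mulrN1 subr_eq0 eq_sym.
have vE (p : SU2 R) : re_im (val (p : SU2_type R)) = re_im (su2_of (of_re_im (re_im (val (p : SU2_type R))))).
  by rewrite -SU2_su2_of.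
apply: (@quaternion_leaf_space R (- 1) 2^-1 lam e0 s0 lam0 el (SU2 R) _ _ _ _
  (fun v => insubd (@eg_one R (SU2 R)) (su2_of (rhoI v))) (rho \o of_re_im)
  (fun v => re_im (su2_of (rhoI v))) _ _ _ _ _ _ _ _ _ _ _ _ g (@su2_basis R) D sg HX HD).
- by move=> k u w; rewrite /= of_re_im_linear rho_linear.
- move=> z; apply: continuous_comp; first exact: of_re_im_continuous.
  exact: (smooth_continuous (linear_smooth rho_linear) I).
- by move=> k u w; rewrite rhoI_linear re_im_su2_linear.
- move=> v; have c := smooth_continuous (linear_smooth rhoI_linear) (I : setT v).
  exact: (@continuous_comp _ _ _ rhoI (fun v => re_im (su2_of v)) v c (@re_im_su2_continuous _)).
- by move=> p; rewrite /= rhoK; exact: vE.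
- by move=> p q /= /re_im_inj/val_inj.
- exact: initial_continuous.
- exact: initial_nbhs.
- move=> p; rewrite /= rho_norm.
  have /andP[_ /eqP] := valP (p : SU2_type R); rewrite SU2_su2_of su2_of_det.
  by move=> /(congr1 (@complex.Re R)).
- move=> p q; rewrite /= -rho_mul -[in RHS](su2_ofK (qmul _ _ _)) -su2_of_mul.
  by rewrite -!SU2_su2_of.
- by rewrite /= -su2_of_one su2_ofK rho_one.
- move=> v nv; have nv' : qnorm (- 1) (rhoI v) = 1 by rewrite -rho_norm rhoIK.
  have vi : val (insubd (@eg_one R (SU2 R) : SU2_type R) (su2_of (rhoI v))) = su2_of (rhoI v).
    exact: (insubdK (@eg_one R (SU2 R) : SU2_type R) (su2_of_SU2 nv')).
  refine (etrans (congr1 (fun A => rho (of_re_im (re_im A))) vi) _).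
  by rewrite su2_ofK rhoIK.
Qed.

End Rotated.

Let half : 2^-1 = Complex (2^-1 : R) 0.
Proof.
have two : 2 != 0 :> R by rewrite pnatr_eq0.
have h : 2 * Complex (2^-1 : R) 0 = 1.
  rewrite -[2]/(Complex (1 : R) 0 + Complex (1 : R) 0) complexDE complexME complex1E.
  by congr Complex; field.
have two' : 2 != 0 :> R[i] by apply/eqP => z; move: h; rewrite z mul0r => /esym/eqP; rewrite oner_eq0.
by apply: (mulfI two'); rewrite h mulfV.
Qed.

Lemma su2_basis_of i : @su2_basis R i = re_im (su2_of (qframe (- 1) 2^-1 i (rv4 1 0 0 0))).
Proof.
rewrite /su2_basis half; congr re_im; move: i; apply: forall3; apply: mat2P;
  rewrite /= [LHS]mxE /su2_of !mx2E /qframe /= !rv4E -?complexiE ?complexNE ?complex1E ?complex0E;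
  rewrite ?complexNE complexME; congr Complex; ring.
Qed.

Theorem SU2_leaf_space_lambda (lam : R) (g : metric R (SU2 R) 3) : 1 < lam ->
  left_invariant_metric g -> represented_at_one g (@su2_basis R) (diag3 lam 1 1) ->
  leaf_space_has_invariant_metric (eg_atlas (SU2 R) 3) g.
Proof.
move=> lam1; apply: (@SU2_leaf_space_rotated id id _ _ _ _ _ _ _ lam g (diag3 lam 1 1) id) => //.
- exact: lt_trans ltr01 lam1.
- by rewrite gt_eqF.
- by move=> i; rewrite su2_basis_of.
Qed.

(** Cyclic permutations of i, j, k; [rhoI] sends i to k, so that E0 becomes X3, the direction of
    squared length [nu]. *)
Let rho v := rv4 (v 0 j0) (v 0 j3) (v 0 j1) (v 0 j2).
Let rhoI v := rv4 (v 0 j0) (v 0 j2) (v 0 j3) (v 0 j1).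
Let sg (i : 'I_3) : 'I_3 := match i : nat with 0 => i2 | 1 => i0 | _ => i1 end.

Theorem SU2_leaf_space_nu (nu : R) (g : metric R (SU2 R) 3) : 0 < nu < 1 ->
  left_invariant_metric g -> represented_at_one g (@su2_basis R) (diag3 1 1 nu) ->
  leaf_space_has_invariant_metric (eg_atlas (SU2 R) 3) g.
Proof.
move=> /andP[nu0 nu1]; apply: (@SU2_leaf_space_rotated rho rhoI _ _ _ _ _ _ _ nu g (diag3 1 1 nu) sg) => //.
- by move=> v; apply: row4P; rewrite /rho /rhoI !rv4E.
- by move=> v; apply: row4P; rewrite /rho /rhoI !rv4E.
- by move=> k u w; apply: row4P; rewrite lincombE /rho !rv4E lincombE.
- by move=> k u w; apply: row4P; rewrite lincombE /rhoI !rv4E lincombE.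
- by move=> v; rewrite /qnorm /rho !rv4E; ring.
- by move=> u v; apply: row4P; rewrite /qmul /rho !rv4E; ring.
- by apply: row4P; rewrite /rho !rv4E.
- by rewrite lt_eqF.
- move=> i; rewrite su2_basis_of; congr (re_im (su2_of _)).
  by move: i; apply: forall3; apply: row4P; rewrite /rhoI /sg /qframe /= !rv4E; ring.
- by apply: forall3; apply: forall3; rewrite !mxE.
Qed.

End SU2Instance.

(** * The Heisenberg group *)

(** Orthogonalization that starts with the central direction, which will be E0 and is not
    normalized, and goes on with two orthonormal vectors. The nonzero minor says that these are
    independent modulo the centre, so that their bracket does not vanish. *)
Lemma gram_schmidt3 (R : realType) (G : 'M[R]_3) : G^T = G ->
  (forall v, v != 0 -> 0 < form G v v) ->
  exists (lam : R) (u w : 'rV[R]_3), [/\ 0 < lam, u 0 i0 * w 0 i1 - u 0 i1 * w 0 i0 != 0,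
    form G (delta_mx 0 i2) (delta_mx 0 i2) = lam,
    form G u (delta_mx 0 i2) = 0 /\ form G w (delta_mx 0 i2) = 0 &
    [/\ form G u u = 1, form G w u = 0 & form G w w = 1]].
Proof.
move=> sG pG; pose ez : 'rV[R]_3 := delta_mx 0 i2.
pose lam := form G ez ez.
have nz (v : 'rV[R]_3) i : v 0 i != 0 -> v != 0 by apply: contraNN => /eqP ->; rewrite mxE.
have lam0 : 0 < lam by apply: pG; apply: (@nz _ i2); rewrite mxE eqxx oner_neq0.
have lamN := lt0r_neq0 lam0.
pose u1 : 'rV[R]_3 := delta_mx 0 i0 - (form G (delta_mx 0 i0) ez / lam) *: ez.
have u1z : form G u1 ez = 0 by rewrite formDl formNl formZl -/lam divfK // subrr.
have u10 : u1 0 i0 = 1 by rewrite !mxE /= mulr0 subr0.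
have u11 : u1 0 i1 = 0 by rewrite !mxE /= mulr0 subr0.
have n1 : 0 < form G u1 u1 by apply: pG; apply: (@nz _ i0); rewrite u10 oner_neq0.
pose r1 := (Num.sqrt (form G u1 u1))^-1.
have r10 : r1 != 0 by rewrite invr_neq0 // lt0r_neq0 // sqrtr_gt0.
have r1s : r1 ^+ 2 * form G u1 u1 = 1.
  by rewrite exprVn sqr_sqrtr ?ltW // mulVf // lt0r_neq0.
pose u := r1 *: u1.
have uu : form G u u = 1 by rewrite formZl formZr mulrA -expr2.
have uz : form G u ez = 0 by rewrite formZl u1z mulr0.
have scE (x : R) (v : 'rV[R]_3) i : (x *: v) 0 i = x * v 0 i by rewrite mxE.
have u0E : u 0 i0 = r1 by rewrite scE u10 mulr1.
have u1E : u 0 i1 = 0 by rewrite scE u11 mulr0.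
clearbody u; have zu : form G ez u = 0 by rewrite form_sym.
pose w1 : 'rV[R]_3 := delta_mx 0 i1 - (form G (delta_mx 0 i1) ez / lam) *: ez -
  form G (delta_mx 0 i1) u *: u.
have w1z : form G w1 ez = 0.
  by rewrite !formDl !formNl !formZl uz mulr0 subr0 -/lam divfK // subrr.
have w1u : form G w1 u = 0.
  by rewrite !formDl !formNl !formZl zu uu mulr0 mulr1 subr0 subrr.
have w11 : w1 0 i1 = 1.
  have BE (x y : 'rV[R]_3) i : (x - y) 0 i = x 0 i - y 0 i by rewrite !mxE.
  by rewrite !BE !scE u1E mulr0 subr0 !mxE /= mulr0 subr0.
clearbody w1; have n2 : 0 < form G w1 w1 by apply: pG; apply: (@nz _ i1); rewrite w11 oner_neq0.
pose r2 := (Num.sqrt (form G w1 w1))^-1.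
have r20 : r2 != 0 by rewrite invr_neq0 // lt0r_neq0 // sqrtr_gt0.
have r2s : r2 ^+ 2 * form G w1 w1 = 1.
  by rewrite exprVn sqr_sqrtr ?ltW // mulVf // lt0r_neq0.
exists lam, u, (r2 *: w1); split=> //.
- by rewrite scE w11 mulr1 u1E mul0r subr0 u0E mulf_neq0.
- by rewrite formZl w1z mulr0.
- by rewrite formZl w1u mulr0 formZl formZr mulrA -expr2.
Qed.

Section Heisenberg.
Context {R : realType}.
Implicit Types v p q : 'rV[R]_3.

Definition rv3 (a b c : R) : 'rV[R]_3 := \row_i [:: a; b; c]`_i.

Lemma rv3E a b c : (rv3 a b c 0 i0 = a) * (rv3 a b c 0 i1 = b) * (rv3 a b c 0 i2 = c).
Proof. by rewrite !mxE. Qed.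

Lemma heis_mulE p q : heis_mul p q = rv3 (p 0 i0 + q 0 i0) (p 0 i1 + q 0 i1)
  (p 0 i2 + q 0 i2 + 2^-1 * (p 0 i0 * q 0 i1 - p 0 i1 * q 0 i0)).
Proof.
apply: row3P; rewrite rv3E mxE /=.
- by congr (p _ _ + q _ _); exact: val_inj.
- by congr (p _ _ + q _ _); exact: val_inj.
- by congr (p _ _ + q _ _ + _ * (p _ _ * q _ _ - p _ _ * q _ _)); exact: val_inj.
Qed.

(* the left-invariant vector field with value [x] at the identity *)
Definition heis_field (x v : 'rV[R]_3) : 'rV[R]_3 :=
  rv3 (x 0 i0) (x 0 i1) (x 0 i2 + 2^-1 * (v 0 i0 * x 0 i1 - v 0 i1 * x 0 i0)).

Variables u w : 'rV[R]_3.
(** The bracket of [u] and [w] is [d] times the central vector. *)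
Let d := u 0 i0 * w 0 i1 - u 0 i1 * w 0 i0.
Hypothesis d0 : d != 0.

Definition heis_basis (i : 'I_3) : 'rV[R]_3 :=
  match i : nat with 0 => rv3 0 0 1 | 1 => u | _ => w end.
Definition heis_frame i := heis_field (heis_basis i).

Lemma heis_field_linear v k x y :
  heis_field (k *: x + y) v = k *: heis_field x v + heis_field y v.
Proof. by apply: row3P; rewrite lincombE /heis_field !rv3E !lincombE; ring. Qed.

Lemma heis_field_smooth x : smooth_on setT (heis_field x).
Proof.
apply: smooth_rowP => [|]; first exact: openT.
apply: forall3; under eq_fun do rewrite rv3E; smooth_rules.
Qed.

Lemma heis_mul_derive p v x : 'D_x (heis_mul p) v = heis_field x p.
Proof.
have -> : heis_mul p = (fun y => p + heis_field y p).
  apply/funext => y; rewrite heis_mulE; apply: row3P; rewrite [RHS]mxE /heis_field !rv3E; ring.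
have dl := is_derive_linear v x (heis_field_linear p).
have dc : is_derive v x (fun=> p) 0 by exact: is_derive_cst.
have dd := is_deriveD dc dl.
by refine (etrans (@derive_val _ _ _ _ _ _ _ dd) _); rewrite add0r.
Qed.

Lemma heis_mul_smooth p : smooth_on setT (heis_mul p).
Proof.
have -> : heis_mul p = (fun y => p + heis_field y p).
  apply/funext => y; rewrite heis_mulE; apply: row3P; rewrite [RHS]mxE /heis_field !rv3E; ring.
apply: smoothD; [exact: openT|exact: smooth_cst|exact: linear_smooth (heis_field_linear p)].
Qed.

Lemma heis_field_derive x v y : 'D_y (heis_field x) v =
  rv3 0 0 (2^-1 * (y 0 i0 * x 0 i1 - y 0 i1 * x 0 i0)).
Proof.
have E : heis_field x = (fun v => x + rv3 0 0 (2^-1 * (v 0 i0 * x 0 i1 - v 0 i1 * x 0 i0))).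
  apply/funext => y'; apply: row3P; rewrite [RHS]mxE /heis_field !rv3E; ring.
have l k (a b : 'rV[R]_3) : rv3 0 0 (2^-1 * ((k *: a + b) 0 i0 * x 0 i1 - (k *: a + b) 0 i1 * x 0 i0)) =
    k *: rv3 0 0 (2^-1 * (a 0 i0 * x 0 i1 - a 0 i1 * x 0 i0)) +
    rv3 0 0 (2^-1 * (b 0 i0 * x 0 i1 - b 0 i1 * x 0 i0)).
  by apply: row3P; rewrite !lincombE !rv3E; do ?rewrite lincombE; ring.
have dl := is_derive_linear v y l.
have dc : is_derive v y (fun=> x) 0 by exact: is_derive_cst.
have dd := is_deriveD dc dl.
by rewrite E; refine (etrans (@derive_val _ _ _ _ _ _ _ dd) _); rewrite add0r.
Qed.

Let emb : 'rV[R]_3 -> 'rV[R]_3 := id.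

Definition heis_chart : chart R 'rV[R]_3 3 := @Chart R 'rV[R]_3 3 setT id id.

Lemma heis_chart_atlas : eg_atlas (H1 R) 3 heis_chart.
Proof.
have sid : smooth_on setT (@id 'rV[R]_3) by apply: smooth_id; exact: openT.
by apply: (@retraction_chart _ _ _ _ _ _ _ _ _ setT id setT id) => //; [move=> x; exact: cvg_id
    |move=> p A pA; exists A|exact: openT|exact: openT].
Qed.

Lemma heis_framed : framed_group emb (@heis_mul R) 0 (fun v => - v) (@heis_mul R) heis_frame.
Proof.
have sid : smooth_on setT (@id 'rV[R]_3) by apply: smooth_id; exact: openT.
have NE v i : (- v) 0 i = - v 0 i by rewrite mxE.
have ZE i : (0 : 'rV[R]_3) 0 i = 0 by rewrite mxE.
split=> //.
- by move=> a; rewrite heis_mulE; apply: row3P; rewrite !rv3E !ZE; ring.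
- by move=> a b; rewrite !heis_mulE; apply: row3P; rewrite !rv3E !NE; ring.
- by move=> a b; rewrite !heis_mulE; apply: row3P; rewrite !rv3E !NE; ring.
- by move=> x; exact: cvg_id.
- by move=> p A pA; exists A.
- by move=> a; exact: heis_mul_smooth.
- by move=> i; exact: heis_field_smooth.
- move=> a b i; rewrite heis_mul_derive /heis_frame /emb heis_mulE.
  by apply: row3P; rewrite /heis_field !rv3E; ring.
- move=> x; rewrite sum3 /heis_frame /emb => /rowP H.
  have h0 := H i0; have h1 := H i1; have h2 := H i2; clear H.
  have E3 (y a b c : 'rV[R]_3) i : (x 0 i0 *: a + x 0 i1 *: b + x 0 i2 *: c) 0 i =
    x 0 i0 * a 0 i + x 0 i1 * b 0 i + x 0 i2 * c 0 i by rewrite !mxE.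
  rewrite E3 // ZE /heis_basis /heis_field /= !rv3E in h0.
  rewrite E3 // ZE /heis_basis /heis_field /= !rv3E in h1.
  rewrite E3 // ZE /heis_basis /heis_field /= !rv3E !ZE in h2.
  have x1 : x 0 i1 = 0.
    apply: (mulIf d0); rewrite mul0r /d.
    transitivity (w 0 i1 * (x 0 i0 * 0 + x 0 i1 * u 0 i0 + x 0 i2 * w 0 i0) -
      w 0 i0 * (x 0 i0 * 0 + x 0 i1 * u 0 i1 + x 0 i2 * w 0 i1)); first by ring.
    by rewrite h0 h1; ring.
  have x2 : x 0 i2 = 0.
    apply: (mulIf d0); rewrite mul0r /d.
    transitivity (u 0 i0 * (x 0 i0 * 0 + x 0 i1 * u 0 i1 + x 0 i2 * w 0 i1) -
      u 0 i1 * (x 0 i0 * 0 + x 0 i1 * u 0 i0 + x 0 i2 * w 0 i0)); first by ring.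
    by rewrite h0 h1; ring.
  apply: row3P; rewrite ZE ?x1 ?x2 //.
  by rewrite -[RHS]h2 x1 x2; ring.
- move=> i; have [c c0 dc] := section_curve (heis_basis i) (sid : smooth_on setT (emb \o id)) I
    (erefl : (id (0 : 'rV[R]_3) = 0)); exists c => //.
  move: dc; rewrite derive_id.
  have -> // : heis_frame i (emb 0) = heis_basis i.
  by apply: row3P; rewrite /heis_frame /heis_field !rv3E /emb ?ZE; ring.
- by exists heis_chart; first exact: heis_chart_atlas.
Qed.

Lemma heis_brackets : frame_brackets emb heis_frame d 0.
Proof.
have E3 (x y : 'rV[R]_3) i : (x - y) 0 i = x 0 i - y 0 i by rewrite !mxE.
have sE k (x : 'rV[R]_3) i : (k *: x) 0 i = k * x 0 i by rewrite mxE.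
split=> q; rewrite !heis_field_derive; apply: row3P;
  by rewrite E3 sE /heis_frame /heis_field /heis_basis /= !rv3E /d; field.
Qed.

(** Coordinates, by Cramer's rule, of the horizontal part of [v] in terms of [u] and [w]. The
    rotation field has components (- t, s) along them, and [heis_rot0] integrates the resulting
    equations E1 y0 = - d s and E2 y0 = - d t. *)
Definition heis_s v := (v 0 i0 * w 0 i1 - v 0 i1 * w 0 i0) / d.
Definition heis_t v := (u 0 i0 * v 0 i1 - u 0 i1 * v 0 i0) / d.
Definition heis_rot0 v := - (d / 2 * (heis_s v ^+ 2 + heis_t v ^+ 2)).

Lemma heis_rotation : rotation_field emb 0 heis_frame d 0
  heis_rot0 (fun v => - heis_t v) heis_s (fun=> 1).
Proof.
have ZE i : (0 : 'rV[R]_3) 0 i = 0 by rewrite mxE.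
split.
- by split; rewrite /heis_rot0 /heis_s /heis_t; smooth_rules.
- by rewrite /heis_rot0 /heis_s /heis_t /emb !ZE; split => //; field.
- move=> q /=; split; (apply: derive_eq; [rewrite /heis_rot0 /heis_s /heis_t; derive_rules|]);
    by rewrite /heis_rot0 /heis_s /heis_t /heis_frame /heis_field /heis_basis /= !rv3E; field.
- move=> q /=; split; (apply: derive_eq; [rewrite /heis_rot0 /heis_s /heis_t; derive_rules|]);
    by rewrite /heis_rot0 /heis_s /heis_t /heis_frame /heis_field /heis_basis /= !rv3E; move: d0; rewrite /d => h; field.
- move=> q /=; split; (apply: derive_eq; [rewrite /heis_rot0 /heis_s /heis_t; derive_rules|]);
    by rewrite /heis_rot0 /heis_s /heis_t /heis_frame /heis_field /heis_basis /= !rv3E; move: d0; rewrite /d => h; field.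
Qed.

Definition heis_proj v : 'rV[R]_2 := rv2 (v 0 i0) (v 0 i1).
(** The inverse of M^T M, where M has the horizontal parts of [u] and [w] as rows: the form for
    which these two are orthonormal. *)
Definition heis_base_metric : 'M[R]_2 := mx2
  ((w 0 i1 ^+ 2 + u 0 i1 ^+ 2) / d ^+ 2) (- (w 0 i0 * w 0 i1 + u 0 i0 * u 0 i1) / d ^+ 2)
  (- (w 0 i0 * w 0 i1 + u 0 i0 * u 0 i1) / d ^+ 2) ((w 0 i0 ^+ 2 + u 0 i0 ^+ 2) / d ^+ 2).

Lemma heis_proj_linear k x y : heis_proj (k *: x + y) = k *: heis_proj x + heis_proj y.
Proof. by apply: row2P; rewrite lincombE /heis_proj ?rv2E0 ?rv2E1 lincombE. Qed.

Let proj_derive x v : 'D_x heis_proj v = heis_proj x.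
Proof.
have dl := is_derive_linear v x heis_proj_linear.
exact: (@derive_val _ _ _ _ _ _ _ dl).
Qed.

Let sig (z : 'rV[R]_2) := rv3 (z 0 k0) (z 0 k1) 0.

Let form2E (a b c : R) (x y : 'rV[R]_2) : form (mx2 a b b c) x y =
  a * (x 0 k0 * y 0 k0) + b * (x 0 k0 * y 0 k1 + x 0 k1 * y 0 k0) + c * (x 0 k1 * y 0 k1).
Proof.
by rewrite /form !mulmx2E !mx2E ![_^T _ _]mxE; ring.
Qed.

Lemma heis_fibration : fibration emb (@heis_mul R) 0 heis_frame heis_proj setT heis_proj
  setT sig (fun=> heis_base_metric).
Proof.
have sp := linear_smooth heis_proj_linear.
split=> //.
- move=> q x; apply: (smooth_continuous (U := setT)) => //.
  apply: smooth_rowP => [|]; first exact: openT.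
  by apply: forall3; under eq_fun do rewrite heis_mulE rv3E; smooth_rules.
- by move=> x; exact: (smooth_continuous sp I).
- move=> p q q' H.
  have h0 := congr1 (fun z : 'rV[R]_2 => z 0 k0) H; rewrite !rv2E0 in h0.
  have h1 := congr1 (fun z : 'rV[R]_2 => z 0 k1) H; rewrite !rv2E1 in h1.
  by rewrite /heis_proj !heis_mulE !rv3E h0 h1.
- exact: openT.
- exact: openT.
- apply: smooth_rowP => [|]; first exact: openT.
  apply: forall3; under eq_fun do rewrite rv3E; smooth_rules.
- by move=> z _; split=> //; apply: row2P; rewrite /heis_proj ?rv2E0 ?rv2E1 !rv3E.
- move=> q _; rewrite proj_derive; apply: row2P; rewrite [RHS]mxE /heis_proj ?rv2E0 ?rv2E1 /heis_frame /heis_field /= !rv3E //.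
- exact: smooth_cst.
- by move=> z _; apply/matrixP; apply: forall2; apply: forall2; rewrite !mxE.
- move=> q _ /=; rewrite !proj_derive !form2E /heis_proj !rv2E0 !rv2E1 /heis_frame /heis_field /heis_basis /= !rv3E.
  by move: d0; rewrite /d => h; split; field.
Qed.

Lemma heis_fibre : fibre_group emb 0 heis_frame heis_proj
  (@id 'rV[R]_1) (fun a b => a + b) 0 (fun a => - a) (fun a b => a + b)
  (fun (i : 'I_1) _ => const_mx 1) (fun z => rv3 0 0 (z 0 0)) (fun z => rv3 0 0 (z 0 0)) 1.
Proof.
have l k (a b : 'rV[R]_1) : rv3 0 0 ((k *: a + b) 0 0) = k *: rv3 0 0 (a 0 0) + rv3 0 0 (b 0 0).
  by apply: row3P; rewrite !lincombE !rv3E; do ?rewrite lincombE; ring.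
split=> //.
- exact: line_framed.
- exact: line_connected.
- exact: linear_smooth l.
- move=> z z' /(congr1 (fun v : 'rV[R]_3 => v 0 i2)); rewrite !rv3E => H.
  by apply/rowP => i; rewrite ord1.
- move=> q; split=> [H|[z <-]]; last by apply: row2P; rewrite /heis_proj ?rv2E0 ?rv2E1 !rv3E mxE.
  have h0 := congr1 (fun z : 'rV[R]_2 => z 0 k0) H; rewrite !rv2E0 mxE in h0.
  have h1 := congr1 (fun z : 'rV[R]_2 => z 0 k1) H; rewrite !rv2E1 mxE in h1.
  by exists (const_mx (q 0 i2)); apply: row3P; rewrite !rv3E ?mxE.
- move=> z; have dl := is_derive_linear z (const_mx 1 : 'rV[R]_1) l.
  refine (etrans (@derive_val _ _ _ _ _ _ _ dl) _); rewrite scale1r.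
  by apply: row3P; rewrite /heis_frame /heis_field /= !rv3E ?mxE; ring.
Qed.

End Heisenberg.

Theorem H1_leaf_space (R : realType) (g : metric R (H1 R) 3) : left_invariant_metric g ->
  leaf_space_has_invariant_metric (eg_atlas (H1 R) 3) g.
Proof.
move=> [metric_g left_g]; have [mg pg] := metric_g.
have Ac := @heis_chart_atlas R.
have [_ /(_ 0)[]] := mg _ Ac; first by exists 0.
move=> sG pG; have [lam [u [w [lam0 d0 hz [uz wz] [uu wu ww]]]]] := gram_schmidt3 sG pG.
have fg := heis_framed d0.
apply: (leaf_space_metric fg (heis_fibration d0) (heis_fibre u w)
  (heis_brackets u w) (heis_rotation d0) lam0 d0 _ metric_g).
- by rewrite eq_sym mulf_neq0 // lt0r_neq0.
- by move=> a; have [_ ?] := left_g a.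
move=> ch Ach c1 i j.
have [cx k1] := chart_cto (eg_is_chart Ach) c1.
(* The Gram matrix is known in the global chart [heis_chart]; the transformation rule of the metric
   carries it to an arbitrary chart around the identity. *)
have Lx : loc_dom ch (@heis_chart R) id (cto ch 0) by split.
have E0 k : 'D_(eps id (heis_frame u w) ch k (cto ch 0)) (loc ch (@heis_chart R) id) (cto ch 0) =
    heis_basis u w k.
  refine (etrans (eps_spec fg k Ach cx) _); rewrite /phi /= k1.
  by apply: row3P; rewrite /heis_frame /heis_field !rv3E ?mxE; ring.
rewrite -(pg _ _ Ach Ac _ Lx) !E0.
have -> : loc ch (@heis_chart R) id (cto ch 0) = 0 by exact: k1.
have ez : rv3 0 0 1 = delta_mx 0 i2 :> 'rV[R]_3 by apply: row3P; rewrite rv3E mxE.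
have zu := uz; rewrite (form_sym _ _ sG) in zu; have zw := wz; rewrite (form_sym _ _ sG) in zw.
have uw := wu; rewrite (form_sym _ _ sG) in uw.
by move: i j; apply: forall3; apply: forall3; rewrite /heis_basis /= ?ez !mxE /= ?mulr1n ?mulr0n.
Qed.

Theorem proposition8p1 (R : realType) :
  (forall (lambda : R) (g : metric R (SU2 R) 3),
     1 < lambda ->
     left_invariant_metric g ->
     represented_at_one g (@su2_basis R) (diag3 lambda 1 1) ->
     leaf_space_has_invariant_metric (eg_atlas (SU2 R) 3) g) /\
  (forall (nu : R) (g : metric R (SU2 R) 3),
     0 < nu < 1 ->
     left_invariant_metric g ->
     represented_at_one g (@su2_basis R) (diag3 1 1 nu) ->
     leaf_space_has_invariant_metric (eg_atlas (SU2 R) 3) g) /\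
  (forall (lambda : R) (g : metric R (SL2 R) 3),
     0 < lambda ->
     left_invariant_metric g ->
     represented_at_one g (@sl2_basis R) (diag3 lambda 1 1) ->
     leaf_space_has_invariant_metric (eg_atlas (SL2 R) 3) g) /\
  (forall g : metric R (H1 R) 3,
     left_invariant_metric g ->
     leaf_space_has_invariant_metric (eg_atlas (H1 R) 3) g).
Proof.
split; first exact: SU2_leaf_space_lambda.
split; first exact: SU2_leaf_space_nu.
by split; [exact: SL2_leaf_space|exact: H1_leaf_space].
Qed.
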